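(* Let $d\ge 1$ be an integer. For each $n\ge 1$, let $\mu_n$ be the uniform probability measure on the finite set of $n$-step self-avoiding walks $\omega=[\omega_0,\omega_1,\dots,\omega_n]$ in $\mathbb{Z}^d$ with $\omega_0=0$ and with $\omega_j\in\{(x^1,\dots,x^d)\in\mathbb{Z}^d : x^1\ge 0\}$ for all $j=0,1,\dots,n$. Then the weak limit of $\mu_n$ as $n\to\infty$ exists. That is, there is a probability measure $\mu$ on infinite nearest-neighbor self-avoiding paths $[\omega_0,\omega_1,\omega_2,\dots]$ in $\mathbb{Z}^d$ starting at $0$ such that for every $k\ge 1$ and every finite sequence $\eta=[\eta_0,\dots,\eta_k]$ of points of $\mathbb{Z}^d$ with $\eta_0=0$, $$\lim_{n\to\infty}\mu_n\bigl\{\omega : \omega_j=\eta_j \text{ for } j=0,1,\dots,k\bigr\}=\mu\bigl\{\omega:\omega_j=\eta_j\text{ for } j=0,1,\dots,k\bigr\}.$$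
   Context: An $n$-step self-avoiding walk in $\mathbb{Z}^d$ is a finite sequence $\omega=[\omega_0,\omega_1,\dots,\omega_n]$ of points of $\mathbb{Z}^d$ such that $|\omega_{j+1}-\omega_j|=1$ (Euclidean norm) for $j=0,\dots,n-1$ and $\omega_j\ne\omega_k$ whenever $0\le j<k\le n$. An infinite nearest-neighbor self-avoiding path is an infinite sequence satisfying the same two conditions for all indices. Weak convergence of measures on $n$-step walks, as $n\to\infty$, to a measure on infinite paths means convergence of the probability of every event determined by finitely many initial steps (in the first displayed quantity, only $n\ge k$ is relevant). The limit measure is called the infinite half-space self-avoiding walk. *)

(* Defs.v *)
From HB Require Import structures.
From mathcomp Require Import all_boot all_order all_algebra finmap.
From mathcomp Require Import all_classical all_reals all_analysis.

Set Implicit Arguments.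
Unset Strict Implicit.
Unset Printing Implicit Defensive.
Import Order.TTheory GRing.Theory Num.Theory.

Local Open Scope classical_set_scope.
Local Open Scope ring_scope.

(* The dimension is d.+1 throughout, so that it is positive and the first
   coordinate of x is x 0 0.  Lengths are measured in the real field R that
   also carries the probabilities. *)
Notation lattice d := 'rV[int]_d.+1.

Definition enorm (R : realType) d (x : lattice d) : R :=
  Num.sqrt (\sum_i (x 0 i)%:~R ^+ 2).

Definition half_space d : set (lattice d) := [set x | 0 <= x 0 0].

(* Arbitrary finite sequences [w_0, ..., w_n], with the discrete
   sigma-algebra. *)
Definition fseq (d n : nat) : Type := {ffun 'I_n.+1 -> lattice d}.
HB.instance Definition _ d n := Choice.on (fseq d n).
Identity Coercion finfun_of_fseq : fseq >-> finfun_of.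
HB.instance Definition _ d n := isPointed.Build (fseq d n) [ffun=> 0].
HB.instance Definition _ d n := @isMeasurable.Build default_measure_display
  (fseq d n) discrete_measurable discrete_measurable0
  discrete_measurableC discrete_measurableU.

Definition is_saw (R : realType) d n (w : fseq d n) : Prop :=
  (forall i j : 'I_n.+1, j = i.+1 :> nat -> enorm R (w j - w i) = 1) /\
  (forall i j : 'I_n.+1, (i < j)%N -> w i <> w j).

Definition half_saw (R : realType) d n : set (fseq d n) :=
  [set w | [/\ is_saw R w, w ord0 = 0 & forall j, half_space (w j)]].
Arguments half_saw R d n : clear implicits.

(* fset_set is only meaningful on finite sets: see finite_half_saw and
   half_saw_neq0 below. *)
Definition unif_half_saw (R : realType) d n (A : set (fseq d n)) : \bar R :=
  (#|` fset_set (half_saw R d n `&` A)|%:R /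
   #|` fset_set (half_saw R d n)|%:R)%:E.
Arguments unif_half_saw R {d n} A.

Definition is_inf_saw (R : realType) d (w : nat -> lattice d) : Prop :=
  (forall j, enorm R (w j.+1 - w j) = 1) /\
  (forall i j, (i < j)%N -> w i <> w j).

Definition inf_saw (R : realType) d : set (nat -> lattice d) :=
  [set w | is_inf_saw R w /\ w 0%N = 0].
Arguments inf_saw R d : clear implicits.

(* [w_0, ..., w_k] = eta; when n < k, which is irrelevant for limits as
   n goes to infinity, only w_0, ..., w_n are compared. *)
Definition starts_with d k (eta : fseq d k) n : set (fseq d n) :=
  [set w | forall (i : 'I_n.+1) (j : 'I_k.+1), i = j :> nat -> w i = eta j].
Arguments starts_with {d k} eta n.

Definition inf_starts_with (R : realType) d k (eta : fseq d k) :
    set (inf_saw R d) :=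
  [set w : inf_saw R d | forall j : 'I_k.+1, val w j = eta j].
Arguments inf_starts_with R {d k} eta.

Definition cylinders (R : realType) d : set (set (inf_saw R d)) :=
  [set C | exists k (eta : fseq d k), C = inf_starts_with R eta].
Arguments cylinders R d : clear implicits.

Lemma enorm1P (R : realType) d (x : lattice d) :
  enorm R x = 1 <-> \sum_i x 0 i ^+ 2 = 1.
Proof.
have -> : enorm R x = Num.sqrt ((\sum_i x 0 i ^+ 2)%:~R).
  rewrite /enorm rmorph_sum; congr Num.sqrt.
  by apply: eq_bigr => i _; rewrite rmorphXn.
have s0 : 0 <= \sum_i x 0 i ^+ 2 by apply: sumr_ge0 => i _; exact: sqr_ge0.
split=> [h|->]; last by rewrite sqrtr1.
have : ((\sum_i x 0 i ^+ 2)%:~R : R) = 1.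
  by rewrite -[LHS]sqr_sqrtr ?ler0z// h expr1n.
by move=> /eqP; rewrite -[1 in X in X -> _]/(1%:~R : R) eqr_int => /eqP.
Qed.

Definition straight d (j : nat) : lattice d :=
  \row_i (if i == 0 then j%:Z else 0).

Lemma straight_step (R : realType) d j :
  enorm R (straight d j.+1 - straight d j) = 1.
Proof.
apply/enorm1P; rewrite (bigD1 0)//= big1 => [|i i0].
  by rewrite !mxE eqxx addr0 intS addrK.
by rewrite !mxE (negbTE i0) subr0 expr0n.
Qed.

Lemma straight_inj d : injective (straight d).
Proof. by move=> i j /matrixP/(_ 0 0); rewrite !mxE eqxx => -[]. Qed.

Lemma straight0 d : straight d 0 = 0.
Proof. by apply/matrixP => i j; rewrite !mxE; case: ifP. Qed.

Lemma straight_inf_saw (R : realType) d : inf_saw R d (straight d).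
Proof.
split; last exact: straight0.
split=> [j|i j ij /straight_inj e]; first exact: straight_step.
by rewrite e ltnn in ij.
Qed.

HB.instance Definition _ (R : realType) d :=
  isPointed.Build (inf_saw R d) (SigSub (mem_set (straight_inf_saw R d))).

Lemma half_saw_neq0 (R : realType) d n : half_saw R d n !=set0.
Proof.
exists [ffun j => straight d (val j)]; split=> /=.
- split=> [i j ij|i j ij]; rewrite !ffunE.
    by rewrite ij straight_step.
  by move=> /straight_inj e; rewrite e ltnn in ij.
- by rewrite ffunE straight0.
- by move=> j; rewrite /half_space/= ffunE mxE eqxx.
Qed.

Lemma half_saw_bound (R : realType) d n (w : fseq d n) :
  half_saw R d n w -> forall j i, `|w j 0 i| <= n%:Z.
Proof.
move=> [[w1 _] w0 _] j i.
suff H m (mn : (m < n.+1)%N) : `|w (Ordinal mn) 0 i| <= m%:Z.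
  case: j => j jn; apply: (le_trans (H _ jn)).
  by rewrite lez_nat -ltnS.
elim: m mn => [|m IH] mn.
  by rewrite (_ : Ordinal mn = ord0) ?w0 ?mxE ?normr0//; apply: val_inj.
have mn' := ltnW mn.
have /enorm1P s1 := w1 (Ordinal mn') (Ordinal mn) erefl.
rewrite -[w (Ordinal mn) 0 i](subrK (w (Ordinal mn') 0 i)).
rewrite (le_trans (ler_normD _ _))// intS lerD//.
have : (w (Ordinal mn) 0 i - w (Ordinal mn') 0 i) ^+ 2 <= 1.
  rewrite -s1 (bigD1 i)//= !mxE lerDl; apply: sumr_ge0 => k _.
  exact: sqr_ge0.
by rewrite -real_normK ?num_real ?expr_le1.
Qed.

Lemma finite_half_saw (R : realType) d n : finite_set (half_saw R d n).
Proof.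
pose dec (g : {ffun 'I_n.+1 -> {ffun 'I_d.+1 -> 'I_(n + n).+1}}) : fseq d n :=
  [ffun j => \row_i ((g j i)%:Z - n%:Z)].
apply: (@sub_finite_set _ _ (dec @` setT)); last first.
  by apply: finite_image; exact: finite_finset.
move=> w hw; have b := half_saw_bound hw.
exists [ffun j => [ffun i => inord (absz (w j 0 i + n%:Z))]] => //.
apply/ffunP => j; apply/rowP => i; rewrite !ffunE mxE !ffunE.
have /andP[l u] : - n%:Z <= w j 0 i <= n%:Z by rewrite -ler_norml.
have p0 : 0 <= w j 0 i + n%:Z by rewrite -lerBlDr sub0r.
rewrite inordK; first by rewrite gez0_abs// addrK.
by rewrite ltnS -lez_nat gez0_abs// PoszD lerD2r.
Qed.

Lemma unif_half_sawE (R : realType) d n :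
  @unif_half_saw R d n =
  mnormalize (mrestr (@counting (fseq d n) R)
    (I : measurable (half_saw R d n))) (dirac point).
Proof.
have fH := finite_half_saw R d n.
have e : mrestr (@counting (fseq d n) R) (I : measurable (half_saw R d n)) setT
    = (#|` fset_set (half_saw R d n)|)%:R%:E.
  by rewrite /mrestr setTI /counting asboolT.
apply/funext => A; rewrite /mnormalize/= e/= eqe pnatr_eq0 orbF.
rewrite cardfs_eq0 ifF; last first.
  apply/negbTE/eqP => /(congr1 (fun X : {fset _} => [set` X])).
  rewrite fset_setK// set_fset0 => H0.
  by have [w] := half_saw_neq0 R d n; rewrite H0.
by rewrite /mrestr setIC /counting asboolT//; exact: finite_setIl.
Qed.

Section unif_half_saw_probability.
Context (R : realType) (d n : nat).
Local Notation mu := (@unif_half_saw R d n).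

Let mu0 : mu set0 = 0%E.
Proof. by rewrite unif_half_sawE measure0. Qed.
Let mu_ge0 A : (0 <= mu A)%E.
Proof. by rewrite unif_half_sawE measure_ge0. Qed.
Let mu_sigma_additive : semi_sigma_additive mu.
Proof. by rewrite unif_half_sawE; exact: measure_semi_sigma_additive. Qed.
HB.instance Definition _ := isMeasure.Build _ _ _ mu
  mu0 mu_ge0 mu_sigma_additive.

Let mu_setT : mu setT = 1%E.
Proof. by rewrite unif_half_sawE probability_setT. Qed.
HB.instance Definition _ := Measure_isProbability.Build _ _ _ mu mu_setT.

End unif_half_saw_probability.

(* Main.v *)
(* Let h_n count the n-step half-space walks and let mu be the connective constant.
   By Hammersley and Welsh, the generating function of bridges diverges at 1/mu, so
   the irreducible bridges b satisfy sum_b mu^(-|b|) = 1 (Kesten).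

   A bump is a factor s, t, -s of the step sequence. Walks with few bumps are
   exponentially rare: a bump-free walk whose rectangles of side 2 x 1 based at a
   step contain at most k sites of the walk can, as long as many of its pieces
   contain k of them, be rerouted inside many disjoint rectangles, which creates
   bumps that say where the rerouting took place; hence such walks have growth
   rate less than mu, by induction on k. Replacing a step t by a bump s, t, -s
   relates the walks of lengths n and n + 2, and the Cauchy-Schwarz inequality
   gives h_(n+2)^2 <= h_n h_(n+4) + (D/n) h_n^2, whence
   limsup h_(n+2) / h_n <= mu^2. Cutting off the first irreducible bridge gives
   the renewal inequality h_n >= sum_b h_(n-|b|), which together with this bound
   forces h_n / h_(n+1) -> 1/mu.

   A half-space walk that starts with an irreducible bridge b is b followed by an
   arbitrary half-space walk, and by the two limits above all but a small
   proportion of the walks start with an irreducible bridge of bounded length.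
   Induction on |u| then shows that the proportion of the walks that start with
   the word u converges. The limits p(u) are consistent, and the path whose law
   they describe is read off a uniform point of [0, 1[ from nested intervals of
   lengths p(u). *)

(* The lattice is bipartite, so changing a walk between two fixed sites preserves the parity of its
   length: inserting bumps can only compare $h_n$ with $h_{n+2}$. The parity is broken by the
   irreducible bridge that consists of the single step [e1]: in the renewal inequality it puts mass
   at least $1/\mu$ on odd lengths, and this turns a one-sided bound on the two-step ratio into a
   limit for the one-step ratio. Rerouting needs a second axis, so dimension one is settled directly
   in [nhalf_add2_le]. Rectangles of neighbouring steps may overlap; only those whose base points
   agree mod 5 are rerouted together, and one of these residue classes still contains a positive
   fraction of the available rectangles. *)
From HB Require Import structures.
Require Import Defs.
From mathcomp Require Import all_boot all_order all_algebra finmap.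
From mathcomp Require Import all_classical all_reals all_analysis.
From mathcomp Require Import ring lra zify.

Set Implicit Arguments.
Unset Strict Implicit.
Unset Printing Implicit Defensive.
Import Order.TTheory GRing.Theory Num.Theory numFieldNormedType.Exports.
Local Open Scope classical_set_scope.
Local Open Scope ring_scope.

(** * Comparing finite sums along injections *)

Section BigSeq.
Context (R : numDomainType).

Lemma ler_sum_sub_seq (T : eqType) (s1 s2 : seq T) (F : T -> R) :
  uniq s1 -> {subset s1 <= s2} -> (forall x, x \in s2 -> 0 <= F x) ->
  \sum_(x <- s1) F x <= \sum_(x <- s2) F x.
Proof.
elim: s1 s2 => [|x s1 IH] s2 /=.
  by move=> _ _ F0; rewrite big_nil big_seq; apply: sumr_ge0.
move=> /andP[xs1 us1] s12 F0; have xs2 : x \in s2 by apply: s12; rewrite mem_head.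
rewrite big_cons (perm_big _ (perm_to_rem xs2)) big_cons lerD2l; apply: IH => //.
- move=> y ys1; have := s12 y; rewrite inE ys1 orbT => /(_ isT) ys2.
  have yx : y != x by apply: contraNneq xs1 => <-.
  have := perm_mem (perm_to_rem xs2) y.
  by rewrite ys2 inE (negbTE yx).
- by move=> y /mem_rem; apply: F0.
Qed.

Lemma ler_sum_inj (T U : eqType) (s1 : seq T) (s2 : seq U) (f : T -> U)
    (F : T -> R) (G : U -> R) :
  uniq s1 -> {in s1 &, injective f} ->
  (forall x, x \in s1 -> f x \in s2 /\ F x <= G (f x)) ->
  (forall y, y \in s2 -> 0 <= G y) ->
  \sum_(x <- s1) F x <= \sum_(y <- s2) G y.
Proof.
move=> us1 fi fP G0.
apply: (@le_trans _ _ (\sum_(x <- s1) G (f x))).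
  by rewrite big_seq [leRHS]big_seq; apply: ler_sum => x /fP[].
rewrite -(big_map f xpredT G); apply: ler_sum_sub_seq => //.
  by rewrite map_inj_in_uniq.
by move=> y /mapP[x /fP[? _] ->].
Qed.

Lemma count_sumr (T : Type) (P : pred T) (s : seq T) :
  (count P s)%:R = \sum_(x <- s | P x) 1 :> R.
Proof. by rewrite -sum1_count natr_sum. Qed.

End BigSeq.

Lemma leq_size_inj (T U : eqType) (s1 : seq T) (s2 : seq U) (f : T -> U) :
  uniq s1 -> {in s1 &, injective f} -> (forall x, x \in s1 -> f x \in s2) ->
  (size s1 <= size s2)%N.
Proof.
move=> us1 fi fP; rewrite -(size_map f); apply: uniq_leq_size.
  by rewrite map_inj_in_uniq.
by move=> y /mapP[x /fP ? ->].
Qed.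

(* A walk from 0 is encoded by its steps; a step (i, b) moves along the i-th
   axis, in the positive direction when b = true. *)
Notation step d := ('I_d.+1 * bool)%type.
Notation word d := (seq (step d)).

(** * Words of steps and the sites they visit *)

Section Words.
Context (d : nat).
Implicit Types (s t : step d) (u v w : word d) (x y : lattice d).

Definition sv s : lattice d := if s.2 then delta_mx 0 s.1 else - delta_mx 0 s.1.
Definition ops s : step d := (s.1, ~~ s.2).

Lemma opsK : involutive ops. Proof. by case=> i b; rewrite /ops /= negbK. Qed.
Lemma sv_ops s : sv (ops s) = - sv s.
Proof. by case: s => i []; rewrite /sv /= ?opprK. Qed.

Lemma svE s j : sv s 0 j = if j == s.1 then (if s.2 then 1 else -1) else 0.
Proof.
case: s => i b; rewrite /sv /=; case: b; rewrite !mxE eqxx /= eq_sym;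
  by case: ifP => _ //=; rewrite ?oppr0.
Qed.

Lemma sv_inj : injective sv.
Proof.
move=> [i b] [j c] /rowP e.
have := e i; rewrite !svE /= eqxx {e}; case: eqP => [<-|_]; last by case: b.
by case: b; case: c.
Qed.

Fixpoint disp w : lattice d := if w is s :: w' then sv s + disp w' else 0.
(* The sites visited by w from x, except the last one, which [traj] adds. *)
Fixpoint vis x w : seq (lattice d) :=
  if w is s :: w' then x :: vis (x + sv s) w' else [::].
Definition traj x w := rcons (vis x w) (x + disp w).

Lemma disp_cat u v : disp (u ++ v) = disp u + disp v.
Proof. by elim: u => [|s u IH] /=; rewrite ?add0r // IH addrA. Qed.

Lemma vis_cat x u v : vis x (u ++ v) = vis x u ++ vis (x + disp u) v.
Proof. by elim: u x => [|s u IH] x /=; rewrite ?addr0 // IH addrA. Qed.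

Lemma traj_cat x u v : traj x (u ++ v) = vis x u ++ traj (x + disp u) v.
Proof. by rewrite /traj vis_cat disp_cat addrA rcons_cat. Qed.

Lemma traj_cons x s w : traj x (s :: w) = x :: traj (x + sv s) w.
Proof. by rewrite /traj /= addrA. Qed.

Lemma traj_nil x : traj x [::] = [:: x].
Proof. by rewrite /traj /= addr0. Qed.

Lemma size_vis x w : size (vis x w) = size w.
Proof. by elim: w x => //= s w IH x; rewrite IH. Qed.

Lemma size_traj x w : size (traj x w) = (size w).+1.
Proof. by rewrite size_rcons size_vis. Qed.

Lemma traj_head x w : traj x w = x :: behead (traj x w).
Proof. by case: w => [|s w]; rewrite ?traj_nil // traj_cons. Qed.

Lemma mem_traj_head x w : x \in traj x w.
Proof. by rewrite traj_head mem_head. Qed.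

Lemma mem_traj_last x w : x + disp w \in traj x w.
Proof. by rewrite mem_rcons mem_head. Qed.

Lemma mem_traj x w y : (y \in traj x w) = (y == x + disp w) || (y \in vis x w).
Proof. by rewrite mem_rcons inE. Qed.

Lemma mem_vis_traj x w y : y \in vis x w -> y \in traj x w.
Proof. by rewrite mem_traj => ->; rewrite orbT. Qed.

Lemma traj_catr x u v : traj x (u ++ v) = traj x u ++ behead (traj (x + disp u) v).
Proof. by rewrite traj_cat {1}(traj_head (x + disp u)) -cat_rcons. Qed.

Lemma mem_traj_cat x u v y :
  (y \in traj x (u ++ v)) = (y \in traj x u) || (y \in traj (x + disp u) v).
Proof.
rewrite traj_cat mem_cat mem_traj; case: eqP => [->|_] //=.
by rewrite mem_traj_head !orbT.
Qed.

Lemma vis_shift y x w : vis (y + x) w = map (+%R y) (vis x w).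
Proof. by elim: w x => //= s w IH x; rewrite -IH addrA. Qed.

Lemma traj_shift y x w : traj (y + x) w = map (+%R y) (traj x w).
Proof. by rewrite /traj map_rcons vis_shift addrA. Qed.

Lemma traj0_shift x w : traj x w = map (+%R x) (traj 0 w).
Proof. by rewrite -traj_shift addr0. Qed.

Lemma vis0_shift x w : vis x w = map (+%R x) (vis 0 w).
Proof. by rewrite -vis_shift addr0. Qed.

Lemma mem_traj_shift x w y : (y \in traj x w) = (y - x \in traj 0 w).
Proof.
by rewrite traj0_shift -{1}[y](subrKC x) mem_map //; apply: addrI.
Qed.

Definition saw w := uniq (traj 0 w).

Lemma saw_shift x w : uniq (traj x w) = saw w.
Proof. by rewrite traj0_shift map_inj_uniq //; apply: addrI. Qed.

Lemma saw_cat u v : saw (u ++ v) ->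
  [/\ saw u, saw v & forall x y, y \in vis x u -> y \in traj (x + disp u) v -> False].
Proof.
move=> s; split.
- by move: s; rewrite /saw traj_catr cat_uniq => /andP[].
- by move: s; rewrite /saw traj_cat cat_uniq => /and3P[_ _]; rewrite saw_shift.
- move=> x y; move: s; rewrite -(saw_shift x) traj_cat cat_uniq => /and3P[_ + _].
  by move=> /hasPn h yu /h /=; rewrite yu.
Qed.

Lemma saw_catE u v : saw (u ++ v) =
  [&& saw u, saw v & ~~ has (mem (vis 0 u)) (traj (disp u) v)].
Proof.
apply/idP/idP.
  move=> s; case/saw_cat: (s) => -> -> _ /=.
  by move: s; rewrite /saw traj_cat cat_uniq add0r => /and3P[].
move=> /and3P[su sv h]; rewrite /saw traj_cat cat_uniq add0r saw_shift sv h !andbT.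
by move: su; rewrite /saw rcons_uniq => /andP[].
Qed.

Definition rv w := rev (map ops w).

Lemma rvK : involutive rv.
Proof. by move=> w; rewrite /rv map_rev revK -map_comp map_id_in // => s _; apply: opsK. Qed.

Lemma size_rv w : size (rv w) = size w.
Proof. by rewrite size_rev size_map. Qed.

Lemma disp_rv w : disp (rv w) = - disp w.
Proof.
elim: w => [|s w IH]; first by rewrite /= oppr0.
by rewrite /rv /= rev_cons -cats1 disp_cat /= -/(rv w) IH sv_ops addr0 opprD addrC.
Qed.

Lemma traj_rv x w : traj (x + disp w) (rv w) = rev (traj x w).
Proof.
elim: w x => [|s w IH] x; first by rewrite /= addr0 traj_nil.
rewrite traj_cons rev_cons -IH /rv /= rev_cons -cats1 -/(rv w) addrA traj_catr.
rewrite disp_rv traj_cons traj_nil /= sv_ops -cats1; congr (_ ++ [:: _]).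
by rewrite addrK addrK.
Qed.

Lemma saw_rv w : saw (rv w) = saw w.
Proof. by rewrite -(saw_shift (0 + disp w)) traj_rv rev_uniq. Qed.

Fixpoint words n : seq (word d) :=
  if n is n'.+1 then [seq s :: w | s <- enum {: step d}, w <- words n'] else [:: [::]].

Lemma mem_words n w : (w \in words n) = (size w == n).
Proof.
elim: n w => [|n IH] [|s w] //=.
  by apply/allpairsP => -[[? ?]] /= [].
rewrite eqSS -IH; apply/allpairsP/idP => [[[t v]] /= [_ h [_ ->]] //|h].
by exists (s, w); rewrite /= mem_enum.
Qed.

Lemma uniq_words n : uniq (words n).
Proof.
elim: n => //= n IH; apply: allpairs_uniq => //; first exact: enum_uniq.
by move=> [? ?] [? ?] _ _ /= [-> ->].
Qed.

Lemma size_words n : size (words n) = ((2 * d.+1) ^ n)%N.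
Proof.
elim: n => //= n IH; rewrite size_allpairs IH -cardE card_prod card_ord card_bool.
by rewrite expnS (mulnC d.+1).
Qed.

Definition cnt (P : pred (word d)) n := count P (words n).
Definition wf (P : pred (word d)) n := [seq w <- words n | P w].

Lemma size_wf P n : size (wf P n) = cnt P n.
Proof. by rewrite size_filter. Qed.

Lemma mem_wf P n w : (w \in wf P n) = P w && (size w == n).
Proof. by rewrite mem_filter mem_words. Qed.

Lemma uniq_wf P n : uniq (wf P n).
Proof. exact: filter_uniq (uniq_words n). Qed.

Lemma cnt_sub (P Q : pred (word d)) n : (forall w, size w = n -> P w -> Q w) ->
  (cnt P n <= cnt Q n)%N.
Proof.
move=> h; rewrite -!size_wf; apply: uniq_leq_size; first exact: uniq_wf.
by move=> w; rewrite !mem_wf => /andP[Pw /eqP sw]; rewrite h // sw eqxx.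
Qed.

Lemma cnt_le_words P n : (cnt P n <= (2 * d.+1) ^ n)%N.
Proof. by rewrite -size_words; apply: count_size. Qed.

Definition factor_closed (P : pred (word d)) :=
  forall u v, P (u ++ v) -> P u && P v.

Lemma cnt_cat (P Q S : pred (word d)) m n :
  (forall u v, size u = m -> size v = n -> P (u ++ v) -> Q u && S v) ->
  (cnt P (m + n) <= cnt Q m * cnt S n)%N.
Proof.
move=> h; rewrite -!size_wf -(size_allpairs pair).
apply: (leq_size_inj (f := fun w => (take m w, drop m w))); first exact: uniq_wf.
  by move=> w w' _ _ [e1 e2]; rewrite -(cat_take_drop m w) e1 e2 cat_take_drop.
move=> w; rewrite mem_wf => /andP[Pw /eqP sw].
have st : size (take m w) = m by rewrite size_takel // sw leq_addr.
have sd : size (drop m w) = n by rewrite size_drop sw addKn.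
have /andP[Qu Sv] := h _ _ st sd (etrans (congr1 P (cat_take_drop m w)) Pw).
by apply/allpairsP; exists (take m w, drop m w); rewrite !mem_wf Qu Sv st sd !eqxx.
Qed.

Lemma saw_factor_closed : factor_closed saw.
Proof. by move=> u v /saw_cat[-> ->]. Qed.

End Words.

(** * Walks in the half-space *)

Section HalfSpace.
Context (d : nat).
Implicit Types (s t : step d) (u v w : word d) (x y : lattice d).

Definition e1 : step d := (ord0, true).
Definition nonneg w := all (fun x : lattice d => 0 <= x 0 0) (traj 0 w).
Definition half w := saw w && nonneg w.

Lemma sv_e1 : sv e1 0 0 = 1. Proof. by rewrite svE. Qed.

(** The condition is translation invariant, so for a suffix of a walk it can be read off from the
    site where the suffix begins. *)
Lemma nonnegP x w : reflect (forall y, y \in traj x w -> x 0 0 <= y 0 0) (nonneg w).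
Proof.
apply: (iffP allP) => h y.
  by rewrite mem_traj_shift => /h; rewrite !mxE subr_ge0.
move=> yw; have /h : x + y \in traj x w by rewrite mem_traj_shift [x + y]addrC addrK.
by rewrite mxE lerDl.
Qed.

(** After the initial step up the walk stays at height at least 1 and cannot return to 0. Hence
    $h_n$ is positive and non-decreasing. *)
Lemma half_e1 w : half w -> half (e1 :: w).
Proof.
move=> /andP[sw /nonnegP nw]; apply/andP; split.
  rewrite /saw traj_cons /= saw_shift sw andbT; apply/negP => /nw.
  by rewrite add0r sv_e1 mxE.
apply/(nonnegP 0) => y; rewrite traj_cons inE => /orP[/eqP->//|/nw].
by rewrite add0r sv_e1 mxE; apply: le_trans.
Qed.

Lemma half_straight n : half (nseq n e1).
Proof.
elim: n => [|n IH]; last exact: half_e1.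
by rewrite /half /saw /nonneg traj_nil /= mxE.
Qed.

Lemma half_saw_word w : half w -> saw w. Proof. by case/andP. Qed.

Lemma cnt_half_gt0 n : (0 < cnt half n)%N.
Proof.
rewrite -has_count; apply/hasP; exists (nseq n e1); last exact: half_straight.
by rewrite mem_words size_nseq.
Qed.

Lemma cnt_half_le_saw n : (cnt half n <= cnt (@saw d) n)%N.
Proof. by apply: cnt_sub => w _ /half_saw_word. Qed.

Lemma cnt_saw_gt0 n : (0 < cnt (@saw d) n)%N.
Proof. exact: leq_trans (cnt_half_gt0 n) (cnt_half_le_saw n). Qed.

Lemma cnt_saw_submul m n :
  (cnt (@saw d) (m + n) <= cnt (@saw d) m * cnt (@saw d) n)%N.
Proof. by apply: cnt_cat => u v _ _ /saw_factor_closed. Qed.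

End HalfSpace.

(** * Exponential growth rates and the connective constant *)

Lemma bernoulli (R : realDomainType) (x : R) n : -1 <= x -> 1 + x *+ n <= (1 + x) ^+ n.
Proof.
move=> x1; have x0 : 0 <= 1 + x by rewrite addrC -[1]opprK subr_ge0.
elim: n => [|n IH]; first by rewrite mulr0n addr0 expr0.
rewrite exprS; apply: le_trans (ler_wpM2l x0 IH).
rewrite -!(mulr_natr x) -natr1.
by have := mulr_ge0 (sqr_ge0 x) (ler0n R n); lra.
Qed.

Lemma expr_unbounded (R : archiRealFieldType) (b C : R) : 1 < b -> exists n, C < b ^+ n.
Proof.
move=> b1; pose e := b - 1; have e0 : 0 < e by rewrite subr_gt0.
exists (Num.bound (`|C| / e)).
have /archi_boundP : 0 <= `|C| / e by rewrite divr_ge0 // ltW.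
rewrite ltr_pdivrMr //; set n := Num.Def.archi_bound _ => h.
apply: le_lt_trans (ler_norm C) _; apply: lt_le_trans h _.
have -> : b = 1 + e by rewrite /e addrC subrK.
apply: le_trans (bernoulli n _); last by rewrite (le_trans _ (ltW e0)) // oppr_le0.
by rewrite mulr_natl lerDr.
Qed.

Section Growth.
Context (R : realType) (d : nat).

Definition growth_le (a : nat -> R) (x : R) :=
  exists2 C, 0 < C & forall n, a n <= C * x ^+ n.

Lemma growth_leW a x y : 0 < x -> x <= y -> growth_le a x -> growth_le a y.
Proof.
move=> x0 xy [C C0 h]; exists C => // n; apply: (le_trans (h n)).
by rewrite ler_pM2l // lerXn2r // nnegrE ltW // (lt_le_trans x0).
Qed.

Definition nsaw n : R := (cnt (@saw d) n)%:R.
Definition nhalf n : R := (cnt (@half d) n)%:R.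

Lemma nsaw_ge1 n : 1 <= nsaw n. Proof. by rewrite ler1n cnt_saw_gt0. Qed.
Lemma nhalf_ge1 n : 1 <= nhalf n. Proof. by rewrite ler1n cnt_half_gt0. Qed.
Lemma nhalf_gt0 n : 0 < nhalf n. Proof. by rewrite ltr0n cnt_half_gt0. Qed.
Lemma nhalf_le n : nhalf n <= nsaw n. Proof. by rewrite ler_nat cnt_half_le_saw. Qed.
Lemma nsawM m n : nsaw (m + n) <= nsaw m * nsaw n.
Proof. by rewrite -natrM ler_nat cnt_saw_submul. Qed.

(* The connective constant. *)
Definition mu : R := inf [set x : R | 0 < x /\ growth_le nsaw x].

Let twoD : R := (2 * d.+1)%:R.

Let mu_set_nonempty : [set x : R | 0 < x /\ growth_le nsaw x] twoD.
Proof.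
split; first by rewrite ltr0n.
by exists 1 => // n; rewrite mul1r -natrX ler_nat cnt_le_words.
Qed.

Let mu_set_lb (x : R) : 0 < x -> growth_le nsaw x -> 1 <= x.
Proof.
move=> x0 [C C0 h]; rewrite leNgt; apply/negP => x1.
have hx n : 1 <= C * x ^+ n by apply: le_trans (h n); apply: nsaw_ge1.
have /(expr_unbounded C)[n] : 1 < x^-1 by rewrite invf_gt1.
apply/negP; rewrite -leNgt exprVn -[_^-1]mul1r ler_pdivrMr ?exprn_gt0 //.
Qed.

Let mu_has_inf : has_inf [set x : R | 0 < x /\ growth_le nsaw x].
Proof. by split; [exists twoD | exists 1 => x [x0 hx]; apply: mu_set_lb]. Qed.

Lemma mu_ge1 : 1 <= mu.
Proof.
apply: lb_le_inf; first by exists twoD.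
by move=> x [x0 hx]; apply: mu_set_lb.
Qed.

Lemma mu_gt0 : 0 < mu. Proof. exact: lt_le_trans mu_ge1. Qed.

Lemma growth_le_mu (x : R) : mu < x -> growth_le nsaw x.
Proof.
move=> mx; have : 0 < x - mu by rewrite subr_gt0.
move=> /inf_adherent/(_ mu_has_inf)[y [y0 hy]]; rewrite -/mu subrKC => /ltW yx.
exact: growth_leW y0 yx hy.
Qed.

(** Divide n by m; the sum in the constant pays for the remainders r < m. *)
Lemma growth_submul (a : nat -> R) (y : R) m : (0 < m)%N -> 0 < y ->
  (forall n, 0 <= a n) -> (forall n k, a (n + k)%N <= a n * a k) ->
  a m <= y ^+ m -> growth_le a y.
Proof.
move=> m0 y0 a0 aM am.
have C0 : 0 <= \sum_(r < m) a r / y ^+ r.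
  by apply: sumr_ge0 => r _; rewrite divr_ge0 // exprn_ge0 // ltW.
exists (1 + \sum_(r < m) a r / y ^+ r); first by rewrite (lt_le_trans ltr01) // lerDl.
move=> n; rewrite {1}(divn_eq n m).
have h q r : a (q * m + r)%N <= (y ^+ m) ^+ q * a r.
  elim: q => [|q IH]; first by rewrite mul0n add0n expr0 mul1r.
  rewrite mulSn -addnA; apply: (le_trans (aM _ _)).
  rewrite exprS -mulrA; apply: ler_pM => //.
apply: (le_trans (h _ _)).
rewrite [in X in _ <= X](divn_eq n m) exprD -exprM (mulnC m) mulrCA ler_pM2l ?exprn_gt0 //.
rewrite -ler_pdivrMr ?exprn_gt0 // (bigD1 (Ordinal (ltn_pmod n m0))) //= addrCA lerDl.
rewrite addr_ge0 // sumr_ge0 // => r _; rewrite divr_ge0 // exprn_ge0 // ltW //.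
Qed.

(** Otherwise some y < [mu] still satisfies nsaw m <= y^m, and submultiplicativity makes y a growth
    rate below the infimum. *)
Lemma mu_le_nsaw n : mu ^+ n <= nsaw n.
Proof.
case: n => [|n]; first by rewrite expr0 nsaw_ge1.
rewrite leNgt; apply/negP => h; set m := n.+1 in h.
have m0 : 0 < m%:R :> R by rewrite ltr0n.
have mum0 : 0 < mu ^+ m by rewrite exprn_gt0 // mu_gt0.
pose e := 1 - nsaw m / mu ^+ m.
have e0 : 0 < e by rewrite subr_gt0 ltr_pdivrMr // mul1r.
have e1 : e <= 1 by rewrite gerBl divr_ge0 // ltW.
(* By Bernoulli (1 - e / (2m))^m >= 1 - e / 2, which exceeds 1 - e = nsaw m / mu^m. *)
pose y := mu * (1 - e / m%:R / 2).
have em : e / m%:R <= 1 by rewrite ler_pdivrMr // mul1r (le_trans e1) // ler1n.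
have em0 : 0 < e / m%:R by rewrite divr_gt0.
have y0 : 0 < y by rewrite mulr_gt0 ?mu_gt0 // ; lra.
have ymu : y < mu by rewrite gtr_pMr ?mu_gt0 //; lra.
have cy : nsaw m <= y ^+ m.
  rewrite exprMn -ler_pdivrMl // mulrC.
  have -> : nsaw m / mu ^+ m = 1 - e by rewrite /e subKr.
  apply: le_trans (bernoulli m _); last by lra.
  rewrite lerD2l mulNrn lerN2 -(mulr_natr (e / m%:R / 2)).
  by rewrite mulrAC divfK ?gt_eqF //; lra.
have : mu <= y.
  apply: ge_inf; first by case: mu_has_inf.
  split=> //; apply: (growth_submul (m := m)) => // *; exact: nsawM.
by rewrite leNgt ymu.
Qed.

End Growth.

(** * Walks with few bumps are exponentially rare *)

Section Bumps.
Context (d : nat).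
Implicit Types (s t : step d) (u v w : word d) (x y : lattice d).
Local Notation s0 := (e1 d).

(** The middle step is free: in a self-avoiding walk it has to be perpendicular to the outer ones.
    The bound on i keeps the default value of [nth] out. *)
Definition bumpat w i := (i.+2 < size w)%N && (nth s0 w i.+2 == ops (nth s0 w i)).
Definition nbump w := count (bumpat w) (iota 0 (size w)).
Definition bumpfree w := ~~ has (bumpat w) (iota 0 (size w)).
Definition fbump w := find (bumpat w) (iota 0 (size w)).

Lemma bumpat_size w i : bumpat w i -> (i < size w)%N.
Proof. by case/andP => h _; apply: leq_trans _ h; rewrite ltnS leqW // leqnSn. Qed.

Lemma bumpfreeP w : reflect (forall i, ~~ bumpat w i) (bumpfree w).
Proof.
apply: (iffP hasPn) => h i; last by [].
apply/negP => b; have := h i; rewrite mem_iota add0n leq0n (bumpat_size b) b.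
by move=> /(_ isT).
Qed.

Lemma nbump_eq0 w : (nbump w == 0%N) = bumpfree w.
Proof. by rewrite /bumpfree has_count -leqNgt leqn0. Qed.

Lemma bumpat_catr u v i : bumpat (u ++ v) (size u + i) = bumpat v i.
Proof.
rewrite /bumpat size_cat -addnS -addnS ltn_add2l !nth_cat.
by rewrite !ltnNge !leq_addr /= !addKn.
Qed.

Lemma bumpat_cat_lt u v i : (i.+2 < size u)%N -> bumpat (u ++ v) i = bumpat u i.
Proof.
move=> h; rewrite /bumpat size_cat (leq_trans h (leq_addr _ _)) h !nth_cat h.
by have -> : (i < size u)%N by lia.
Qed.

Lemma bumpat_catl u v i : bumpat u i -> bumpat (u ++ v) i.
Proof. by move=> b; rewrite bumpat_cat_lt //; case/andP: b. Qed.

Lemma bumpfree_factor_closed : factor_closed bumpfree.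
Proof.
move=> u v /bumpfreeP h; apply/andP; split; apply/bumpfreeP => i.
  by apply: contra (h i); apply: bumpat_catl.
by have := h (size u + i)%N; rewrite bumpat_catr.
Qed.

Lemma fbump_le w i : bumpat w i -> (fbump w <= i)%N.
Proof.
move=> b; rewrite leqNgt; apply/negP => /(before_find 0%N).
by rewrite nth_iota ?(bumpat_size b) // add0n b.
Qed.

Lemma bumpat_fbump w i : bumpat w i -> bumpat w (fbump w).
Proof.
move=> b; have h : has (bumpat w) (iota 0 (size w)).
  by apply/hasP; exists i => //; rewrite mem_iota add0n bumpat_size.
have := nth_find 0%N h; rewrite nth_iota //.
by rewrite -[X in (_ < X)%N](size_iota 0) -has_find.
Qed.

(** A bump that starts at i occupies i, i + 1 and i + 2, so one that is not inside u starts at size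
    u - 2 or later. This is why [encode] measures offsets from fbump + 2. *)
Lemma fbump_ge u v i : bumpfree u -> bumpat (u ++ v) i ->
  (size u <= fbump (u ++ v) + 2)%N.
Proof.
move=> /bumpfreeP bu /bumpat_fbump b; rewrite leqNgt addn2; apply/negP => h.
by have := bu (fbump (u ++ v)); rewrite -(bumpat_cat_lt v h) b.
Qed.

(** Bumps of the parts survive; the new ones straddle the cut, hence start at one of the last two
    steps of u. *)
Lemma nbump_cat u v :
  (nbump u + nbump v <= nbump (u ++ v) <= nbump u + nbump v + 2)%N.
Proof.
rewrite /nbump size_cat iotaD count_cat add0n.
have -> : count (bumpat (u ++ v)) (iota (size u) (size v)) = nbump v.
  rewrite -[X in iota X _]addn0 iotaDl count_map.
  by apply: eq_count => i /=; rewrite bumpat_catr.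
suff : (nbump u <= count (bumpat (u ++ v)) (iota 0 (size u)) <= nbump u + 2)%N.
  by rewrite /nbump; lia.
apply/andP; split.
  by apply: sub_count => i; apply: bumpat_catl.
rewrite /nbump; have [h|h] := leqP (size u) 2.
  by rewrite (leq_trans (count_size _ _)) // size_iota (leq_trans h) // leq_addl.
have -> : size u = (size u - 2 + 2)%N by rewrite subnK // ltnW.
rewrite iotaD !count_cat add0n.
rewrite (leq_trans (leq_add (leqnn _) (count_size _ _))) // size_iota leq_add2r.
rewrite (leq_trans _ (leq_addr _ _)) //.
apply: eq_leq; apply: eq_in_count => i; rewrite mem_iota add0n => ih.
by rewrite bumpat_cat_lt //; lia.
Qed.

Definition perp t : step d := (if t.1 == ord0 then ord_max else ord0, true).

Definition rpt x t (p : int * int) : lattice d := x + sv t *~ p.1 + sv (perp t) *~ p.2.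
Definition rect : seq (int * int) := [seq (a%:Z, b%:Z) | a <- iota 0 3, b <- iota 0 2].
Definition box x t := [seq rpt x t p | p <- rect].

Lemma rpt_shift x y t p : rpt (y + x) t p = y + rpt x t p.
Proof. by rewrite /rpt !addrA. Qed.

Lemma box_shift x y t : box (y + x) t = map (+%R y) (box x t).
Proof. by rewrite /box -map_comp; apply: eq_map => p; apply: rpt_shift. Qed.

Lemma mem_box_shift x y t z : (y + z \in box (y + x) t) = (z \in box x t).
Proof. by rewrite box_shift mem_map //; apply: addrI. Qed.

Lemma mem_box0 x t : x \in box x t.
Proof. by apply/mapP; exists (0, 0) => //; rewrite /rpt /= !mulr0z !addr0. Qed.

Lemma mem_box1 x t : x + sv t \in box x t.
Proof. by apply/mapP; exists (1, 0) => //; rewrite /rpt /= mulr1z mulr0z addr0. Qed.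

Lemma mulrz_coord (z : lattice d) (m : int) i : (z *~ m) 0 i = z 0 i * m.
Proof.
case: m => n; first by rewrite -pmulrn mulmxnE -mulr_natr natz.
by rewrite NegzE -nmulrn mulrN mxE mulmxnE -mulr_natr natz.
Qed.

Lemma sv_coord_le1 t i : `|sv t 0 i| <= 1.
Proof. by rewrite svE; case: ifP => _ //; case: ifP. Qed.

Context (d0 : (0 < d)%N).

Lemma perp_neq t : ((perp t).1 == t.1) = false.
Proof.
rewrite /perp /=; case: (eqVneq t.1 ord0) => [->|]; last by rewrite eq_sym => /negbTE.
by apply/negP => /eqP /(congr1 val) /= e; move: d0; rewrite e.
Qed.

Lemma rptE x t p i : rpt x t p 0 i = x 0 i + sv t 0 i * p.1 + sv (perp t) 0 i * p.2.
Proof. rewrite /rpt mxE mulrz_coord; congr (_ + _); by rewrite mxE mulrz_coord. Qed.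

Lemma rpt_inj x t : injective (rpt x t).
Proof.
move=> [a b] [a' b'] /rowP e; congr (_, _).
  have := e t.1; rewrite !rptE /= !svE eqxx eq_sym perp_neq !mul0r !addr0.
  by move=> /addrI; case: ifP => _; rewrite ?mul1r ?mulN1r // => /oppr_inj.
have := e (perp t).1; rewrite !rptE /= !svE eqxx perp_neq !mul0r !addr0.
by move=> /addrI; rewrite mul1r mul1r.
Qed.

Lemma box_near x t y i : y \in box x t -> `|y 0 i - x 0 i| <= 2.
Proof.
have h : all (fun p : int * int => (`|p.1| <= 2) && (`|p.2| <= 1)) rect by [].
move=> /mapP[p /(allP h) /andP[p1 p2] ->]; rewrite rptE.
have -> (a b c : int) : a + b + c - a = b + c by ring.
have [e|ne] := eqVneq i t.1.
  rewrite [X in _ + X * _]svE e eq_sym perp_neq mul0r addr0 normrM.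
  have := sv_coord_le1 t t.1; have := normr_ge0 (sv t 0 t.1); have := normr_ge0 p.1; nia.
rewrite svE (negbTE ne) mul0r add0r normrM.
have := sv_coord_le1 (perp t) i; have := normr_ge0 (sv (perp t) 0 i).
have := normr_ge0 p.2; nia.
Qed.

(* Two boxes whose base points are distinct but congruent mod 5 are disjoint. *)
Definition cls x : {ffun 'I_d.+1 -> 'I_5} := [ffun i => inord (absz (modz (x 0 i) 5))].

Lemma cls_box x x' t t' y : cls x = cls x' -> y \in box x t -> y \in box x' t' -> x = x'.
Proof.
move=> /ffunP e yx yx'; apply/rowP => i.
have := box_near i yx; have := box_near i yx'; have := e i; rewrite !ffunE.
move=> /(congr1 val); rewrite /= !inordK; lia.
Qed.

(* Paths in the 3 x 2 rectangle are found by exhaustive search: (false, _) is a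
   move along the long side, (true, _) one along the short side. *)
Definition mstep := (bool * bool)%type.
Definition mv (m : mstep) : int * int :=
  match m with (false, true) => (1, 0) | (false, false) => (-1, 0)
  | (true, true) => (0, 1) | (true, false) => (0, -1) end.
Definition mopp (m : mstep) : mstep := (m.1, ~~ m.2).
Definition madd (p q : int * int) := (p.1 + q.1, p.2 + q.2).
Fixpoint mtraj p (z : seq mstep) : seq (int * int) :=
  if z is m :: z' then p :: mtraj (madd p (mv m)) z' else [:: p].
Definition mbump (z : seq mstep) :=
  has (fun i => (i.+2 < size z)%N && (nth (false, true) z i.+2 == mopp (nth (false, true) z i)))
    [:: 0; 1; 2]%N.
Fixpoint mwords n : seq (seq mstep) :=
  if n is n'.+1 then [seq m :: z | m <- [:: (false, true); (false, false); (true, true); (true, false)], z <- mwords n']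
  else [:: [::]].
Definition mcheck p q (z : seq mstep) :=
  [&& all (mem rect) (mtraj p z), uniq (mtraj p z), last p (mtraj p z) == q & mbump z].
Definition mok p q (z : seq mstep) := mcheck p q z && (size z <= 5)%N.

(** A finite check. A unit square would be too small: inside it, opposite corners are joined by
    two-step paths only, which have no bump. *)
Lemma mreroute p q : p \in rect -> q \in rect -> p != q -> exists z, mok p q z.
Proof.
(* A self-avoiding path on six sites has at most five steps. *)
pose cand := flatten [seq mwords n | n <- iota 0 6].
have : all (fun p => all (fun q => (p == q) || has (mok p q) cand) rect) rect.
  by vm_compute.
move=> /allP h /h /allP {}h /h /orP[/eqP->|]; first by rewrite eqxx.
by move=> /hasP[w _ wo] _; exists w.
Qed.

Definition fstep t (m : mstep) : step d :=
  match m with (false, true) => t | (false, false) => ops t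
  | (true, true) => perp t | (true, false) => ops (perp t) end.

Lemma fstep_opp t m : fstep t (mopp m) = ops (fstep t m).
Proof. by case: m => [[] []] //=; rewrite opsK. Qed.

Lemma rpt_madd x t p m : rpt x t (madd p (mv m)) = rpt x t p + sv (fstep t m).
Proof.
apply/rowP => i; rewrite !(rptE, mxE).
by case: m => [[] []] /=; rewrite ?sv_ops ?mxE; ring.
Qed.

Lemma traj_rpt x t p z : traj (rpt x t p) (map (fstep t) z) = map (rpt x t) (mtraj p z).
Proof.
elim: z p => [|m z IH] p; first by rewrite traj_nil.
by rewrite /= traj_cons -rpt_madd IH.
Qed.

Lemma reroute x t y z : y \in box x t -> z \in box x t -> y != z ->
  exists w, [/\ {subset traj y w <= box x t}, saw w, y + disp w = z,
    exists2 i, bumpat w i & (i <= 2)%N & (size w <= 5)%N].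
Proof.
move=> /mapP[p pr ->] /mapP[q qr ->] pq.
have /mreroute [] // : p != q by apply: contraNneq pq => ->.
move=> w /andP[/and4P[/allP wr uw /eqP wq /hasP[i i2 /andP[iw /eqP wb]]] w5].
exists (map (fstep t) w); split.
- by rewrite traj_rpt => _ /mapP[r /wr rr ->]; apply: map_f.
- by rewrite -(saw_shift (rpt x t p)) traj_rpt map_inj_uniq //; apply: rpt_inj.
- have := congr1 (last (rpt x t p)) (traj_rpt x t p w).
  by rewrite last_rcons last_map wq.
- exists i; last by move: i2; rewrite !inE => /or3P[] /eqP ->.
  have iw' : (i < size w)%N by lia.
  rewrite /bumpat size_map iw (nth_map (false, true)) // wb fstep_opp.
  by rewrite (nth_map (false, true) s0) // eqxx.
- by rewrite size_map.
Qed.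

End Bumps.

(** * Crowded rectangles and the detours through them *)

Section Zones.
Context (d : nat) (d0 : (0 < d)%N).
Implicit Types (s t : step d) (u v w P : word d) (x y : lattice d).
Local Notation s0 := (e1 d).

(** Sites are counted rather than visits, so the value is at most 6, and it can only grow when the
    walk is extended. *)
Definition vcount x w j :=
  count (mem (traj x w)) (box (x + disp (take j w)) (nth s0 w j)).

Lemma vcount_shift x w j : vcount x w j = vcount 0 w j.
Proof.
rewrite /vcount add0r box_shift count_map; apply: eq_count => y /=.
by rewrite ?inE mem_traj_shift [x + y]addrC addrK.
Qed.

Definition crowded k w := has (fun j => (k <= vcount 0 w j)%N) (iota 0 (size w)).

Lemma crowdedP k w : reflect (exists2 j, (j < size w)%N & (k <= vcount 0 w j)%N) (crowded k w).
Proof.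
apply: (iffP hasP) => -[j].
  by rewrite mem_iota add0n => ? ?; exists j.
by move=> ? ?; exists j => //; rewrite mem_iota add0n.
Qed.

Lemma crowded_catl k u v : crowded k u -> crowded k (u ++ v).
Proof.
move=> /crowdedP[j ju h]; apply/crowdedP; exists j.
  by rewrite size_cat (leq_trans ju) // leq_addr.
apply: leq_trans h _; rewrite /vcount takel_cat; last exact: ltnW.
rewrite nth_cat ju; apply: sub_count => y /=.
by rewrite ?inE mem_traj_cat => ->.
Qed.

Lemma vcount_catr u v j : (vcount (disp u) v j <= vcount 0 (u ++ v) (size u + j))%N.
Proof.
rewrite /vcount take_cat nth_cat ifN; last by rewrite -leqNgt leq_addr.
rewrite ifN; last by rewrite -leqNgt leq_addr.
rewrite addKn disp_cat add0r.
by apply: sub_count => y /=; rewrite ?inE mem_traj_cat add0r => ->; rewrite orbT.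
Qed.

Lemma crowded_catr k u v : crowded k v -> crowded k (u ++ v).
Proof.
move=> /crowdedP[j jv h]; apply/crowdedP; exists (size u + j)%N.
  by rewrite size_cat ltn_add2l.
by apply: leq_trans (vcount_catr _ _ _); rewrite vcount_shift.
Qed.

Lemma mem_traj_take x w j : x + disp (take j w) \in traj x w.
Proof.
rewrite -{2}(cat_take_drop j w) mem_traj_cat; apply/orP; left.
exact: mem_traj_last.
Qed.

Lemma mem_traj_next x w j : (j < size w)%N -> x + disp (take j w) + sv (nth s0 w j) \in traj x w.
Proof.
move=> jw; have := mem_traj_take x w j.+1.
by rewrite (take_nth s0) // -cats1 disp_cat /= addr0 addrA.
Qed.

(** A rectangle contains both ends of its step: the base case of the induction on k. *)
Lemma crowded2 w : (0 < size w)%N -> crowded 2 w.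
Proof.
move=> w0; apply/crowdedP; exists 0%N => //.
rewrite /vcount /box /rect; set c := 0 + _; set t := nth _ _ _.
have h0 : rpt c t (0, 0) \in traj 0 w.
  by rewrite /rpt !mulr0z !addr0; apply: mem_traj_take.
have h1 : rpt c t (1, 0) \in traj 0 w.
  by rewrite /rpt mulr0z mulr1z addr0; apply: mem_traj_next.
by rewrite /= h0 h1 add1n ltnS addnCA leq_addr.
Qed.

Lemma first_visit x w (p : pred (lattice d)) : has p (traj x w) ->
  exists u v, [/\ w = u ++ v, p (x + disp u) & ~~ has p (vis x u)].
Proof.
elim: w x => [|s w IH] x.
  by rewrite traj_nil /= orbF => px; exists [::], [::]; rewrite addr0.
rewrite traj_cons /=; have [px _|npx /= /IH[u [v [-> pu hu]]]] := boolP (p x).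
  by exists [::], (s :: w); rewrite addr0.
by exists (s :: u), v; rewrite /= addrA (negbTE npx).
Qed.

Lemma last_visit x w (p : pred (lattice d)) : has p (traj x w) ->
  exists u v, [/\ w = u ++ v, p (x + disp u) & ~~ has p (behead (traj (x + disp u) v))].
Proof.
elim: w x => [|s w IH] x.
  by rewrite traj_nil /= orbF => px; exists [::], [::]; rewrite addr0 traj_nil.
have [/IH[u [v [-> pu hu]]] _|nh] := boolP (has p (traj (x + sv s) w)).
  by exists (s :: u), v; rewrite /= addrA.
rewrite traj_cons /= (negbTE nh) orbF => px.
by exists [::], (s :: w); rewrite addr0 traj_cons.
Qed.

(* A zone (j, a, b, r, g) of P: the visits of P = a ++ b ++ g to the rectangle
   attached to its j-th step all happen during b, and r is a detour through
   that rectangle, with the same end points as b, that contains a bump. *)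
Record zone_spec k P j (a b r g : word d) : Prop := ZoneSpec {
  zone_cat : P = a ++ b ++ g;
  zone_ltn : (j < size P)%N;
  zone_crowded : (k <= vcount 0 P j)%N;
  zone_pre : forall y, y \in vis 0 a -> y \notin box (disp (take j P)) (nth s0 P j);
  zone_post : forall y, y \in behead (traj (disp (a ++ b)) g) ->
    y \notin box (disp (take j P)) (nth s0 P j);
  zone_in : {subset traj (disp a) r <= box (disp (take j P)) (nth s0 P j)};
  zone_saw : saw r;
  zone_disp : disp r = disp b;
  zone_bump : exists2 i, bumpat r i & (i <= 2)%N;
  zone_size : (size r <= 5)%N;
  zone_gt0 : (0 < size b)%N }.

Lemma disp_neq0 w : saw w -> w != [::] -> disp w != 0.
Proof.
case: w => // s w; rewrite /saw traj_cons /= => /andP[h _] _.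
apply/negP => /eqP e; case/negP: h.
by have := mem_traj_last (0 + sv s) w; rewrite -addrA e addr0.
Qed.

(** Cut P at its first and last visits to the rectangle. They differ because the rectangle contains
    both ends of the j-th step, so [reroute] joins them. *)
Lemma zone_exists k P : saw P -> crowded k P ->
  exists j a b r g, zone_spec k P j a b r g.
Proof.
move=> sP /crowdedP[j jP kj].
set c := disp (take j P); set t := nth s0 P j; pose bx := box c t.
have hc : c \in traj 0 P by have := mem_traj_take 0 P j; rewrite add0r.
have hc' : c + sv t \in traj 0 P by have := mem_traj_next 0 jP; rewrite add0r.
have h1 : has (mem bx) (traj 0 P) by apply/hasP; exists c => //=; apply: mem_box0.
have [a [v [Pav pa ha]]] := first_visit h1.
rewrite add0r in pa.
have h2 : has (mem bx) (traj (disp a) v).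
  by apply/hasP; exists (disp a) => //; apply: mem_traj_head.
have [b [g [vbg pb hg]]] := last_visit h2.
have bn0 : b != [::].
  apply/negP => /eqP b0; rewrite b0 /= in vbg; rewrite b0 /= addr0 in hg.
  have only y : y \in traj 0 P -> y \in bx -> y = disp a.
    rewrite Pav traj_cat add0r mem_cat vbg => /orP[ya yb|].
      by case/negP: ha; apply/hasP; exists y.
    rewrite traj_head inE => /orP[/eqP//|yg yb].
    by case/negP: hg; apply/hasP; exists y.
  have := only _ hc' (mem_box1 _ _); rewrite -(only _ hc (mem_box0 _ _)).
  move=> /eqP; rewrite -subr_eq0 addrC addKr => /eqP sv0.
  by have := svE t t.1; rewrite sv0 mxE eqxx; case: ifP.
have sb : saw b by move: sP; rewrite Pav vbg => /saw_cat[_ /saw_cat[]].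
have [r [rin sr rd [i ri i2] r5]] : exists r, [/\ {subset traj (disp a) r <= bx}, saw r,
    disp a + disp r = disp a + disp b, exists2 i, bumpat r i & (i <= 2)%N & (size r <= 5)%N].
  apply: reroute => //; rewrite -subr_eq0 opprD addrA subrr sub0r oppr_eq0.
  exact: disp_neq0.
exists j, a, b, r, g; split => //.
- by rewrite Pav vbg.
- by move=> y ya; apply/negP => yb; case/negP: ha; apply/hasP; exists y.
- rewrite disp_cat => y ya; apply/negP => yb; case/negP: hg; apply/hasP.
  by exists y.
- exact: addrI rd.
- by exists i.
- by rewrite lt0n size_eq0.
Qed.

(** By assumption the whole walk meets the box only during P, and then only during b. The detour
    stays inside the box, so it cannot hit X, a, g or Y. That all new sites lie in the box is what
    the induction over several zones needs. *)
Lemma zone_replace k P j a b r g (X Y : word d) : zone_spec k P j a b r g ->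
  saw (X ++ P ++ Y) ->
  (forall y, y \in traj 0 (X ++ P ++ Y) ->
     y \in box (disp X + disp (take j P)) (nth s0 P j) -> y \in traj (disp X) P) ->
  saw (X ++ (a ++ r ++ g) ++ Y) /\
  (forall y, y \in traj 0 (X ++ (a ++ r ++ g) ++ Y) ->
     y \in traj 0 (X ++ P ++ Y) \/ y \in box (disp X + disp (take j P)) (nth s0 P j)).
Proof.
move=> [Pe jP _ zpre zpost zin sr rd _ _ _] sw only.
set bx := box _ _ in zpre zpost zin; set bX := box (disp X + _) _ in only *.
have bXE y : (y \in bX) = (y - disp X \in bx).
  by rewrite -{1}(subrKC (disp X) y) mem_box_shift.
have [_ _ dX] := saw_cat sw.
pose U := X ++ a; pose V := g ++ Y.
have E1 : X ++ P ++ Y = U ++ b ++ V by rewrite /U /V Pe -!catA.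
have E2 : X ++ (a ++ r ++ g) ++ Y = U ++ r ++ V by rewrite /U /V -!catA.
rewrite E1 in sw only *; rewrite E2.
have [sU /saw_cat[sb sV dbV] dUbV] := saw_cat sw.
have rbX y : y \in traj (disp U) r -> y \in bX.
  rewrite bXE disp_cat => yr; apply: zin.
  by rewrite mem_traj_shift; rewrite mem_traj_shift in yr; rewrite -addrA -opprD.
have UbX y : y \in vis 0 U -> y \in bX -> False.
  rewrite /U vis_cat mem_cat add0r => /orP[yX yb|ya].
    apply: (dX 0 y) => //; rewrite traj_cat mem_cat.
    have := only y; rewrite -E1 mem_traj_cat => /(_ _ yb).
    rewrite mem_traj yX orbT add0r => /(_ isT).
    by rewrite -mem_cat -traj_cat mem_traj_cat => ->.
  rewrite bXE; apply/negP; apply: zpre; move: ya.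
  by rewrite vis0_shift => /mapP[z zz ->]; rewrite addrC addKr.
have VbX y : y \in behead (traj (disp U + disp b) V) -> y \in bX -> False.
  rewrite /V traj_catr traj_head /= mem_cat => /orP[yg|yY yb].
    rewrite bXE; apply/negP; apply: zpost; move: yg.
    rewrite /U disp_cat -addrA -disp_cat traj0_shift (traj0_shift (disp (a ++ b))).
    rewrite !behead_map => /mapP[z zz ->].
    by rewrite addrAC (addrC (disp X)) addrK; apply: map_f.
  have yP : y \in traj (disp X) P.
    apply: only => //; rewrite traj_cat mem_cat traj_cat mem_cat; apply/orP; right.
    apply/orP; right; rewrite /V traj_catr mem_cat.
    by rewrite add0r yY orbT.
  have := sw; rewrite -E1 catA /saw traj_catr cat_uniq => /and3P[_ /hasPn h _].
  have /h : y \in behead (traj (0 + disp (X ++ P)) Y).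
    by move: yY; rewrite add0r Pe /U !disp_cat -!addrA.
  by rewrite /= traj_cat add0r mem_cat yP orbT.
have memV y : y \in traj (disp U + disp b) V -> y \in traj 0 (U ++ b ++ V).
  by rewrite traj_cat mem_cat traj_cat mem_cat add0r => ->; rewrite !orbT.
split.
  rewrite /saw traj_cat cat_uniq add0r traj_cat rd cat_uniq.
  apply/and4P; split.
  - by move: sU; rewrite /saw rcons_uniq => /andP[].
  - apply/hasPn => y; rewrite mem_cat /= => /orP[yr|yV].
      by apply/negP => /UbX; apply; apply: rbX; apply: mem_vis_traj.
    apply/negP => yU; apply: (dUbV 0 y yU); rewrite traj_cat add0r mem_cat yV.
    by rewrite orbT.
  - by move: sr; rewrite -(saw_shift (disp U)) rcons_uniq => /andP[].
  - apply/andP; split; last by rewrite saw_shift.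
    apply/hasPn => y; rewrite traj_head inE /= => /orP[/eqP->|yV].
      by move: sr; rewrite -(saw_shift (disp U)) rcons_uniq rd => /andP[].
    apply/negP => yr; apply: (VbX y) => //; apply: rbX; exact: mem_vis_traj.
move=> y; rewrite traj_cat mem_cat add0r => /orP[yU|].
  by left; rewrite mem_traj_cat; apply/orP; left; apply: mem_vis_traj.
rewrite traj_cat mem_cat rd => /orP[yr|yV]; last by left; apply: memV.
by right; apply: rbX; apply: mem_vis_traj.
Qed.

End Zones.

(** * Simultaneous rerouting of many zones *)

Section Surgery.
Context (d : nat) (d0 : (0 < d)%N) (k L : nat).
Implicit Types (s t : step d) (u v w P A : word d) (x y : lattice d) (fl : seq bool).
Local Notation s0 := (e1 d).

Definition sparse l w := [&& saw w, bumpfree w & ~~ crowded l w].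

Lemma sparse_factor_closed l : factor_closed (sparse l).
Proof.
move=> u v /and3P[/saw_factor_closed/andP[su sv] /bumpfree_factor_closed/andP[bu bv] c].
rewrite /sparse su sv bu bv /=; apply/andP; split; apply: contra c.
  exact: crowded_catl.
exact: crowded_catr.
Qed.

Definition zone_data := (nat * word d * word d * word d * word d)%type.

Definition is_zone P (z : zone_data) :=
  let: (j, a, b, r, g) := z in zone_spec k P j a b r g.

(** A choice that depends on P alone, so that surgery, encoding and start positions refer to the
    same zone. *)
Definition zone P : zone_data := xget (0%N, [::], [::], [::], [::]) [set z | is_zone P z].

Lemma zoneP P : saw P -> crowded k P -> is_zone P (zone P).
Proof.
move=> sP cP; apply: (@xgetPex _ _ [set z | is_zone P z]).
have [j [a [b [r [g h]]]]] := zone_exists d0 sP cP.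
by exists (j, a, b, r, g).
Qed.

Definition zindex P := (zone P).1.1.1.1.

Definition reroute_zone P := let: (j, a, b, r, g) := zone P in a ++ r ++ g.

Definition center x P := x + disp (take (zindex P) P).

(* w is cut into pieces of length L, and the zones of the pieces flagged by fl
   are rerouted. *)
Fixpoint surgery fl w :=
  if fl is f :: fl' then
    (if f then reroute_zone (take L w) else take L w) ++ surgery fl' (drop L w)
  else w.

Section Class.
Context (c : {ffun 'I_d.+1 -> 'I_5}).

(** Restricting the base points to one class c mod 5 keeps the rerouted rectangles disjoint. *)
Definition good x P := crowded k P && (cls (center x P) == c).

Fixpoint allowed x fl w :=
  if fl is f :: fl' then
    (f ==> good x (take L w)) && allowed (x + disp (take L w)) fl' (drop L w)
  else true.

Lemma mem_vis_take x w j : (j < size w)%N -> x + disp (take j w) \in vis x w.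
Proof.
move=> jw; rewrite -{2}(cat_take_drop j w) vis_cat mem_cat; apply/orP; right.
by rewrite (drop_nth s0) //= mem_head.
Qed.

Lemma sub_count_eq (T : eqType) (a b : pred T) (s : seq T) :
  (forall z, a z -> b z) -> (count b s <= count a s)%N ->
  forall z, z \in s -> b z -> a z.
Proof.
move=> ab; elim: s => //= z s IH h y.
have hs : (count a s <= count b s)%N by apply: sub_count.
have hz : (a z <= b z)%N by case az: (a z) => //; rewrite ab.
rewrite inE => /orP[/eqP-> bz|]; last by apply: IH; lia.
by move: h; rewrite bz; case: (a z) => //; lia.
Qed.

(** X is the prefix after surgery, W0 the original one. A good piece has at least k sites in its
    rectangle and the whole walk at most k, so the rest of the original walk stays out of it. Sites
    added earlier lie in rectangles of the same class with other base points, which are disjoint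
    from this one. *)
Lemma saw_surgery fl (X W0 w : word d) :
  sparse k.+1 (W0 ++ w) -> disp X = disp W0 -> saw (X ++ w) ->
  (forall y, y \in traj 0 (X ++ w) -> y \in traj 0 (W0 ++ w) \/
     exists z t, [/\ y \in box z t, cls z = c & z \in vis 0 W0]) ->
  allowed (disp W0) fl w -> saw (X ++ surgery fl w).
Proof.
elim: fl X W0 w => [|f fl IH] X W0 w sp dX sX hX //=.
set P := take L w; set Y := drop L w => /andP[fg al].
have wE : w = P ++ Y by rewrite cat_take_drop.
have sP : saw P by move: sX; rewrite wE => /saw_cat[_ /saw_cat[]].
rewrite catA; case: f fg => /= [/andP[cP clsP]|_]; last first.
  apply: (IH _ (W0 ++ P)); rewrite ?disp_cat ?dX // -?catA -?wE //.
  move=> y /hX[?|[z [t [zb cz zW]]]]; first by left.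
  by right; exists z, t; split; rewrite // vis_cat mem_cat zW.
move: (zoneP sP cP) (eqP clsP); rewrite /center /zindex /reroute_zone.
case: (zone P) => [[[[j a] b] r] g] /= z {}clsP.
have jP := zone_ltn z.
have only y : y \in traj 0 (X ++ P ++ Y) ->
    y \in box (disp X + disp (take j P)) (nth s0 P j) -> y \in traj (disp X) P.
  rewrite -wE dX => yX yb; case: (hX _ yX) => [yw|[y' [t [yb' cy' y'W]]]].
    case/and3P: sp => _ _ /negP sp.
    apply: (@sub_count_eq _ (mem (traj (disp W0) P)) (mem (traj 0 (W0 ++ w)))
      (box (disp W0 + disp (take j P)) (nth s0 P j))) => //.
    - by move=> u /= uP; rewrite wE !mem_traj_cat add0r uP orbT.
    - rewrite -ltnS; apply: leq_trans (_ : k.+1 <= _)%N; last first.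
        by rewrite ltnS -/(vcount (disp W0) P j) vcount_shift; apply: zone_crowded z.
      rewrite ltnNge; apply/negP => kc; apply: sp; apply/crowdedP.
      exists (size W0 + j)%N; first by rewrite size_cat ltn_add2l wE size_cat ltn_addr.
      apply: leq_trans kc _; rewrite /vcount add0r take_cat nth_cat.
      rewrite ifN; last by rewrite -leqNgt leq_addr.
      rewrite ifN; last by rewrite -leqNgt leq_addr.
      by rewrite addKn disp_cat wE nth_cat jP takel_cat // ltnW.
  (* Intersecting rectangles of class c share their base point; but y' was visited before P started,
     and the base point of this rectangle is visited in P. *)
  have e : y' = disp W0 + disp (take j P).
    by apply: (cls_box d0 _ yb' yb); rewrite cy'.
  case/and3P: sp => sp _ _; move: sp; rewrite wE => /saw_cat[_ _] /(_ 0 y' y'W).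
  rewrite add0r e mem_traj_cat => h; case: h; apply/orP; left.
  by apply: mem_vis_traj; apply: mem_vis_take.
have [|s2 sub2] := zone_replace z _ only; first by rewrite -wE.
apply: (IH _ (W0 ++ P)).
- by rewrite -catA -wE.
- by rewrite !disp_cat (zone_disp z) dX [in RHS](zone_cat z) !disp_cat.
- by rewrite -catA.
- move=> y; rewrite -!catA -wE => yS.
  have [] := sub2 y; first by rewrite -!catA.
    rewrite -wE => /hX[?|[y' [t [yb cy yW]]]]; first by left.
    by right; exists y', t; split; rewrite // vis_cat mem_cat yW.
  move=> yb; right; exists (disp X + disp (take j P)), (nth s0 P j); split => //.
    by rewrite dX.
  by rewrite vis_cat mem_cat dX add0r mem_vis_take // orbT.
- by rewrite disp_cat.
Qed.

Lemma size_surgery x fl w : saw w -> allowed x fl w ->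
  (size (surgery fl w) <= size w + 5 * count id fl)%N.
Proof.
elim: fl x w => [|f fl IH] x w; first by rewrite addn0.
rewrite /=; set P := take L w; set Y := drop L w => sw /andP[fg al].
have wE : w = P ++ Y by rewrite cat_take_drop.
have [sP sY _] : [/\ saw P, saw Y & True] by move: sw; rewrite wE => /saw_cat[].
have := IH _ _ sY al; rewrite wE !size_cat.
case: f fg => /= [/andP[cP _]|_]; last by rewrite add0n; lia.
move: (zoneP sP cP); rewrite /reroute_zone.
case: (zone P) => [[[[j a] b] r] g] /= z.
by rewrite [in size P](zone_cat z) !size_cat; have := zone_size z; lia.
Qed.

(* A bump-free walk is recovered from its surgery: each reroute creates the first
   bump of what remains, so it is located by the offset of its start to that
   bump, its length and the subword that it replaced. A is the unflagged word
   that precedes w. *)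
Fixpoint encode A fl w : seq (nat * nat * word d) :=
  if fl is f :: fl' then
    let P := take L w in let Y := drop L w in
    if f then
      let: (j, a, b, r, g) := zone P in
      (fbump (A ++ a ++ r ++ g ++ surgery fl' Y) + 2 - size (A ++ a), size r, b)%N
        :: encode g fl' Y
    else encode (A ++ P) fl' Y
  else [::].

Fixpoint decode (cs : seq (nat * nat * word d)) w : word d * seq nat :=
  if cs is (o, n, b) :: cs' then
    let i := (fbump w + 2 - o)%N in
    let: (v, l) := decode cs' (drop (i + n) w) in
    (take i w ++ b ++ v, i :: map (addn (i + size b)) l)
  else (w, [::]).

(* The positions of the zones in the original walk, from which the flags are
   determined. *)
Fixpoint starts (i : nat) fl w : seq nat :=
  if fl is f :: fl' then
    let P := take L w in let Y := drop L w in
    if f then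
      let: (j, a, b, r, g) := zone P in
      (i + size a)%N :: map (addn (i + size a + size b)) (starts (size g) fl' Y)
    else starts (i + L) fl' Y
  else [::].

(** As A ++ w has no bump, the first bump of the altered word starts no earlier than two steps
    before the first detour, and no later than the bump inside it. Once that detour is undone, the
    untouched end g of the piece takes the role of A. *)
Lemma decodeK x A fl w : saw w -> (size fl * L <= size w)%N -> bumpfree (A ++ w) ->
  allowed x fl w ->
  decode (encode A fl w) (A ++ surgery fl w) = (A ++ w, starts (size A) fl w).
Proof.
elim: fl x A w => [|f fl IH] x A w //=.
set P := take L w; set Y := drop L w => sw szw bw /andP[fg al].
have wE : w = P ++ Y by rewrite cat_take_drop.
have [sP sY _] : [/\ saw P, saw Y & True] by move: sw; rewrite wE => /saw_cat[].
have szY : (size fl * L <= size Y)%N by rewrite size_drop; lia.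
have szP : size P = L by rewrite size_takel //; lia.
case: f fg => /= [/andP[cP _]|_]; last first.
  by rewrite catA (IH _ _ _ sY szY _ al) ?size_cat ?szP -?catA -?wE.
move: (zoneP sP cP); rewrite /reroute_zone.
case: (zone P) => [[[[j a] b] r] g] /= z.
have bE : A ++ w = (A ++ a) ++ b ++ (g ++ Y) by rewrite {1}wE (zone_cat z) -!catA.
rewrite bE in bw *.
have /andP[bAa /bumpfree_factor_closed/andP[_ bgY]] := bumpfree_factor_closed bw.
set W := A ++ (a ++ r ++ g) ++ surgery fl Y.
have WE : W = (A ++ a) ++ r ++ (g ++ surgery fl Y) by rewrite /W -!catA.
have -> : A ++ a ++ r ++ g ++ surgery fl Y = W by rewrite /W -!catA.
have [i bi i2] := zone_bump z.
have bWi : bumpat W (size (A ++ a) + i) by rewrite WE bumpat_catr; apply: bumpat_catl.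
(* The truncated subtraction made by [encode] is exact, by [fbump_ge]. *)
have iE : (fbump W + 2 - (fbump W + 2 - size (A ++ a)) = size (A ++ a))%N.
  by rewrite subKn // WE; apply: (fbump_ge bAa); rewrite -WE; apply: bWi.
rewrite iE.
have -> : drop (size (A ++ a) + size r) W = g ++ surgery fl Y.
  by rewrite WE addnC -drop_drop !drop_size_cat.
rewrite WE take_size_cat //.
by rewrite (IH _ _ _ sY szY bgY al) size_cat.
Qed.

(** The first bump starts at most two steps after the start of the detour, so its offset is at most
    4; a detour has at most 5 steps. *)
Definition codes : seq (nat * nat * word d) :=
  [seq (p, b) | p <- [seq (o, n) | o <- iota 0 5, n <- iota 0 6],
                b <- flatten [seq words d l | l <- iota 0 L.+1]].

Lemma encode_codes x A fl w : saw w -> bumpfree (A ++ w) -> allowed x fl w ->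
  all (mem codes) (encode A fl w) && (size (encode A fl w) == count id fl).
Proof.
elim: fl x A w => [|f fl IH] x A w //=.
set P := take L w; set Y := drop L w => sw bw /andP[fg al].
have wE : w = P ++ Y by rewrite cat_take_drop.
have [sP sY _] : [/\ saw P, saw Y & True] by move: sw; rewrite wE => /saw_cat[].
case: f fg => /= [/andP[cP _]|_]; last first.
  by rewrite add0n; apply: IH al => //; rewrite -catA -wE.
move: (zoneP sP cP).
case: (zone P) => [[[[j a] b] r] g] /= z.
have bE : A ++ w = (A ++ a) ++ b ++ (g ++ Y) by rewrite {1}wE (zone_cat z) -!catA.
rewrite bE in bw.
have /andP[bAa /bumpfree_factor_closed/andP[_ bgY]] := bumpfree_factor_closed bw.
have /andP[-> /eqP ->] := IH _ _ _ sY bgY al.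
rewrite add1n eqxx !andbT.
set W := A ++ _.
have WE : W = (A ++ a) ++ r ++ (g ++ surgery fl Y) by rewrite /W -!catA.
have [i bi i2] := zone_bump z.
have bWi : bumpat W (size (A ++ a) + i) by rewrite WE bumpat_catr; apply: bumpat_catl.
apply: allpairs_f; first apply: allpairs_f.
- by rewrite mem_iota; have := fbump_le bWi; rewrite /=; lia.
- by rewrite mem_iota add0n ltnS (zone_size z).
apply/flattenP; exists (words d (size b)); last by rewrite mem_words.
apply: map_f; rewrite mem_iota add0n ltnS.
have : (size P <= L)%N by rewrite size_take_min geq_minl.
by rewrite (zone_cat z) !size_cat; lia.
Qed.

Lemma starts_ge i fl w : all (leq i) (starts i fl w).
Proof.
elim: fl i w => [|[] fl IH] i w //=.
  case: (zone _) => [[[[j a] b] r] g] /=; rewrite leq_addr /=.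
  by rewrite all_map; apply/allP => m _ /=; rewrite -!addnA leq_addr.
by apply: sub_all (IH (i + L)%N _) => m; apply: leq_trans; apply: leq_addr.
Qed.

(** A zone starts strictly inside its piece since b is not empty. Where the flags first disagree,
    one list has a start in that piece and the other only later ones. *)
Lemma starts_inj i x fl fl' w : saw w -> size fl = size fl' ->
  (size fl * L <= size w)%N -> allowed x fl w -> allowed x fl' w ->
  starts i fl w = starts i fl' w -> fl = fl'.
Proof.
elim: fl fl' i x w => [|f fl IH] [|f' fl'] i x w //=.
set P := take L w; set Y := drop L w => sw [sz] szw /andP[fg al] /andP[fg' al'].
have wE : w = P ++ Y by rewrite cat_take_drop.
have [sP sY _] : [/\ saw P, saw Y & True] by move: sw; rewrite wE => /saw_cat[].
have szY : (size fl * L <= size Y)%N by rewrite size_drop; lia.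
have szP : size P = L by rewrite size_takel //; lia.
case: f f' fg fg' => [] [] /=.
- move=> /andP[cP _] _; move: (zoneP sP cP).
  case: (zone P) => [[[[j a] b] r] g] /= z [/inj_map e].
  by rewrite (IH _ _ _ _ sY sz szY al al' (e (@addnI _))).
- move=> /andP[cP _] _; move: (zoneP sP cP).
  case: (zone P) => [[[[j a] b] r] g] /= z e.
  have := starts_ge (i + L) fl' Y; rewrite -e /= leq_add2l.
  by rewrite -szP (zone_cat z) !size_cat; have := zone_gt0 z; lia.
- move=> _ /andP[cP _]; move: (zoneP sP cP).
  case: (zone P) => [[[[j a] b] r] g] /= z e.
  have := starts_ge (i + L) fl Y; rewrite e /= leq_add2l.
  by rewrite -szP (zone_cat z) !size_cat; have := zone_gt0 z; lia.
- by move=> _ _ /(IH _ _ _ _ sY sz szY al al') ->.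
Qed.

Fixpoint ngood x q w : nat :=
  if q is q'.+1 then
    (good x (take L w) + ngood (x + disp (take L w)) q' (drop L w))%N
  else 0%N.

End Class.
End Surgery.

Fixpoint bits q : seq (seq bool) :=
  if q is q'.+1 then map (cons true) (bits q') ++ map (cons false) (bits q') else [:: [::]].

Lemma size_bits q fl : fl \in bits q -> size fl = q.
Proof.
elim: q fl => [|q IH] fl; first by rewrite inE => /eqP->.
by rewrite mem_cat => /orP[] /mapP[l /IH <- ->].
Qed.

Lemma uniq_bits q : uniq (bits q).
Proof.
elim: q => //= q IH; rewrite cat_uniq !map_inj_uniq ?IH //=; try by move=> ? ? [].
by rewrite andbT; apply/hasPn => _ /mapP[l _ ->]; apply/mapP => -[].
Qed.

Fixpoint seqs (T : Type) (s : seq T) m : seq (seq T) :=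
  if m is m'.+1 then [seq x :: l | x <- s, l <- seqs s m'] else [:: [::]].

Lemma size_seqs (T : Type) (s : seq T) m : size (seqs s m) = (size s ^ m)%N.
Proof. by elim: m => //= m IH; rewrite size_allpairs IH expnS. Qed.

Lemma mem_seqs (T : eqType) (s : seq T) l : all (mem s) l -> l \in seqs s (size l).
Proof. by elim: l => //= x l IH /andP[xs /IH]; apply: allpairs_f. Qed.

Lemma size_seqs_mem (T : eqType) (s : seq T) m l : l \in seqs s m -> size l = m.
Proof.
elim: m l => [|m IH] l /=; first by rewrite inE => /eqP->.
by move=> /allpairsP[[x l'] [_ /= /IH <- ->]].
Qed.

Definition words_le (d : nat) (P : pred (word d)) n : seq (word d) :=
  flatten [seq wf P l | l <- iota 0 n.+1].

Lemma mem_words_le (d : nat) (P : pred (word d)) n w :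
  (w \in words_le P n) = P w && (size w <= n)%N.
Proof.
apply/flattenP/andP => [[ws /mapP[l]]|[Pw sw]].
  by rewrite mem_iota add0n ltnS => ln -> ; rewrite mem_wf => /andP[-> /eqP->].
exists (wf P (size w)); last by rewrite mem_wf Pw eqxx.
by apply: map_f; rewrite mem_iota add0n ltnS.
Qed.

#[local] Arguments codes : simpl never.

(** * Counting the outcomes of surgery *)

Section SurgerySum.
Context (R : realType) (d : nat) (d0 : (0 < d)%N) (k L : nat).
Context (c : {ffun 'I_d.+1 -> 'I_5}).

(** Binomial expansion: an allowed flag list selects a subset of the good pieces, and goodness is
    judged on the original walk. *)
Lemma sum_allowed (t : R) x q (w : word d) :
  \sum_(fl <- bits q | allowed k L c x fl w) t ^+ count id fl
  = (1 + t) ^+ ngood k L c x q w.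
Proof.
elim: q x w => [|q IH] x w; first by rewrite big_cons big_nil /= expr0 addr0.
rewrite /= big_cat /= !big_map /= IH exprD.
case: (good _ _ _ _) => /=; last by rewrite big_pred0_eq add0r expr0 mul1r.
rewrite expr1 mulrDl mul1r addrC; congr (_ + _).
by rewrite -IH mulr_sumr; apply: eq_bigr => fl _; rewrite exprD expr1.
Qed.

(** Expand the left side over flag lists. Surgery and encoding together determine (w, fl), and m
    reroutings lengthen w by at most 5m: this gives the m-th term. *)
Lemma sum_good_le (t : R) n q : 0 <= t -> (q * L <= n)%N ->
  \sum_(w <- wf (sparse k.+1) n) (1 + t) ^+ ngood k L c 0 q w
  <= \sum_(m < q.+1) (t * (size (codes d L))%:R) ^+ m
       * \sum_(l < (n + 5 * m).+1) nsaw R d l.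
Proof.
move=> t0 qn.
pose s1 := [seq (w, fl) | w <- wf (sparse k.+1) n,
                          fl <- [seq fl <- bits q | allowed k L c 0 fl w]].
pose s2 := flatten [seq [seq (v, cs) | v <- words_le (@saw d) (n + 5 * m),
                                       cs <- seqs (codes d L) m] | m <- iota 0 q.+1].
have -> : \sum_(w <- wf (sparse k.+1) n) (1 + t) ^+ ngood k L c 0 q w
    = \sum_(p <- s1) t ^+ count id p.2.
  rewrite big_allpairs_dep; apply: eq_bigr => w _ /=.
  by rewrite big_filter sum_allowed.
have -> : \sum_(m < q.+1) (t * (size (codes d L))%:R) ^+ m
       * \sum_(l < (n + 5 * m).+1) nsaw R d l = \sum_(p <- s2) t ^+ size p.2.
  rewrite big_flatten big_map -[iota 0 q.+1]/(index_iota 0 q.+1) big_mkord.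
  apply: eq_bigr => m _.
  rewrite big_allpairs_dep; symmetry.
  transitivity (\sum_(v <- words_le (@saw d) (n + 5 * m)) (t * (size (codes d L))%:R) ^+ m).
    apply: eq_bigr => v _; transitivity (\sum_(cs <- seqs (codes d L) m) t ^+ m).
      by rewrite big_seq [RHS]big_seq; apply: eq_bigr => cs /size_seqs_mem <-.
    by rewrite big_const_seq count_predT size_seqs iter_addr_0 -(mulr_natr (t ^+ m)) natrX exprMn.
  rewrite big_const_seq count_predT iter_addr_0 -(mulr_natr (_ ^+ m)); congr (_ * _).
  rewrite size_flatten /shape -map_comp sumnE big_map.
  rewrite -[iota 0 _]/(index_iota 0 (n + 5 * m).+1) big_mkord natr_sum; apply: eq_bigr => l _.
  by rewrite /= size_wf.
have s1P p : p \in s1 -> [/\ saw p.1, bumpfree p.1, sparse k.+1 p.1, size p.1 = n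
    & size p.2 = q /\ allowed k L c 0 p.2 p.1].
  move=> /allpairsPdep[w [fl [wn + ->]]] /=.
  rewrite mem_filter => /andP[al /size_bits fq].
  by move: wn; rewrite mem_wf => /andP[sp /eqP wn]; case/and3P: (sp).
apply: (@ler_sum_inj R _ _ s1 s2
  (fun p => (surgery k L p.2 p.1, encode k L [::] p.2 p.1))).
- apply: allpairs_uniq_dep => [|w _|].
  + exact: uniq_wf.
  + by rewrite filter_uniq // uniq_bits.
  + by move=> [? ?] [? ?] _ _ [-> ->].
- move=> [w fl] [w' fl'] /s1P /= [sw bw spw wn [flq al]].
  move=> /s1P /= [sw' bw' spw' wn' [flq' al']] [e1 e2].
  have := decodeK d0 (A := [::]) sw _ bw al; rewrite flq wn => /(_ qn).
  have := decodeK d0 (A := [::]) sw' _ bw' al'; rewrite flq' wn' => /(_ qn).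
  rewrite /= e1 e2 => -> [ew es]; move: al' es; rewrite ew => al' es; congr (_, _).
  by apply: starts_inj sw _ _ al al' (esym es); rewrite ?flq ?wn // flq'.
- move=> [w fl] /s1P /= [sw bw spw wn [flq al]].
  have /andP[ce /eqP se] := encode_codes d0 (A := [::]) sw bw al; split; last by rewrite se.
  apply/flattenP; eexists.
    apply: map_f; rewrite mem_iota; apply: (_ : (0 <= count id fl < 0 + q.+1)%N).
    by rewrite add0n ltnS -flq count_size.
  apply: allpairs_f; last by rewrite -se; apply: mem_seqs.
  rewrite mem_words_le -wn (size_surgery d0 sw al) andbT.
  apply: (saw_surgery d0 (X := [::]) (W0 := [::]) _ _ _ _ al) => //.
  by move=> y; left.
- by move=> p _; apply: exprn_ge0.
Qed.

End SurgerySum.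

(** Replaces the M-th root of 1 + t. The witness is 1 / (1 - e) - 1 because Bernoulli bounds (1 -
    e)^M from below. *)
Lemma root_ge1_exists (R : realFieldType) M (t : R) : 0 < t ->
  exists2 t0, 0 < t0 & (1 + t0) ^+ M <= 1 + t.
Proof.
move=> t0; pose e := t / (M.+1%:R * (1 + t)).
have M0 : 0 < M.+1%:R :> R by rewrite ltr0n.
have t1 : 0 < 1 + t by rewrite addr_gt0.
have e0 : 0 < e by rewrite divr_gt0 // mulr_gt0.
have e1 : e < 1.
  rewrite ltr_pdivrMr ?mulr_gt0 // mul1r (lt_le_trans (y := 1 + t)) ?ltrDr //.
  by rewrite ler_peMl ?(ltW t1) ?ler1n.
have eM : e *+ M <= t / (1 + t).
  rewrite -mulr_natr /e invfM mulrA mulrAC ler_pM2r ?invr_gt0 // mulrAC.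
  by rewrite ler_pdivrMr // ler_pM2l // ler_nat.
have h : (1 + t)^-1 <= (1 - e) ^+ M.
  apply: le_trans (bernoulli M _); last by lra.
  rewrite mulNrn lerBrDr -lerBrDl; apply: (le_trans eM).
  by rewrite le_eqVlt; apply/orP; left; apply/eqP; field; rewrite gt_eqF.
exists ((1 - e)^-1 - 1); first by rewrite subr_gt0 invf_gt1 //; lra.
rewrite addrC subrK exprVn -[leRHS]invrK lef_pV2 ?posrE ?exprn_gt0 ?invr_gt0 //; lra.
Qed.

(** * Walks in which an event occurs in few pieces *)

Fixpoint npieces (d : nat) (E : pred (word d)) L q (w : word d) : nat :=
  if q is q'.+1 then (E (take L w) + npieces E L q' (drop L w))%N else 0%N.

Section FewPieces.
Context (R : realType) (d : nat) (P E : pred (word d)) (L : nat).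
Context (Pf : factor_closed P).

(** The weight is a product over the pieces, s where E holds and 1 elsewhere, and the property P
    passes to each piece. *)
Lemma sum_npieces_le (s : R) q r : 0 <= s ->
  \sum_(w <- wf P (q * L + r)) s ^+ npieces E L q w
  <= ((cnt (predI P (predC E)) L)%:R + s * (cnt P L)%:R) ^+ q * (cnt P r)%:R.
Proof.
move=> s0; elim: q => [|q IH].
  rewrite mul0n add0n expr0 mul1r /= (eq_bigr (fun=> 1)) //.
  by rewrite big_const_seq count_predT iter_addr_0 size_wf.
apply: (@le_trans _ _ (\sum_(p <- [seq (u, v) | u <- wf P L, v <- wf P (q * L + r)])
    (s ^+ E p.1 * s ^+ npieces E L q p.2))).
  apply: (@ler_sum_inj _ _ _ _ _ (fun w => (take L w, drop L w))).
  - exact: uniq_wf.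
  - by move=> w w' _ _ [e1 e2]; rewrite -(cat_take_drop L w) e1 e2 cat_take_drop.
  - move=> w; rewrite mem_wf => /andP[Pw /eqP sw]; split; last by rewrite /= exprD.
    have /andP[Pu Pv] : P (take L w) && P (drop L w) by apply: Pf; rewrite cat_take_drop.
    apply: allpairs_f; rewrite mem_wf ?Pu ?Pv /=.
      by rewrite size_takel // sw mulSn -addnA leq_addr.
    by rewrite size_drop sw mulSn -addnA addKn.
  - by move=> p _; rewrite mulr_ge0 // exprn_ge0.
rewrite big_allpairs /=; under eq_bigr do rewrite -mulr_sumr.
rewrite -mulr_suml exprS -mulrA; apply: ler_pM => //.
- by apply: sumr_ge0 => u _; rewrite exprn_ge0.
- by apply: sumr_ge0 => u _; rewrite exprn_ge0.
rewrite /wf big_filter (bigID E) /= addrC lerD //.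
  rewrite (eq_bigr (fun=> 1)); last by move=> u /andP[_ /negbTE->].
  by rewrite -count_sumr.
apply: (@le_trans _ _ (\sum_(u <- words d L | P u && E u) s)).
  by apply: ler_sum => u /andP[_ ->]; rewrite expr1.
rewrite (eq_bigr (fun=> s * 1)) => [|u _]; last by rewrite mulr1.
rewrite -mulr_sumr ler_wpM2l // -count_sumr ler_nat.
by apply: sub_count => u /andP[].
Qed.

(** A Markov argument: with s = 2^-m, a walk in which E holds on at most q / m of its q pieces has
    weight at least 2^-q, while the total weight is at most (y^L / 2)^q up to a constant. *)
Lemma few_pieces (y : R) : (0 < L)%N -> 0 < y ->
  4 * (cnt (predI P (predC E)) L)%:R <= y ^+ L ->
  exists2 m, (0 < m)%N & growth_le (fun n =>
    (cnt (fun w => P w && (m * npieces E L (n %/ L) w <= n %/ L)%N) n)%:R) y.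
Proof.
move=> L0 y0 hy.
have yL : 0 < y ^+ L by rewrite exprn_gt0.
(* This makes s * cnt P L at most y^L / 4; the hypothesis bounds the pieces without E by another y^L
   / 4. *)
have [m hm] := @expr_unbounded R 2 (4 * (cnt P L)%:R / y ^+ L) (ltr1n _ 2).
pose s : R := 2^-1 ^+ m.+1.
have s0 : 0 <= s by rewrite exprn_ge0 // invr_ge0.
have hs : 4 * (s * (cnt P L)%:R) <= y ^+ L.
  move: hm; rewrite ltr_pdivrMr // => /ltW hm.
  rewrite mulrCA -(ler_pM2l (_ : 0 < 2 ^+ m.+1)) ?exprn_gt0 //.
  rewrite /s exprVn mulVKf ?expf_neq0 ?pnatr_eq0 //.
  apply: (le_trans hm); rewrite ler_pM2r // exprS ler_peMl ?exprn_ge0 //; lra.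
exists m.+1 => //; pose C : R := \sum_(r < L) (cnt P r)%:R / y ^+ r.
have C0 : 0 <= C by apply: sumr_ge0 => r _; rewrite divr_ge0 // exprn_ge0 // ltW.
exists (1 + C); first by rewrite (lt_le_trans ltr01) // lerDl.
move=> n; set q := (n %/ L)%N; set r := (n %% L)%N.
have nE : n = (q * L + r)%N by apply: divn_eq.
have rL : (r < L)%N by rewrite ltn_mod.
have bound : 2 ^+ q * ((cnt (predI P (predC E)) L)%:R + s * (cnt P L)%:R) ^+ q <= (y ^+ L) ^+ q :> R.
  rewrite -exprMn; apply: lerXn2r; rewrite ?nnegrE ?(ltW yL) //.
    by rewrite mulr_ge0 // addr_ge0 // mulr_ge0.
  by lra.
apply: (@le_trans _ _ (2 ^+ q * \sum_(w <- wf P n) s ^+ npieces E L q w)).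
  rewrite count_sumr /wf big_filter mulr_sumr.
  rewrite [leRHS](bigID (fun w => (m.+1 * npieces E L q w <= q)%N)) /=.
  rewrite -[leLHS]addr0; apply: lerD; last first.
    by apply: sumr_ge0 => w _; rewrite mulr_ge0 ?exprn_ge0.
  apply: ler_sum => w /andP[_ h]; rewrite /s -exprM.
  rewrite exprVn ler_pdivlMr ?exprn_gt0 // mul1r.
  by apply: ler_weXn2l => //; rewrite ler1n.
apply: (@le_trans _ _ ((y ^+ L) ^+ q * (cnt P r)%:R)).
  apply: le_trans (ler_wpM2r _ bound) => //.
  rewrite -mulrA ler_wpM2l ?exprn_ge0 // [in leLHS]nE; exact: sum_npieces_le.
rewrite [in leRHS]nE exprD -exprM (mulnC L) mulrCA ler_pM2l ?exprn_gt0 //.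
rewrite -ler_pdivrMr ?exprn_gt0 // /C (bigD1 (Ordinal rL)) //= addrCA lerDl.
by rewrite addr_ge0 // sumr_ge0 // => i _; rewrite divr_ge0 // exprn_ge0 // ltW.
Qed.

End FewPieces.

(** * The induction on the number of sites in a rectangle *)

Section SparseGrowth.
Context (R : realType) (d : nat) (d0 : (0 < d)%N).
Local Notation mu := (mu R d).
Local Notation nsaw := (nsaw R d).

Lemma sum_nsaw_le (x : R) : mu < x ->
  exists2 C, 0 < C & forall j, \sum_(l < j.+1) nsaw l <= C * x ^+ j.
Proof.
move=> mx; have [C C0 hC] := growth_le_mu mx.
have x1 : 1 < x := le_lt_trans (mu_ge1 R d) mx.
have x0 : 0 < x := lt_trans ltr01 x1.
have xm1 : 0 < x - 1 by rewrite subr_gt0.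
exists (C * (x / (x - 1))); first by rewrite mulr_gt0 // divr_gt0.
move=> j; apply: (@le_trans _ _ (C * \sum_(l < j.+1) x ^+ l)).
  by rewrite mulr_sumr; apply: ler_sum.
rewrite -mulrA ler_pM2l // mulrAC -exprS ler_pdivlMr // mulrC -subrX1.
by rewrite gerBl.
Qed.

Lemma sum_half_le q : \sum_(m < q) 2^-1 ^+ m <= 2 :> R.
Proof.
have := subrX1 (2^-1 : R) q; have : 0 <= 2^-1 ^+ q :> R by rewrite exprn_ge0 // invr_ge0.
lra.
Qed.

(** t makes t * size codes * x^5 at most 1/2, so that the sum over m is geometric. It is uniform in
    x <= 2 mu because x will be taken close to mu in terms of t. *)
Lemma good_growth k L : exists2 t : R, 0 < t & forall x, mu < x -> x <= 2 * mu ->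
  exists2 C, 0 < C & forall n q c, (q * L <= n)%N ->
    \sum_(w <- wf (sparse k.+1) n) (1 + t) ^+ ngood (d := d) k L c 0 q w <= C * x ^+ n.
Proof.
pose T : R := (size (codes d L)).+1%:R.
have T0 : 0 < T by rewrite ltr0n.
have mu0 := mu_gt0 R d.
have m2 : 0 < 2 * mu by rewrite mulr_gt0.
exists (2 * T * (2 * mu) ^+ 5)^-1.
  by rewrite invr_gt0 mulr_gt0 ?exprn_gt0 // mulr_gt0.
set t := _^-1; have t0 : 0 < t by rewrite invr_gt0 mulr_gt0 ?exprn_gt0 // mulr_gt0.
move=> x mx x2; have [C C0 hC] := sum_nsaw_le mx.
have x0 : 0 < x := lt_trans mu0 mx.
exists (C * 2); first by rewrite mulr_gt0.
move=> n q c qn; apply: (le_trans (sum_good_le d0 k c (ltW t0) qn)).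
apply: (@le_trans _ _ (\sum_(m < q.+1) C * x ^+ n * 2^-1 ^+ m)); last first.
  by rewrite -mulr_sumr [leRHS]mulrAC ler_pM2l ?mulr_gt0 ?exprn_gt0 ?sum_half_le.
apply: ler_sum => m _.
apply: le_trans (ler_wpM2l _ (hC _)) _; first by rewrite exprn_ge0 // mulr_ge0 // ltW.
rewrite exprD exprM mulrCA !mulrA -!mulrA ler_pM2l // mulrCA ler_pM2l ?exprn_gt0 //.
rewrite -exprMn; apply: lerXn2r; rewrite ?nnegrE ?invr_ge0 ?mulr_ge0 ?exprn_ge0 ?(ltW x0) ?(ltW t0) //.
rewrite -mulrA ler_pdivrMl ?mulr_gt0 ?exprn_gt0 // [leRHS]mulrC -(mulrA 2 T) mulKf ?pnatr_eq0 //.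
apply: ler_pM => //; rewrite ?exprn_ge0 ?(ltW x0) //; first by rewrite ler_nat.
by apply: lerXn2r; rewrite ?nnegrE ?(ltW x0) ?(ltW m2).
Qed.

Lemma npieces_crowded k L x q (w : word d) :
  npieces (crowded k) L q w = (\sum_c ngood k L c x q w)%N.
Proof.
elim: q x w => [|q IH] x w /=; first by rewrite big1.
rewrite big_split /= -IH; congr (_ + _)%N; rewrite /good.
case: (crowded _ _) => /=; last by rewrite big1.
rewrite (bigD1 (cls (center k x (take L w)))) //= eqxx big1 // => c.
by rewrite eq_sym => /negbTE->.
Qed.

(** Pieces that are [sparse] k are rare; so, up to a set of growth rate y < mu, a walk has at least
    one crowded piece in m, hence one good piece in m * K for one of the K classes. Such walks have
    weight at least (1 + t1)^(n / L), while the total weight is at most C x^n with x just above mu.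
    This leaves a rate z < mu. *)
Lemma sparse_growth_step k : (exists2 x, 0 < x < mu & growth_le (fun n => (cnt (@sparse d k) n)%:R) x) ->
  exists2 x, 0 < x < mu & growth_le (fun n => (cnt (@sparse d k.+1) n)%:R) x.
Proof.
move=> [x0 /andP[x00 x0mu] [C C0 hC]].
have mu0 := mu_gt0 R d.
pose y := (x0 + mu) / 2.
have y0 : 0 < y by rewrite divr_gt0 // addr_gt0.
have ymu : y < mu by rewrite /y; lra.
have xy : x0 < y by rewrite /y; lra.
have [L hL] : exists L, 4 * (1 + C) < (y / x0) ^+ L.
  by apply: expr_unbounded; rewrite ltr_pdivlMr // mul1r.
have L0 : (0 < L)%N by case: L hL => //; rewrite expr0; lra.
have few : 4 * (cnt (predI (@sparse d k.+1) (predC (crowded k))) L)%:R <= y ^+ L.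
  apply: (@le_trans _ _ (4 * (C * x0 ^+ L))).
    rewrite ler_pM2l //; apply: le_trans (hC L); rewrite ler_nat.
    by apply: cnt_sub => w _ /andP[/and3P[sw bw _] /= cw]; apply/and3P.
  rewrite mulrA -ler_pdivlMr ?exprn_gt0 // -expr_div_n; apply: ltW; apply: le_lt_trans hL.
  by rewrite ler_pM2l // lerDr.
have [m m0 [C1 C10 hC1]] := few_pieces (@sparse_factor_closed d k.+1) L0 y0 few.
have [t t0 ht] := good_growth k L.
pose K := #|{ffun 'I_d.+1 -> 'I_5}|.
have K0 : (0 < K)%N by apply/card_gt0P; exists [ffun=> ord0].
(* One good piece among m * K is worth 1 + t, that is, a factor at least 1 + t1 for each piece. *)
have [t1 t10 ht1] := root_ge1_exists (m * K) t0.
(* Below x / z = (1 + e)^2 with e <= e0, which gives x^L <= (1 + t1) z^L. *)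
have [e0 e00 he0] := root_ge1_exists (2 * L) t10.
pose e := Num.min e0 1.
have ep : 0 < e by rewrite lt_min e00 ltr01.
have e1 : e <= 1 by rewrite ge_min lexx orbT.
have he : (1 + e) ^+ (2 * L) <= 1 + t1.
  apply: le_trans he0; apply: lerXn2r; rewrite ?nnegrE ?addr_ge0 ?(ltW ep) ?(ltW e00) //.
  by rewrite lerD2l ge_min lexx.
have ep1 : 0 < 1 + e by rewrite addr_gt0.
have [x [z [z0 zmu mux x2 xzL]]] : exists x z, [/\ 0 < z, z < mu, mu < x, x <= 2 * mu &
    x ^+ L <= (1 + t1) * z ^+ L].
  exists (mu * (1 + e)), (mu / (1 + e)); split.
  - by rewrite divr_gt0.
  - by rewrite ltr_pdivrMr // ltr_pMr // ltrDl.
  - by rewrite ltr_pMr // ltrDl.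
  - by rewrite [leRHS]mulrC ler_pM2l // -[2]/(1 + 1) lerD2l.
  - rewrite -ler_pdivrMr ?exprn_gt0 ?divr_gt0 // -expr_div_n; apply: le_trans he.
    rewrite exprM le_eqVlt; apply/orP; left; apply/eqP; congr (_ ^+ L).
    by field; rewrite !gt_eqF.
have xx0 : 0 < x := lt_trans mu0 mux.
have [C2 C20 hC2] := ht x mux x2.
have zx : 1 <= x / z by rewrite ler_pdivlMr // mul1r ltW // (lt_trans zmu).
have t1p : 0 < 1 + t1 by rewrite addr_gt0.
pose g n : R := (cnt (fun w : word d => sparse k.+1 w && (m * npieces (crowded k) L (n %/ L) w <= n %/ L)%N) n)%:R.
have core n : x ^+ n <= (1 + t1) ^+ (n %/ L) * ((x / z) ^+ L * z ^+ n).
  have rL : (n %% L <= L)%N by rewrite ltnW // ltn_mod.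
  rewrite {1 3}(divn_eq n L) (mulnC (n %/ L)%N) !exprD !exprM.
  rewrite [leRHS](_ : _ = ((1 + t1) * z ^+ L) ^+ (n %/ L) * ((x / z) ^+ L * z ^+ (n %% L))).
    apply: ler_pM; rewrite ?exprn_ge0 ?(ltW xx0) //.
      by apply: lerXn2r; rewrite ?nnegrE ?mulr_ge0 ?exprn_ge0 ?(ltW z0) ?(ltW t1p) ?(ltW xx0).
    rewrite -ler_pdivrMr ?exprn_gt0 // -expr_div_n.
    exact: ler_weXn2l.
  by rewrite [in RHS]exprMn -[RHS]mulrA; congr (_ * _); rewrite mulrCA.
have typical n : (cnt (@sparse d k.+1) n)%:R - g n <= K%:R * (C2 * (x / z) ^+ L) * z ^+ n.
  pose q := (n %/ L)%N; pose r := (n %% L)%N.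
  have qLn : (q * L <= n)%N by apply: leq_trunc_div.
  have nE : n = (q * L + r)%N by apply: divn_eq.
  apply: (@le_trans _ _ (((1 + t1) ^+ q)^-1 *
     \sum_(c : {ffun 'I_d.+1 -> 'I_5}) \sum_(w <- wf (sparse k.+1) n) (1 + t) ^+ ngood k L c 0 q w)).
    rewrite lerBlDl /g /cnt !count_sumr /wf.
    rewrite exchange_big /= big_filter mulr_sumr.
    rewrite (bigID (fun w => (m * npieces (crowded k) L q w <= q)%N)) /= lerD2l.
    rewrite [leRHS](bigID (fun w => (m * npieces (crowded k) L q w <= q)%N)) /= -[leLHS]add0r.
    apply: lerD.
      apply: sumr_ge0 => w _; rewrite mulr_ge0 ?invr_ge0 ?exprn_ge0 ?(ltW t1p) //.
      by apply: sumr_ge0 => c _; rewrite exprn_ge0 // addr_ge0 // ltW.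
    apply: ler_sum => w /andP[_ h].
    rewrite ler_pdivlMl ?exprn_gt0 // mulr1.
    have [c hc] : exists c, (q <= m * K * ngood k L c 0 q w)%N.
      apply/existsP; apply: contraR h; rewrite negb_exists => /forallP h.
      rewrite (npieces_crowded _ _ 0) -(leq_pmul2l K0).
      rewrite mulnA (mulnC K m) big_distrr /=.
      apply: (@leq_trans (\sum_(c : {ffun 'I_d.+1 -> 'I_5}) q)); last by rewrite sum_nat_const.
      by apply: leq_sum => c _; apply: ltnW; rewrite ltnNge h.
    rewrite (bigD1 c) //= -[leLHS]addr0; apply: lerD; last first.
      by apply: sumr_ge0 => c' _; rewrite exprn_ge0 // addr_ge0 // ltW.
    apply: (@le_trans _ _ ((1 + t1) ^+ (m * K * ngood k L c 0 q w))).
      by apply: ler_weXn2l => //; rewrite lerDl ltW.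
    by rewrite exprM; apply: lerXn2r => //; rewrite nnegrE ?exprn_ge0 ?addr_ge0 ?(ltW t10) ?(ltW t0).
  rewrite ler_pdivrMl ?exprn_gt0 //.
  apply: (@le_trans _ _ (\sum_(c : {ffun 'I_d.+1 -> 'I_5}) C2 * x ^+ n)).
    by apply: ler_sum => c _; apply: hC2.
  rewrite sumr_const -/K -(mulr_natl (C2 * _)) -!mulrA [leRHS]mulrCA ler_pM2l ?ltr0n //.
  by rewrite [leRHS]mulrCA ler_pM2l // core.
exists (Num.max y z); first by rewrite lt_max y0 gt_max ymu zmu.
have C30 : 0 < K%:R * (C2 * (x / z) ^+ L).
  by rewrite mulr_gt0 ?ltr0n // mulr_gt0 // exprn_gt0 // divr_gt0.
exists (C1 + K%:R * (C2 * (x / z) ^+ L)); first by rewrite addr_gt0.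
move=> n; have m1 : y ^+ n <= Num.max y z ^+ n.
  by apply: lerXn2r; rewrite ?nnegrE ?le_max ?lexx // ltW.
have m2 : z ^+ n <= Num.max y z ^+ n.
  by apply: lerXn2r; rewrite ?nnegrE ?le_max ?lexx ?orbT // ?(ltW y0) // ltW.
rewrite -[leLHS](subrK (g n)) addrC mulrDl; apply: lerD.
  by apply: le_trans (hC1 n) _; rewrite ler_pM2l.
by apply: le_trans (typical n) _; rewrite ler_pM2l.
Qed.

End SparseGrowth.

(** * Walks with few bumps *)

Section FewBumps.
Context (R : realType) (d : nat) (d0 : (0 < d)%N).
Local Notation mu := (mu R d).

(** No nonempty walk is [sparse] 2, so any rate serves at the start. *)
Lemma sparse_growth k : (2 <= k)%N ->
  exists2 x, 0 < x < mu & growth_le (fun n => (cnt (@sparse d k) n)%:R) x.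
Proof.
case: k => [|[|k]] // _; elim: k => [|k]; last exact: sparse_growth_step.
have mu0 := mu_gt0 R d.
exists (mu / 2); first by rewrite divr_gt0 //= ltr_pdivrMr // ltr_pMr // ltr1n.
exists 1 => // -[|n].
  by rewrite expr0 mulr1 (_ : 1 = 1%:R) // ler_nat (leq_trans (count_size _ _)).
have -> : cnt (@sparse d 2) n.+1 = 0%N.
  apply/eqP; rewrite -leqn0 leqNgt -has_count; apply/hasPn => w.
  rewrite mem_words => /eqP sw; apply/negP => /and3P[_ _] /negP; apply.
  by apply: crowded2; rewrite sw.
by rewrite mul1r exprn_ge0 // divr_ge0 // ltW.
Qed.

(** A rectangle has only six sites: the induction ends here with all bump-free walks. *)
Lemma crowded7 (w : word d) : crowded 7 w = false.
Proof.
by apply/crowdedP => -[j _]; rewrite leqNgt ltnS; apply/negP/negPn; apply: count_size.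
Qed.

Lemma bumpfree_growth :
  exists2 x, 0 < x < mu & growth_le (fun n => (cnt (predI (@saw d) (@bumpfree d)) n)%:R) x.
Proof.
have [x x0 [C C0 h]] := @sparse_growth 7 isT; exists x => //; exists C => // n.
apply: le_trans (h n); rewrite ler_nat; apply: cnt_sub => w _ /andP[sw bw].
by rewrite /sparse sw [bumpfree w]bw crowded7.
Qed.

Lemma npieces_le_nbump L q (w : word d) :
  (npieces (predC (@bumpfree d)) L q w <= nbump w)%N.
Proof.
elim: q w => //= q IH w; rewrite -{3}(cat_take_drop L w).
have /andP[h _] := nbump_cat (take L w) (drop L w); apply: leq_trans h.
apply: leq_add => //; rewrite -nbump_eq0; lia.
Qed.

(** Bump-free pieces of length L are rare for large L, and every other piece contributes at least
    one bump. *)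
Lemma few_bumps : exists2 y, 0 < y < mu & exists2 M, (0 < M)%N &
  growth_le (fun n => (cnt (fun w : word d => saw w && (M * nbump w <= n)%N) n)%:R) y.
Proof.
have [x0 /andP[x00 x0mu] [C C0 hC]] := bumpfree_growth.
have mu0 := mu_gt0 R d.
pose y := (x0 + mu) / 2.
have y0 : 0 < y by rewrite divr_gt0 // addr_gt0.
have ymu : y < mu by rewrite ltr_pdivrMr // mulr_natr mulr2n ltrD2r.
have xy : x0 < y by rewrite ltr_pdivlMr // mulr_natr mulr2n ltrD2l.
have [L hL] : exists L, 4 * (1 + C) < (y / x0) ^+ L.
  by apply: expr_unbounded; rewrite ltr_pdivlMr // mul1r.
have L0 : (0 < L)%N by case: L hL => //; rewrite expr0; lra.
have few : 4 * (cnt (predI (@saw d) (predC (predC (@bumpfree d)))) L)%:R <= y ^+ L.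
  apply: (@le_trans _ _ (4 * (C * x0 ^+ L))).
    rewrite ler_pM2l //; apply: le_trans (hC L); rewrite ler_nat.
    by apply: cnt_sub => w _ /andP[sw /= /negPn bw]; apply/andP.
  rewrite mulrA -ler_pdivlMr ?exprn_gt0 // -expr_div_n; apply: ltW; apply: le_lt_trans hL.
  by rewrite ler_pM2l // lerDr.
have [m m0 [C1 C10 hC1]] := few_pieces (@saw_factor_closed d) L0 y0 few.
exists y; first by rewrite y0.
(* For n >= L one has n < 2 L (n / L), which converts the number of pieces into the length. *)
exists (2 * L * m)%N; first by rewrite !muln_gt0 L0 m0.
exists C1 => // n; apply: le_trans (hC1 n); rewrite ler_nat; apply: cnt_sub => w _ /andP[-> h] /=.
have [nL|Ln] := ltnP n L; first by rewrite divn_small // muln0.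
have np := npieces_le_nbump L (n %/ L) w.
rewrite -(leq_pmul2l (_ : 0 < 2 * L)%N) ?muln_gt0 ?L0 //.
apply: (@leq_trans n).
  by apply: leq_trans h; rewrite mulnA leq_pmul2l ?muln_gt0 ?L0.
have q1 : (0 < n %/ L)%N by rewrite divn_gt0.
have := divn_eq n L; have := ltn_pmod n L0; nia.
Qed.

End FewBumps.

(** * Inserting bumps: the ratio inequality *)

Section Insertion.
Context (d : nat).
Implicit Types (s t : step d) (u v w : word d) (x y : lattice d).
Local Notation s0 := (e1 d).

Definition ins w j s := take j w ++ [:: s; nth s0 w j; ops s] ++ drop j.+1 w.
Definition del w j := take j w ++ nth s0 w j.+1 :: drop j.+3 w.

Lemma size_ins w j s : (j < size w)%N -> size (ins w j s) = (size w).+2.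
Proof. by move=> jw; rewrite /ins !size_cat size_takel ?size_drop /=; lia. Qed.

Lemma split_nth w j : (j < size w)%N -> w = take j w ++ nth s0 w j :: drop j.+1 w.
Proof. by move=> jw; rewrite -drop_nth // cat_take_drop. Qed.

Lemma ins_cat u t v s : ins (u ++ t :: v) (size u) s = u ++ [:: s; t; ops s] ++ v.
Proof.
have e : drop (size u).+1 (u ++ t :: v) = v by rewrite -cat_rcons drop_size_cat ?size_rcons.
by rewrite /ins e take_size_cat // nth_cat ltnn subnn.
Qed.

Lemma del_cat u s t s' v : del (u ++ [:: s, t, s' & v]) (size u) = u ++ t :: v.
Proof.
rewrite /del take_size_cat // nth_cat ltnNge leqnSn /= subSn // subnn /=.
by rewrite -[u ++ [:: s, t, s' & v]]/(u ++ [:: s; t; s'] ++ v) catA drop_size_cat // size_cat addn3.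
Qed.

Lemma delK w j s : (j < size w)%N -> del (ins w j s) j = w.
Proof.
move=> jw; rewrite {2}(split_nth jw) -(del_cat _ s _ (ops s)) size_takel //; exact: ltnW.
Qed.

Lemma nth_ins w j s : (j < size w)%N -> nth s0 (ins w j s) j = s.
Proof. by move=> jw; rewrite /ins nth_cat size_takel ?(ltnW jw) // ltnn subnn. Qed.

Lemma bumpat_ins w j s : (j < size w)%N -> bumpat (ins w j s) j.
Proof.
move=> jw; have -> : j = (size (take j w) + 0)%N by rewrite size_takel ?addn0 // ltnW.
rewrite {1}/ins size_takel ?addn0 ?(ltnW jw) //.
have := bumpat_catr (take j w) ([:: s; nth s0 w j; ops s] ++ drop j.+1 w) 0.
by rewrite size_takel ?(ltnW jw) // addn0 => ->; rewrite /bumpat /= eqxx.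
Qed.

Lemma bumpatP w j : bumpat w j ->
  exists u s t v, [/\ w = u ++ [:: s, t, ops s & v] & j = size u].
Proof.
move=> /andP[jw /eqP e]; exists (take j w), (nth s0 w j), (nth s0 w j.+1), (drop j.+3 w).
split; last by rewrite size_takel //; lia.
rewrite -[LHS](cat_take_drop j) (drop_nth s0); last lia.
by rewrite (drop_nth s0); last lia; rewrite (drop_nth s0) // e.
Qed.

Lemma insK w j : bumpat w j -> ins (del w j) j (nth s0 w j) = w.
Proof.
move=> /bumpatP[u [s [t [v [-> ->]]]]].
by rewrite del_cat ins_cat nth_cat ltnn subnn.
Qed.

(** The two sites that the inserted bump adds; by [traj_ins] all old sites are kept. *)
Definition y1 w j s := disp (take j w) + sv s.
Definition y2 w j s := disp (take j w) + sv s + sv (nth s0 w j).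

Lemma traj_ins w j s : (j < size w)%N ->
  perm_eq (traj 0 (ins w j s)) [:: y1 w j s, y2 w j s & traj 0 w].
Proof.
move=> jw; have -> : traj 0 w = vis 0 (take j w) ++
    traj (disp (take j w)) (nth s0 w j :: drop j.+1 w).
  by rewrite {1}(split_nth jw) traj_cat add0r.
rewrite /ins !traj_cat !add0r /= !traj_cons sv_ops.
have -> : sv s + (sv (nth s0 w j) + (- sv s + 0)) = sv (nth s0 w j) by rewrite addr0 addrC subrK.
set x := disp _; set a := vis _ _; set b := traj _ _.
rewrite -[X in perm_eq X _]/(a ++ ([:: x] ++ [:: x + sv s; x + sv s + sv (nth s0 w j)]) ++ b).
rewrite -[X in perm_eq _ X]/([:: x + sv s; x + sv s + sv (nth s0 w j)] ++ a ++ [:: x] ++ b).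
by rewrite -(catA [:: x]) catA perm_catCA -catA.
Qed.

Lemma half_insE w j s : (j < size w)%N -> half (ins w j s) =
  [&& half w, y1 w j s \notin traj 0 w, y2 w j s \notin traj 0 w,
      0 <= y1 w j s 0 0 & 0 <= y2 w j s 0 0].
Proof.
move=> jw; rewrite /half /saw /nonneg (perm_uniq (traj_ins s jw)).
rewrite (perm_all _ (traj_ins s jw)) /= inE negb_or.
have -> : y1 w j s != y2 w j s.
  rewrite /y2 -{1}[y1 w j s]addr0 (inj_eq (addrI _)); apply/eqP => /rowP/(_ (nth s0 w j).1).
  by rewrite svE mxE eqxx; case: ifP.
rewrite /=.
by case: (uniq _); case: (all _ _); case: (y1 _ _ _ \in _); case: (y2 _ _ _ \in _);
   rewrite /= ?andbT ?andbF.
Qed.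

(** At most 2 bumps straddle each of the two cuts and at most 3 start in the inserted factor. *)
Lemma nbump_ins w j s : (j < size w)%N ->
  (nbump w <= nbump (ins w j s) + 7)%N /\ (nbump (ins w j s) <= nbump w + 7)%N.
Proof.
move=> jw; rewrite {1 4}(split_nth jw) /ins.
set u := take j w; set v := drop _ w; set t := nth s0 w j.
have := nbump_cat u (t :: v); have := nbump_cat [:: t] v.
have := nbump_cat u ([:: s; t; ops s] ++ v); have := nbump_cat [:: s; t; ops s] v.
have : (nbump [:: s; t; ops s] <= 3)%N by apply: count_size.
have : (nbump [:: t] <= 1)%N by apply: count_size.
rewrite /= -/([:: s; t; ops s] ++ v) -[t :: v]/([:: t] ++ v).
move: (nbump _) (nbump _) (nbump _) (nbump _) (nbump _) (nbump _) (nbump _) (nbump _) => *; lia.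
Qed.

Definition places w : seq (nat * step d) :=
  [seq p <- [seq (j, s) | j <- iota 0 (size w), s <- enum {: step d}] | half (ins w p.1 p.2)].
Definition nplace w := size (places w).

Lemma mem_places w j s : ((j, s) \in places w) = (j < size w)%N && half (ins w j s).
Proof.
rewrite mem_filter andbC; congr (_ && _).
apply/allpairsP/idP => [[[j' s'] /= [jw _ [-> _]]]|jw].
  by rewrite mem_iota add0n in jw.
by exists (j, s); rewrite /= mem_iota add0n jw mem_enum.
Qed.

Lemma uniq_places w : uniq (places w).
Proof.
apply: filter_uniq; apply: allpairs_uniq; rewrite ?iota_uniq ?enum_uniq //.
by move=> [? ?] [? ?] _ _ [-> ->].
Qed.

Lemma nplace_le w : (nplace w <= 2 * d.+1 * size w)%N.
Proof.
rewrite /nplace size_filter (leq_trans (count_size _ _)) // size_allpairs size_iota.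
by rewrite -cardE card_prod card_ord card_bool (mulnC d.+1) mulnC.
Qed.

Definition bumps w := [seq j <- iota 0 (size w) | bumpat w j].

Lemma mem_bumps w j : (j \in bumps w) = bumpat w j.
Proof.
rewrite mem_filter mem_iota add0n andbC.
by apply/andP/idP => [[]//|b]; split=> //; apply: bumpat_size.
Qed.

Lemma size_bumps w : size (bumps w) = nbump w.
Proof. by rewrite size_filter. Qed.

(** Pairs (walk, place) inject into pairs (walk with n + 2 steps, one of its bumps): the position of
    the bump and its outer step undo the insertion. *)
Lemma insertion_le (R : numDomainType) (F : word d -> R) n : (forall w, 0 <= F w) ->
  \sum_(w <- wf (@half d) n) \sum_(p <- places w) F (ins w p.1 p.2)
  <= \sum_(w <- wf (@half d) n.+2) (nbump w)%:R * F w.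
Proof.
move=> F0.
have -> : \sum_(w <- wf (@half d) n.+2) (nbump w)%:R * F w =
    \sum_(p <- [seq (w, j) | w <- wf (@half d) n.+2, j <- bumps w]) F p.1.
  rewrite big_allpairs_dep; apply: eq_bigr => w _ /=.
  by rewrite big_const_seq count_predT size_bumps iter_addr_0 mulr_natl.
have -> : \sum_(w <- wf (@half d) n) \sum_(p <- places w) F (ins w p.1 p.2) =
    \sum_(q <- [seq (w, p) | w <- wf (@half d) n, p <- places w]) F (ins q.1 q.2.1 q.2.2).
  by rewrite big_allpairs_dep.
apply: (@ler_sum_inj _ _ _ _ _ (fun q => (ins q.1 q.2.1 q.2.2, q.2.1))).
- apply: allpairs_uniq_dep; [exact: uniq_wf|by move=> w _; apply: uniq_places|].
  by move=> [? ?] [? ?] _ _ [-> ->].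
- move=> [w [j s]] [w' [j' s']] /allpairsPdep[x [[i r] [_ ip [-> -> ->]]]].
  move=> /allpairsPdep[x' [[i' r'] [_ ip' [-> -> ->]]]] /= [e ei].
  move: ip ip'; rewrite !mem_places => /andP[ix _] /andP[ix' _].
  rewrite -ei in e ix' *.
  have := congr1 (fun w => del w i) e; rewrite !delK // => ->.
  by have := congr1 (fun w => nth s0 w i) e; rewrite !nth_ins // => ->.
- move=> [w [j s]] /allpairsPdep[x [[i r] [xn ip [-> -> ->]]]]; split => //=.
  move: ip xn; rewrite mem_places !mem_wf => /andP[ix hx] /andP[_ /eqP xn].
  apply/allpairsPdep; exists (ins x i r), i.
  by rewrite mem_wf hx size_ins // xn eqxx mem_bumps bumpat_ins.
- by [].
Qed.

(** Deleting a bump only removes two sites, so what remains is a half-space walk in which the bump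
    can be put back. *)
Lemma insertion_ge (R : numDomainType) (F : word d -> R) n : (forall w, 0 <= F w) ->
  \sum_(w <- wf (@half d) n.+2) (nbump w)%:R * F w
  <= \sum_(w <- wf (@half d) n) \sum_(p <- places w) F (ins w p.1 p.2).
Proof.
move=> F0.
have -> : \sum_(w <- wf (@half d) n.+2) (nbump w)%:R * F w =
    \sum_(p <- [seq (w, j) | w <- wf (@half d) n.+2, j <- bumps w]) F p.1.
  rewrite big_allpairs_dep; apply: eq_bigr => w _ /=.
  by rewrite big_const_seq count_predT size_bumps iter_addr_0 mulr_natl.
have -> : \sum_(w <- wf (@half d) n) \sum_(p <- places w) F (ins w p.1 p.2) =
    \sum_(q <- [seq (w, p) | w <- wf (@half d) n, p <- places w]) F (ins q.1 q.2.1 q.2.2).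
  by rewrite big_allpairs_dep.
apply: (@ler_sum_inj _ _ _ _ _ (fun q => (del q.1 q.2, (q.2, nth s0 q.1 q.2)))).
- apply: allpairs_uniq_dep; [exact: uniq_wf|by move=> w _; rewrite filter_uniq ?iota_uniq|].
  by move=> [? ?] [? ?] _ _ [-> ->].
- move=> [w j] [w' j'] /allpairsPdep[x [i [_ ip [-> ->]]]].
  move=> /allpairsPdep[x' [i' [_ ip' [-> ->]]]] /= [e ei es].
  move: ip ip'; rewrite !mem_bumps => ip ip'.
  rewrite -ei in e es ip' *.
  by have := insK ip; rewrite e es insK // => ->.
- move=> [w j] /allpairsPdep[x [i [xn ip [-> ->]]]] /=.
  move: ip xn; rewrite mem_bumps mem_wf => ip /andP[hx /eqP xn]; rewrite insK //; split => //.
  have iS : (i < size (del x i))%N.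
    by move: ip => /bumpatP[u [s [t [v [-> ->]]]]]; rewrite del_cat size_cat /=; lia.
  have dS : size (del x i) = n.
    by move: (size_ins (nth s0 x i) iS); rewrite insK // xn => -[].
  apply/allpairsPdep; exists (del x i), (i, nth s0 x i).
  rewrite mem_wf mem_places iS insK // hx dS eqxx !andbT; split => //.
  by move: hx; rewrite -{1}(insK ip) half_insE // => /and5P[].
- by [].
Qed.

End Insertion.

Section PlaceBound.
Context (d : nat).
Implicit Types (s t : step d) (u v w : word d) (x y : lattice d).
Local Notation s0 := (e1 d).

Lemma disp_take_inj w : saw w ->
  {in [pred i | (i <= size w)%N] &, injective (fun i => disp (take i w))}.
Proof.
move=> sw i j; rewrite !inE => iw jw e.
have nthE n : (n <= size w)%N -> nth 0 (traj 0 w) n = disp (take n w).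
  move=> nw; rewrite -{1}(cat_take_drop n w) traj_cat nth_cat size_vis size_takel //.
  by rewrite ltnn subnn traj_head add0r.
apply/eqP; rewrite -(nth_uniq 0 _ _ sw) ?size_traj ?ltnS //; apply/eqP.
by rewrite !nthE.
Qed.

Lemma count_places_le w (p : pred (nat * step d)) : half w ->
  (forall j j' s, (j < size w)%N -> (j' < size w)%N -> p (j, s) -> p (j', s) -> j = j') ->
  (count p (places w) <= 2 * d.+1)%N.
Proof.
move=> hw pinj; rewrite -size_filter.
apply: (@leq_trans (size (enum {: step d}))); last first.
  by rewrite -cardE card_prod card_ord card_bool mulnC.
apply: (leq_size_inj (f := snd)); first by rewrite filter_uniq ?uniq_places.
  move=> [j s] [j' s']; rewrite !(mem_filter p) !mem_places.
  move=> /and3P[pj jw _] /and3P[pj' jw' _] /= e; subst s'.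
  by rewrite (pinj j j' s).
by move=> [j s] _; rewrite mem_enum.
Qed.

(** A place is lost only if its position is j or one of its two sites is one of the two new sites.
    Each of these five conditions holds for at most one position per step s, hence for at most 2 (d
    + 1) places. *)
Lemma nplace_ins w j s : half w -> (j < size w)%N -> half (ins w j s) ->
  (nplace w <= nplace (ins w j s) + 10 * d.+1)%N.
Proof.
move=> hw jw hi; have sw := half_saw_word hw.
pose z1 := y1 w j s; pose z2 := y2 w j s.
pose bad (p : nat * step d) := [|| p.1 == j, y1 w p.1 p.2 == z1, y1 w p.1 p.2 == z2,
  y2 w p.1 p.2 == z1 | y2 w p.1 p.2 == z2].
have y1inj z i i' r : (i < size w)%N -> (i' < size w)%N ->
    y1 w i r == z -> y1 w i' r == z -> i = i'.
  move=> iw iw' /eqP<- /eqP /addIr e; symmetry.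
  by apply: disp_take_inj e; rewrite // inE ltnW.
have y2inj z i i' r : (i < size w)%N -> (i' < size w)%N ->
    y2 w i r == z -> y2 w i' r == z -> i = i'.
  move=> iw iw' /eqP<- /eqP; rewrite /y2 addrAC [RHS]addrAC => /addIr e; symmetry.
  have : disp (take i'.+1 w) = disp (take i.+1 w).
    by rewrite !(take_nth s0) // -!cats1 !disp_cat /= !addr0.
  by move=> /(disp_take_inj sw); rewrite !inE => /(_ iw' iw) [].
have hbad : (count bad (places w) <= 5 * (2 * d.+1))%N.
  have cU (a b : pred (nat * step d)) l : (count (predU a b) l <= count a l + count b l)%N.
    by rewrite -count_predUI leq_addr.
  pose q1 := [pred p : nat * step d | p.1 == j].
  pose q2 := [pred p : nat * step d | y1 w p.1 p.2 == z1].
  pose q3 := [pred p : nat * step d | y1 w p.1 p.2 == z2].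
  pose q4 := [pred p : nat * step d | y2 w p.1 p.2 == z1].
  pose q5 := [pred p : nat * step d | y2 w p.1 p.2 == z2].
  have c1 : (count q1 (places w) <= 2 * d.+1)%N.
    by apply: count_places_le => // i i' r _ _ /eqP /= -> /eqP /= ->.
  have c2 : (count q2 (places w) <= 2 * d.+1)%N by apply: count_places_le => //= *; apply: y1inj; eauto.
  have c3 : (count q3 (places w) <= 2 * d.+1)%N by apply: count_places_le => //= *; apply: y1inj; eauto.
  have c4 : (count q4 (places w) <= 2 * d.+1)%N by apply: count_places_le => //= *; apply: y2inj; eauto.
  have c5 : (count q5 (places w) <= 2 * d.+1)%N by apply: count_places_le => //= *; apply: y2inj; eauto.
  have h1 := cU q1 (predU q2 (predU q3 (predU q4 q5))) (places w).
  have h2 := cU q2 (predU q3 (predU q4 q5)) (places w).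
  have h3 := cU q3 (predU q4 q5) (places w).
  have h4 := cU q4 q5 (places w).
  apply: leq_trans h1 _; rewrite -[5%N]/(1 + (1 + (1 + (1 + 1))))%N !mulnDl !mul1n.
  apply: leq_add => //; apply: leq_trans h2 _.
  apply: leq_add => //; apply: leq_trans h3 _.
  apply: leq_add => //; apply: leq_trans h4 _.
  exact: leq_add.
rewrite -[10%N]/(5 * 2)%N -mulnA -{1}[nplace w](count_predC bad) addnC; apply: leq_add => //.
rewrite -size_filter.
(* Positions after j move by two; position j itself is among the bad ones. *)
pose sh i := if (i < j)%N then i else i.+2.
have wE := split_nth jw.
have iE : ins w j s = take j w ++ [:: s; nth s0 w j; ops s] ++ drop j.+1 w by [].
apply: (leq_size_inj (f := fun p => (sh p.1, p.2))); first by rewrite filter_uniq ?uniq_places.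
  by move=> [i r] [i' r'] _ _ /= [e ->]; congr (_, _); move: e; rewrite /sh; have [?|?] := ltnP i j; have [?|?] := ltnP i' j; lia.
move=> [i r]; rewrite (mem_filter (predC bad)) !mem_places /= => /and3P[nb iw hir].
move: nb; rewrite /bad /= !negb_or => /and5P[nij n11 n12 n21 n22].
have shlt : (sh i < size (ins w j s))%N by rewrite size_ins // /sh; have [?|?] := ltnP i j; lia.
rewrite shlt /=.
have [e1 e2] : disp (take (sh i) (ins w j s)) = disp (take i w) /\
    nth s0 (ins w j s) (sh i) = nth s0 w i.
  have sj : size (take j w) = j by rewrite size_takel // ltnW.
  rewrite /sh; case: ltnP => ij.
    by rewrite iE takel_cat ?nth_cat ?sj ?ij ?(ltnW ij) // take_takel ?(ltnW ij) // nth_take.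
  have {nij} {}ij : (j < i)%N by rewrite ltn_neqAle eq_sym nij.
  have [m im] : exists m, i = (j + m.+1)%N by exists (i - j.+1)%N; lia.
  have i2 : i.+2 = (j + (3 + m))%N by lia.
  rewrite i2 iE nth_cat take_cat sj !ltnNge !leq_addr /= addKn /=.
  have -> : take i w = take j w ++ nth s0 w j :: take m (drop j.+1 w).
    by rewrite im {1}wE take_cat sj ltnNge leq_addr /= addKn.
  rewrite nth_drop im addSnnS add0n; split => //.
  rewrite !disp_cat /= sv_ops; congr (_ + _).
  by rewrite [sv _ + (- _ + _)]addrCA addNKr.
move: hir; rewrite (half_insE _ iw) (half_insE _ shlt) hw hi /=.
have pm := perm_mem (traj_ins s jw).
by rewrite /y1 /y2 e1 e2 !pm !inE -/(y1 w i r) -/(y2 w i r) (negbTE n11) (negbTE n12) (negbTE n21) (negbTE n22).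
Qed.

End PlaceBound.

(** * Bridges *)

(** For decompositions that exist but need not be unique: f recomposes x from y, and one preimage is
    chosen for each x. *)
Lemma ler_sum_cover (R : numDomainType) (T U : eqType) (s1 : seq T) (s2 : seq U)
    (f : U -> T) (F : T -> R) (G : U -> R) :
  uniq s1 ->
  (forall x, x \in s1 -> exists y, [/\ y \in s2, f y = x & F x <= G y]) ->
  (forall y, y \in s2 -> 0 <= G y) ->
  \sum_(x <- s1) F x <= \sum_(y <- s2) G y.
Proof.
case: s2 => [|y0 s2'] us1 cov G0.
  case: s1 us1 cov => [_ _|x s1 _ cov]; first by rewrite !big_nil.
  by have [y []] := cov x (mem_head _ _).
set s2 := y0 :: s2' in cov G0 *.
pose p x y := (f y == x) && (F x <= G y).
pose g x := nth y0 s2 (find (p x) s2).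
have gP x : x \in s1 -> g x \in s2 /\ p x (g x).
  move=> /cov[y [ys2 fy xy]]; have h : has (p x) s2.
    by apply/hasP; exists y => //; rewrite /p fy eqxx.
  by split; [rewrite mem_nth // -has_find | apply: nth_find].
apply: (@ler_sum_inj _ _ _ _ _ g) => //.
- by move=> x x' /gP[_ /andP[/eqP e _]] /gP[_ /andP[/eqP e' _]] eg; rewrite -e -e' eg.
- by move=> x /gP[? /andP[_ ?]].
Qed.

Section Bridges.
Context (d : nat).
Implicit Types (s t : step d) (u v w : word d) (x y : lattice d).
Local Notation e1 := (e1 d).

Lemma nonneg_cat u v : nonneg (u ++ v) =
  all (fun x : lattice d => 0 <= x 0 0) (vis 0 u) &&
  all (fun x : lattice d => 0 <= x 0 0) (traj (disp u) v).
Proof. by rewrite /nonneg traj_cat all_cat add0r. Qed.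

Lemma half_catl u v : half (u ++ v) -> half u.
Proof.
move=> /andP[/saw_cat[su _ _] /allP nw]; rewrite /half su; apply/allP => x xu.
by apply: nw; rewrite mem_traj_cat xu.
Qed.

(** The end lies strictly above all earlier sites while the start is only weakly lowest, so that any
    half-space walk may follow a bridge. *)
Definition bridge w := half w && all (fun x : lattice d => x 0 0 < disp w 0 0) (vis 0 w).

Lemma bridge_half w : bridge w -> half w. Proof. by case/andP. Qed.

Lemma bridge_nil : bridge [::].
Proof. by rewrite /bridge /half /saw /nonneg traj_nil /= mxE. Qed.

Lemma bridge_disp_ge0 w : half w -> 0 <= disp w 0 0.
Proof. by move=> /andP[_ /allP]; apply; rewrite -[disp w]add0r mem_traj_last. Qed.

Lemma bridge_cat_half u v : bridge u -> half v -> half (u ++ v).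
Proof.
move=> /andP[hu /allP bu] /andP[sv nv]; have /andP[su nu] := hu.
apply/andP; split.
  rewrite saw_catE su sv /=; apply/hasPn => x xv; apply/negP => /bu.
  by rewrite ltNge; move/nonnegP: nv => ->.
rewrite nonneg_cat; apply/andP; split.
  by apply/allP => x xu; move/allP: nu; apply; apply: mem_vis_traj.
apply/allP => x xv; apply: le_trans (bridge_disp_ge0 hu) _.
by move/nonnegP: nv => ->.
Qed.

Lemma bridge_cat u v : bridge u -> bridge v -> bridge (u ++ v).
Proof.
move=> bu bv; rewrite /bridge (bridge_cat_half bu (bridge_half bv)) vis_cat add0r all_cat.
have [hv /allP lv] := andP bv; have [hu /allP lu] := andP bu.
rewrite /=; apply/andP; split; apply/allP => x; rewrite disp_cat mxE.
  by move=> /lu h; rewrite (lt_le_trans h) // lerDl bridge_disp_ge0.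
by rewrite vis0_shift => /mapP[y /lv h ->]; rewrite mxE ltrD2l.
Qed.

Lemma bridge_catr u v : bridge (u ++ v) -> half v -> bridge v.
Proof.
move=> /andP[_ /allP lw] hv; rewrite /bridge hv; apply/allP => x xv.
have : disp u + x \in vis 0 (u ++ v).
  by rewrite vis_cat mem_cat add0r [vis (disp u) v]vis0_shift map_f ?orbT.
by move=> /lw; rewrite disp_cat !mxE ltrD2l.
Qed.

Definition irred w := [&& bridge w, w != [::] &
  ~~ has (fun i => bridge (take i w) && bridge (drop i w)) (iota 1 (size w).-1)].

Lemma irred_bridge w : irred w -> bridge w. Proof. by case/and3P. Qed.

Lemma irredP u v : irred (u ++ v) -> bridge u -> bridge v -> u = [::] \/ v = [::].
Proof.
move=> /and3P[_ _ /hasPn h] bu bv; case: u bu h => [|s u] bu h; first by left.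
case: v bv h => [|t v] bv h; first by right.
have := h (size (s :: u)); rewrite take_size_cat // drop_size_cat // bu bv mem_iota size_cat /=.
by move=> /(_ _)/negP; case=> //; lia.
Qed.

(** If u is shorter, then u' = u ++ g where g begins v and is thus a half-space walk; this makes g a
    bridge, against the irreducibility of u'. *)
Lemma irred_prefix_inj u u' v v' : irred u -> irred u' -> half v -> half v' ->
  u ++ v = u' ++ v' -> u = u'.
Proof.
wlog le_uu' : u u' v v' / (size u <= size u')%N.
  move=> W iu iu' hv hv' e; have [h|/ltnW h] := leqP (size u) (size u'); first exact: W h iu iu' hv hv' e.
  by symmetry; apply: W h iu' iu hv' hv (esym e).
move=> iu iu' hv hv' e.
have uE : u = take (size u) u'.
  by rewrite -(takel_cat v' le_uu') -e take_size_cat.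
pose g := drop (size u) u'.
have u'E : u' = u ++ g by rewrite {1}uE cat_take_drop.
have vE : v = g ++ v'.
  by have := congr1 (drop (size u)) e; rewrite u'E -catA !drop_size_cat.
have hg : half g by rewrite vE in hv; apply: half_catl hv.
have bg : bridge g by apply: (@bridge_catr u); rewrite -?u'E ?irred_bridge.
have [u0|g0] : u = [::] \/ g = [::].
- by apply: irredP; rewrite -?u'E // irred_bridge.
- by case/and3P: iu => _; rewrite u0.
- by rewrite u'E g0 cats0.
Qed.

Lemma irred_factor w : bridge w -> w != [::] ->
  exists u v, [/\ irred u, bridge v & w = u ++ v].
Proof.
have [n] := ubnP (size w); elim: n w => // n IH w sw bw wn0.
have [iw|niw] := boolP (irred w).
  by exists w, [::]; rewrite cats0 iw bridge_nil.
have /hasP[i] : has (fun i => bridge (take i w) && bridge (drop i w)) (iota 1 (size w).-1).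
  by move: niw; rewrite /irred bw wn0 /= negbK.
rewrite mem_iota => /andP[i1 i2] /andP[bt bd].
have i3 : (i < size w)%N by lia.
have st : size (take i w) = i by rewrite size_takel // ltnW.
have h1 : (size (take i w) < n)%N by rewrite st; lia.
have h2 : take i w != [::] by rewrite -size_eq0 st -lt0n.
have [u [v [iu bv tE]]] := IH _ h1 bt h2.
by exists u, (v ++ drop i w); rewrite catA -tE cat_take_drop bridge_cat.
Qed.

Lemma bridge_e1 : bridge [:: e1].
Proof.
rewrite /bridge /= mxE /= addr0 sv_e1 !andbT.
by apply: (half_straight d 1).
Qed.

Lemma irred_e1 : irred [:: e1].
Proof. by rewrite /irred bridge_e1. Qed.

Lemma min_split w : exists u v, w = u ++ v /\
  forall x, x \in traj 0 w -> disp u 0 0 <= x 0 0.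
Proof.
elim/last_ind: w => [|w s [u [v [-> h]]]].
  by exists [::], [::]; split=> // x; rewrite traj_nil inE => /eqP->.
pose e := disp (rcons (u ++ v) s).
have hT x : x \in traj 0 (rcons (u ++ v) s) -> x = e \/ x \in traj 0 (u ++ v).
  rewrite -cats1 mem_traj_cat => /orP[|]; first by right.
  rewrite traj_cons traj_nil !inE => /orP[/eqP->|/eqP->].
    by right; apply: mem_traj_last.
  by left; rewrite /e -cats1 [in RHS]disp_cat /= addr0 add0r.
have [le|lt] := lerP (disp u 0 0) (e 0 0).
  exists u, (rcons v s); rewrite -rcons_cat; split => // x /hT[->//|]; exact: h.
exists (rcons (u ++ v) s), [::]; rewrite cats0; split => // x /hT[->//|/h].
by apply: le_trans; apply: ltW.
Qed.

Lemma half_of_ge u w : saw w -> (forall x, x \in traj (disp u) w -> disp u 0 0 <= x 0 0) -> half w.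
Proof. by move=> sw h; rewrite /half sw; apply/(nonnegP (disp u)). Qed.

(** Cut at a site of minimal height and reverse the first part. *)
Lemma saw_split_half w : saw w -> exists u v, [/\ w = rv u ++ v, half u & half v].
Proof.
move=> sw; have [u [v [wE h]]] := min_split w; exists (rv u), v; rewrite rvK wE.
have [su sv _] : [/\ saw u, saw v & True] by rewrite wE in sw; case/saw_cat: sw.
split=> //; apply: (@half_of_ge u) => //; first by rewrite saw_rv.
  move=> x; rewrite -[disp u]add0r traj_rv mem_rev add0r => xu.
  by apply: h; rewrite wE mem_traj_cat xu.
by move=> x xv; apply: h; rewrite wE mem_traj_cat add0r xv orbT.
Qed.

Definition rfs s : step d := if s.1 == ord0 then ops s else s.

Lemma rfsK : involutive rfs.
Proof. case=> i b; rewrite /rfs /=; have [->|ne] := eqVneq i ord0.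
  by rewrite /= /ops /= negbK.
by rewrite /= (negbTE ne). Qed.

Definition rfx x : lattice d := \row_i (if i == ord0 then - x 0 i else x 0 i).

Lemma rfxK : involutive rfx.
Proof. move=> x; apply/rowP => i; rewrite /rfx !mxE; have [->|_] //= := eqVneq i ord0.
by rewrite opprK. Qed.

Lemma rfxD x y : rfx (x + y) = rfx x + rfx y.
Proof. by apply/rowP => i; rewrite !mxE; case: ifP => _; rewrite ?opprD. Qed.

Lemma sv_rfs s : sv (rfs s) = rfx (sv s).
Proof.
apply/rowP => i; rewrite /rfx mxE /rfs; have [s0|s0] := eqVneq s.1 ord0.
  rewrite sv_ops mxE !svE s0; have [//|_] := eqVneq i ord0.
  by rewrite oppr0.
have [->|//] := eqVneq i ord0.
by rewrite !svE eq_sym (negbTE s0) oppr0.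
Qed.

Lemma traj_rf x w : traj (rfx x) (map rfs w) = map rfx (traj x w).
Proof.
elim: w x => [|s w IH] x; first by rewrite !traj_nil.
by rewrite map_cons !traj_cons map_cons -IH rfxD sv_rfs.
Qed.

Definition low a w := half w && all (fun x : lattice d => x 0 0 < a%:Z) (traj 0 w).

Lemma step_down s : sv s 0 0 < 0 -> s = ops e1.
Proof.
case: s => i [] /=; rewrite svE /=; have [<-|//] := eqVneq 0 i.
  by [].
by [].
Qed.

(* Cut at the last visit to the top level and reflect what follows. *)
Lemma low_split a w : low a.+1 w -> ~~ low a w ->
  exists u v, [/\ bridge (rcons u e1), disp (rcons u e1) 0 0 = a.+1%:Z &
    w = u \/ w = u ++ ops e1 :: map rfs v /\ low a v].
Proof.
move=> /andP[hw /allP hi]; rewrite /low hw /= => /allPn[x xw xa].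
have htop : has (fun x : lattice d => a%:Z <= x 0 0) (traj 0 w).
  by apply/hasP; exists x => //; rewrite leNgt.
have [u [v [wE ua vlow]]] := last_visit htop; rewrite add0r in ua vlow.
have uin : disp u \in traj 0 w by rewrite wE mem_traj_cat -{1}[disp u]add0r mem_traj_last.
have hu : disp u 0 0 = a%:Z.
  apply/eqP; rewrite eq_le ua andbT; have := hi _ uin; lia.
have [su sav _] : [/\ saw u, saw v & True] by case/andP: hw; rewrite wE => /saw_cat[].
have top y : y \in traj 0 u -> y 0 0 < disp (rcons u e1) 0 0.
  move=> yu; rewrite -cats1 disp_cat /= addr0 mxE sv_e1 hu.
  by have := hi y; rewrite wE mem_traj_cat yu => /(_ isT); lia.
have ge0 y : y \in traj 0 w -> 0 <= y 0 0 by move=> yw; case/andP: hw => _ /allP; apply.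
exists u.
(* u ends at the top level of the walk, so one more step up makes the end strictly highest. *)
have br : bridge (rcons u e1).
  have tE : traj 0 (rcons u e1) = rcons (traj 0 u) (disp (rcons u e1)).
    by rewrite -cats1 traj_catr traj_cons traj_nil /= -cats1 disp_cat /= addr0 add0r.
  apply/andP; split; last first.
    have -> : vis 0 (rcons u e1) = traj 0 u by rewrite -cats1 vis_cat /= /traj cats1.
    by apply/allP => y; apply: top.
  apply/andP; split.
    rewrite /saw tE rcons_uniq [uniq _]su andbT; apply/negP => /top.
    by rewrite ltxx.
  apply/allP => y; rewrite tE mem_rcons inE => /orP[/eqP->|yu].
    by apply: le_trans (ltW (top _ (mem_traj_head 0 u))); rewrite mxE.
  by apply: ge0; rewrite wE mem_traj_cat yu.
have dE : disp (rcons u e1) 0 0 = a.+1%:Z.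
  by rewrite -cats1 disp_cat /= addr0 mxE sv_e1 hu; lia.
case: v wE vlow sav => [|s v] wE vlow sav; first by exists [::]; split => //; left; rewrite wE cats0.
rewrite traj_cons /= in vlow.
have slow y : y \in traj (disp u + sv s) v -> y 0 0 < a%:Z.
  by move=> yv; rewrite ltNge; apply/negP => ya; case/negP: vlow; apply/hasP; exists y.
have sE : s = ops e1.
  by apply: step_down; have := slow _ (mem_traj_head _ _); rewrite mxE hu gtrDl.
exists (map rfs v); split => //; right; split.
  by rewrite (mapK rfsK) -sE.
have sav' : saw v by case/(@saw_cat _ [:: s]): sav.
(* What follows the step down starts at height a - 1; under the reflection a height h becomes a - 1
   - h, again between 0 and a - 1. *)
have tr y : y \in traj 0 (map rfs v) -> exists2 z, z \in traj (disp u + sv s) v & y 0 0 = a%:Z - 1 - z 0 0.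
  have r0 : rfx 0 = 0 by apply/rowP => i; rewrite !mxE oppr0; case: ifP.
  rewrite -r0 traj_rf => /mapP[z zv ->].
  exists (disp u + sv s + z); first by rewrite mem_traj_shift addrC addKr.
  have -> : (disp u + sv s + z) 0 0 = a%:Z - 1 + z 0 0.
    rewrite mxE; congr (_ + _); rewrite mxE hu; congr (_ + _).
    by rewrite sE sv_ops mxE sv_e1.
  by rewrite mxE eqxx; ring.
have sub z : z \in traj (disp u + sv s) v -> z \in traj 0 w.
  by move=> zv; rewrite wE mem_traj_cat traj_cons inE add0r zv !orbT.
have i1 (m : int) : 0 <= m -> a%:Z - 1 - m < a%:Z by clear; lia.
have i2 (m : int) : m < a%:Z -> 0 <= a%:Z - 1 - m by clear; lia.
apply/andP; split; last first.
  by apply/allP => y /tr[z /sub/ge0 zv ->]; apply: i1.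
apply/andP; split; last by apply/allP => y /tr[z /slow zv ->]; apply: i2.
have r0 : rfx 0 = 0 by apply/rowP => i; rewrite !mxE oppr0; case: ifP.
by rewrite /saw -r0 traj_rf map_inj_uniq //; apply: inv_inj rfxK.
Qed.

End Bridges.

Lemma geometric_sum_le (R : realFieldType) (q : R) n : 0 <= q -> q < 1 ->
  \sum_(i < n) q ^+ i <= (1 - q)^-1.
Proof.
move=> q0 q1; rewrite -[leRHS]mul1r ler_pdivlMr ?subr_gt0 // mulrC.
have -> : (1 - q) * \sum_(i < n) q ^+ i = 1 - q ^+ n.
  by rewrite -opprB mulNr -subrX1 opprB.
by rewrite gerBl exprn_ge0.
Qed.

(** * Generating functions of bridges and half-space walks *)

Section Kesten.
Context (R : realType) (d : nat).
Implicit Types (P Q : pred (word d)) (w : word d) (z : R).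
Local Notation e1 := (e1 d).
Local Notation mu := (mu R d).
Local Notation nsaw := (nsaw R d).
Local Notation nhalf := (nhalf R d).

Lemma words_le_filter P n : words_le P n = [seq w <- words_le predT n | P w].
Proof.
rewrite /words_le filter_flatten -map_comp; congr flatten; apply: eq_map => l.
by rewrite /= /wf filter_predT.
Qed.

Lemma uniq_words_le P n : uniq (words_le P n).
Proof.
rewrite words_le_filter filter_uniq //.
elim: n => [|n IH]; first by [].
have -> : words_le predT n.+1 = words_le predT n ++ @wf d predT n.+1.
  rewrite /words_le (_ : iota 0 n.+2 = iota 0 n.+1 ++ [:: n.+1]); last first.
    by rewrite -[[:: n.+1]]/(iota (0 + n.+1) 1) -iotaD addn1.
  by rewrite map_cat flatten_cat; congr (_ ++ _); rewrite -[RHS]cats0.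
rewrite cat_uniq IH uniq_wf andbT.
apply/hasPn => w; rewrite mem_wf => /eqP sw.
by rewrite /= mem_words_le sw ltnn andbF.
Qed.

(** A truncated generating function: at fixed n it is a polynomial in z, so no convergence is
    involved. *)
Definition gf P n z : R := \sum_(w <- words_le P n) z ^+ size w.

Lemma gfE P n z : gf P n z = \sum_(l < n.+1) (cnt P l)%:R * z ^+ l.
Proof.
rewrite /gf /words_le big_flatten big_map -[iota 0 n.+1]/(index_iota 0 n.+1) big_mkord.
apply: eq_bigr => l _; rewrite mulr_natl -size_wf -iter_addr_0 -count_predT -big_const_seq.
by rewrite big_seq [RHS]big_seq; apply: eq_bigr => w; rewrite mem_wf => /andP[_ /eqP->].
Qed.

Lemma gf_ge0 P n z : 0 <= z -> 0 <= gf P n z.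
Proof. by move=> z0; apply: sumr_ge0 => w _; rewrite exprn_ge0. Qed.

Lemma gf_sub P Q n z : 0 <= z -> (forall w, (size w <= n)%N -> P w -> Q w) ->
  gf P n z <= gf Q n z.
Proof.
move=> z0 PQ; apply: ler_sum_sub_seq; first exact: uniq_words_le.
  by move=> w; rewrite !mem_words_le => /andP[Pw sw]; rewrite PQ.
by move=> w _; rewrite exprn_ge0.
Qed.

Lemma gf_split P Q n z : gf P n z = gf (predI P Q) n z + gf (predI P (predC Q)) n z.
Proof.
rewrite /gf (words_le_filter P) (words_le_filter (predI P Q)).
by rewrite (words_le_filter (predI P (predC Q))) !big_filter (bigID Q).
Qed.

Lemma gf_mulE P Q n m z : gf P n z * gf Q m z =
  \sum_(p <- [seq (u, v) | u <- words_le P n, v <- words_le Q m])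
     z ^+ size p.1 * z ^+ size p.2.
Proof. by rewrite big_allpairs /gf mulr_suml; apply: eq_bigr => u _; rewrite mulr_sumr. Qed.

Definition bridge_span a w := bridge w && (disp w 0 0 == a%:Z).

(** The factor z on the left pays for the step [e1] that completes the first part to a bridge, the
    one on the right for the step down between the parts; the 1 beside it stands for an absent
    second part. *)
Lemma gf_low_step a n z : 0 <= z ->
  1 + z * gf (low a.+1) n z <= (1 + z * gf (low a) n z) * (1 + gf (bridge_span a.+1) n.+1 z).
Proof.
move=> z0; rewrite (gf_split _ (low a)) mulrDr addrA mulrDr mulr1; apply: lerD.
  by rewrite lerD2l ler_wpM2l //; apply: gf_sub => // w _ /andP[].
rewrite /gf mulr_sumr.
pose f (p : word d * option (word d)) :=
  let u := take (size p.1).-1 p.1 in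
  if p.2 is Some v then u ++ ops e1 :: map (@rfs d) v else u.
pose g (o : option (word d)) : R := if o is Some v then z * z ^+ size v else 1.
pose s2 := [seq (b, o) | b <- words_le (bridge_span a.+1) n.+1,
                         o <- None :: map (@Some (word d)) (words_le (@low d a) n)].
apply: (@le_trans _ _ (\sum_(p <- s2) z ^+ size p.1 * g p.2)); last first.
  rewrite big_allpairs /= mulrC mulr_suml; apply: ler_sum => b _.
  by rewrite -mulr_sumr big_cons big_map mulr_sumr.
apply: (@ler_sum_cover _ _ _ _ _ f); first exact: uniq_words_le.
  move=> w; rewrite mem_words_le => /andP[/andP[lw /= nlw] wn].
  have [u [v [bu du wE]]] := low_split lw nlw.
  have tE : take (size (rcons u e1)).-1 (rcons u e1) = u.
    by rewrite size_rcons /= -cats1 take_size_cat.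
  have mem_b : (size u <= n)%N -> rcons u e1 \in words_le (bridge_span a.+1) n.+1.
    by move=> un; rewrite mem_words_le /bridge_span bu du eqxx size_rcons ltnS.
  case: wE => [wE|[wE lv]].
    exists (rcons u e1, None); split; rewrite /f /= ?tE //.
      by apply: allpairs_f; rewrite ?mem_head // mem_b // -wE.
    by rewrite wE mulr1 size_rcons exprS.
  have sw : size w = (size u + (size v).+1)%N by rewrite wE size_cat /= size_map.
  exists (rcons u e1, Some v); split; rewrite /f /= ?tE //.
    have un : (size u <= n)%N by rewrite (leq_trans _ wn) // sw leq_addr.
    have vn : (size v <= n)%N by rewrite (leq_trans _ wn) // sw addnS leqW ?leq_addl.
    apply: allpairs_f; first exact: mem_b.
    by rewrite inE /= map_f // mem_words_le lv.
  by rewrite sw size_rcons !exprS exprD exprS mulrA.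
move=> [b o] _ /=; rewrite mulr_ge0 ?exprn_ge0 //; case: o => //= v.
by rewrite mulr_ge0 ?exprn_ge0.
Qed.

Lemma sum_bridge_span a n z : 0 <= z ->
  \sum_(i < a) gf (bridge_span i.+1) n z <= gf (@bridge d) n z.
Proof.
move=> z0; rewrite /gf (words_le_filter (@bridge d)) big_filter.
rewrite (eq_bigr (fun i : 'I_a => \sum_(w <- words_le predT n | bridge_span i.+1 w) z ^+ size w));
  last by move=> i _; rewrite words_le_filter big_filter.
rewrite (exchange_big_dep (@bridge d)) /=; last by move=> i w _ /andP[].
apply: ler_sum => w bw; under eq_bigl => i do rewrite /bridge_span bw /=.
have [/existsP[i /eqP di]|/existsPn ne] := boolP [exists i : 'I_a, disp w 0 0 == i.+1%:Z].
  rewrite (bigD1 i) ?di //= big1 ?addr0 // => j /andP[/eqP[e] /eqP]; case.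
  by apply: val_inj => /=; move: e => [].
by rewrite big1 ?exprn_ge0 // => i; rewrite (negbTE (ne i)).
Qed.

Lemma height_le_size w x : x \in traj 0 w -> x 0 0 <= (size w)%:Z.
Proof.
elim/last_ind: w x => [|w s IH] x.
  by rewrite traj_nil inE => /eqP->; rewrite mxE.
rewrite -cats1 mem_traj_cat => /orP[/IH h|].
  by rewrite size_cat /= (le_trans h) // lez_nat leq_addr.
rewrite traj_cons traj_nil !inE => /orP[/eqP->|/eqP->].
  by rewrite (le_trans (IH _ (mem_traj_last _ _))) // size_cat lez_nat leq_addr.
rewrite mxE size_cat PoszD lerD ?IH ?mem_traj_last //.
exact: le_trans (ler_norm _) (sv_coord_le1 _ _).
Qed.

(* The Hammersley-Welsh bound. *)
Lemma gf_half_le n z : 0 <= z -> z * gf (@half d) n z <= expR (gf (@bridge d) n.+1 z).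
Proof.
move=> z0.
(* Iteration gives a product of factors 1 + B_i over the spans i, bounded by the exponential of the
   sum of the B_i. *)
have step a : 1 + z * gf (low a) n z <= expR (\sum_(i < a) gf (bridge_span i.+1) n.+1 z).
  elim: a => [|a IH].
    rewrite big_ord0 expR0 /gf big_seq big1 ?mulr0 ?addr0 // => w.
    rewrite mem_words_le => /andP[/andP[hw /allP lw] _].
    have := lw _ (mem_traj_head 0 w); by rewrite mxE ltxx.
  apply: le_trans (gf_low_step a n z0) _; rewrite big_ord_recr expRD.
  apply: ler_pM => //; rewrite ?addr_ge0 ?mulr_ge0 ?gf_ge0 //.
  exact: expR_ge1Dx.
apply: (@le_trans _ _ (1 + z * gf (low n.+1) n z)).
  apply: ler_wpDl => //; rewrite ler_wpM2l //; apply: gf_sub => // w wn hw.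
  rewrite /low hw; apply/allP => x /height_le_size xw.
  by rewrite (le_lt_trans xw) // ltz_nat ltnS.
by apply: le_trans (step _) _; rewrite ler_expR sum_bridge_span.
Qed.

Lemma gf_saw_le n z : 0 <= z -> gf (@saw d) n z <= gf (@half d) n z ^+ 2.
Proof.
move=> z0; rewrite expr2 gf_mulE.
apply: (@ler_sum_cover _ _ _ _ _ (fun p => rv p.1 ++ p.2)); first exact: uniq_words_le.
  move=> w; rewrite mem_words_le => /andP[sw wn].
  have [u [v [wE hu hv]]] := saw_split_half sw.
  have e : size w = (size u + size v)%N by rewrite wE size_cat size_rv.
  exists (u, v); split => //; last by rewrite e exprD.
  by apply: allpairs_f; rewrite mem_words_le ?hu ?hv /= (leq_trans _ wn) // e ?leq_addr ?leq_addl.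
by move=> p _; rewrite mulr_ge0 ?exprn_ge0.
Qed.

Let mu0 : 0 < mu. Proof. exact: mu_gt0. Qed.
Let imu0 : 0 <= mu^-1. Proof. by rewrite invr_ge0 ltW. Qed.

(** At 1 / mu every term of the series of all walks is at least 1, by [mu_le_nsaw], and that series
    is bounded in terms of the bridge series. *)
Lemma gf_bridge_unbounded (K : R) : exists n, K < gf (@bridge d) n mu^-1.
Proof.
apply/not_existsP => h.
have {}h n : gf (@bridge d) n mu^-1 <= K by rewrite leNgt; apply/negP.
have hh n : gf (@half d) n mu^-1 <= mu * expR K.
  rewrite -ler_pdivrMl //; apply: le_trans (gf_half_le n imu0) _.
  by rewrite ler_expR.
have hs n : n%:R <= (mu * expR K) ^+ 2.
  apply: le_trans (_ : gf (@saw d) n mu^-1 <= _).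
    rewrite gfE (@le_trans _ _ (\sum_(l < n.+1) 1)) //.
      by rewrite sumr_const card_ord ler_nat.
    apply: ler_sum => l _; rewrite exprVn -ler_pdivrMr ?invr_gt0 ?exprn_gt0 // invrK mul1r.
    exact: mu_le_nsaw.
  apply: le_trans (gf_saw_le n imu0) _; apply: lerXn2r; rewrite ?nnegrE ?gf_ge0 //.
  by rewrite mulr_ge0 ?expR_ge0 // ltW.
have := hs (Num.bound ((mu * expR K) ^+ 2)).
by apply/negP; rewrite -ltNge archi_boundP // exprn_ge0 // mulr_ge0 ?expR_ge0 // ltW.
Qed.

Lemma gf_bridge_le n z : 0 <= z ->
  gf (@bridge d) n z <= 1 + gf (@irred d) n z * gf (@bridge d) n z.
Proof.
move=> z0; rewrite {1}(gf_split _ (pred1 [::])); apply: lerD.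
  apply: (@le_trans _ _ (\sum_(w <- [:: [::] : word d]) z ^+ size w)); last first.
    by rewrite big_cons big_nil expr0 addr0.
  apply: ler_sum_sub_seq; first exact: uniq_words_le.
    by move=> w; rewrite mem_words_le => /andP[/andP[_ /= h] _]; rewrite inE.
  by move=> w _; rewrite exprn_ge0.
rewrite gf_mulE.
apply: (@ler_sum_cover _ _ _ _ _ (fun p => p.1 ++ p.2)); first exact: uniq_words_le.
  move=> w; rewrite mem_words_le => /andP[/andP[bw /= w0] wn].
  have [u [v [iu bv wE]]] := irred_factor bw w0.
  have e : size w = (size u + size v)%N by rewrite wE size_cat.
  exists (u, v); split => //; last by rewrite e exprD.
  by apply: allpairs_f; rewrite mem_words_le ?iu ?bv /= (leq_trans _ wn) // e ?leq_addr ?leq_addl.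
by move=> p _; rewrite mulr_ge0 ?exprn_ge0.
Qed.

Lemma gf_irred_bridge n m z : 0 <= z ->
  gf (@irred d) n z * gf (@bridge d) m z <= gf (@bridge d) (n + m) z.
Proof.
move=> z0; rewrite gf_mulE.
apply: (@ler_sum_inj _ _ _ _ _ (fun p => p.1 ++ p.2)).
- by apply: allpairs_uniq; rewrite ?uniq_words_le // => -[? ?] [? ?] _ _ [-> ->].
- move=> [u v] [u' v'] /allpairsP[[a b] [/= am bm [-> ->]]] /allpairsP[[a' b'] [/= am' bm' [-> ->]]] e.
  move: am bm am' bm' e; rewrite !mem_words_le => /andP[ia _] /andP[hb _] /andP[ia' _] /andP[hb' _] e.
  have ea := irred_prefix_inj ia ia' (bridge_half hb) (bridge_half hb') e.
  by move: e; rewrite ea => /eqP; rewrite eqseq_cat // eqxx => /eqP->.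
- move=> [u v] /allpairsP[[a b] [/= am bm [-> ->]]].
  move: am bm; rewrite !mem_words_le => /andP[ia sa] /andP[hb sb].
  by rewrite (bridge_cat (irred_bridge ia) hb) size_cat leq_add // exprD.
- by move=> w _; rewrite exprn_ge0.
Qed.

(** Concatenations of irreducible bridges are bridges and factor uniquely, so the powers of the
    irreducible series stay below the bridge series, which is bounded for z < 1 / mu. *)
Lemma gf_irred_le1_lt n z : 0 < z -> z < mu^-1 -> gf (@irred d) n z <= 1.
Proof.
move=> z0 zmu; have zz := ltW z0.
have pw m : gf (@irred d) n z ^+ m <= gf (@bridge d) (n * m) z.
  elim: m => [|m IH].
    rewrite expr0 muln0 gfE big_ord1 expr0 mulr1 -[1]/(1%:R) ler_nat.
    by rewrite -has_count; apply/hasP; exists [::]; rewrite ?inE ?bridge_nil.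
  rewrite exprS mulnS; apply: le_trans (gf_irred_bridge _ _ zz).
  by rewrite ler_wpM2l // gf_ge0.
have zi : mu < z^-1 by rewrite -[mu]invrK ltf_pV2 ?posrE ?invr_gt0.
pose x := (mu + z^-1) / 2.
have mx : mu < x by rewrite ltr_pdivlMr // mulr_natr mulr2n ltrD2l.
have xz : x < z^-1 by rewrite ltr_pdivrMr // mulr_natr mulr2n ltrD2r.
have x0 : 0 < x := lt_trans mu0 mx.
have xz1 : x * z < 1 by rewrite -ltr_pdivlMr // mul1r.
have [C C0 hC] := growth_le_mu mx.
have bd m : gf (@bridge d) m z <= C / (1 - x * z).
  rewrite gfE; apply: (@le_trans _ _ (\sum_(l < m.+1) C * (x * z) ^+ l)).
    apply: ler_sum => l _; rewrite exprMn mulrA ler_pM2r ?exprn_gt0 //.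
    apply: le_trans (hC l); rewrite ler_nat; apply: cnt_sub => w _ /bridge_half.
    exact: half_saw_word.
  by rewrite -mulr_sumr ler_pM2l // geometric_sum_le // mulr_ge0 // ltW.
rewrite leNgt; apply/negP => /(expr_unbounded (C / (1 - x * z)))[m].
by apply/negP; rewrite -leNgt; apply: le_trans (pw m) _.
Qed.

(** The truncation has degree at most n, so dividing 1 / mu by 1 + e costs at most a factor (1 +
    e)^n. *)
Lemma gf_irred_le1 n : gf (@irred d) n mu^-1 <= 1.
Proof.
rewrite -[leRHS]addr0; apply/ler_addgt0Pr => t t0; rewrite addr0.
have [e e0 he] := root_ge1_exists n t0.
have e1 : 0 < 1 + e by rewrite addr_gt0.
pose z := mu^-1 / (1 + e).
have z0 : 0 < z by rewrite divr_gt0 // invr_gt0.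
have zmu : z < mu^-1 by rewrite ltr_pdivrMr // ltr_pMr ?invr_gt0 // ltrDl.
apply: le_trans he; have := gf_irred_le1_lt n z0 zmu.
move=> /(ler_wpM2l (ltW (exprn_gt0 n e1))); rewrite mulr1; apply: le_trans.
rewrite /gf mulr_sumr big_seq [leRHS]big_seq; apply: ler_sum => w.
rewrite mem_words_le => /andP[_ wn]; rewrite /z expr_div_n mulrC -mulrA ler_peMr //.
  by rewrite exprn_ge0.
rewrite mulrC ler_pdivlMr ?exprn_gt0 // mul1r; apply: ler_weXn2l => //.
by rewrite lerDl ltW.
Qed.

(** Otherwise [gf_bridge_le] bounds the bridge series by 1 / (1 - t). With [gf_irred_le1], the
    irreducible bridges have total mass 1. *)
Lemma gf_irred_near1 (t : R) : t < 1 -> exists n, t < gf (@irred d) n mu^-1.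
Proof.
move=> t1; apply/not_existsP => h.
have {}h n : gf (@irred d) n mu^-1 <= t by rewrite leNgt; apply/negP.
have [n] := gf_bridge_unbounded (1 - t)^-1; apply/negP; rewrite -leNgt.
rewrite -[leRHS]mul1r ler_pdivlMr ?subr_gt0 // mulrBr mulr1 lerBlDr.
apply: le_trans (gf_bridge_le n imu0) _; rewrite lerD2l mulrC.
by rewrite ler_wpM2l // gf_ge0.
Qed.

Lemma cnt_bridge_half m n : (cnt (@bridge d) m * cnt (@half d) n <= cnt (@half d) (m + n))%N.
Proof.
rewrite -!size_wf -(size_allpairs pair).
apply: (leq_size_inj (f := fun p => p.1 ++ p.2)).
- by apply: allpairs_uniq; rewrite ?uniq_wf // => -[? ?] [? ?] _ _ [-> ->].
- move=> [u v] [u' v'] /allpairsP[[a b] [/= am bm [-> ->]]] /allpairsP[[a' b'] [/= am' bm' [-> ->]]] /eqP.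
  move: am am'; rewrite !mem_wf => /andP[_ /eqP sa] /andP[_ /eqP sa'].
  by rewrite eqseq_cat ?sa ?sa' // => /andP[/eqP-> /eqP->].
- move=> [u v] /allpairsP[[a b] [/= am bm [-> ->]]].
  move: am bm; rewrite !mem_wf => /andP[ia /eqP sa] /andP[hb /eqP sb].
  by rewrite (bridge_cat_half ia hb) size_cat sa sb eqxx.
Qed.

(** As the bridge series is unbounded at 1 / mu, some m > 0 has at least x^m bridges of length m;
    these can be concatenated freely. *)
Lemma nhalf_lower (x : R) : 0 < x -> x < mu ->
  exists2 c, 0 < c & forall n, c * x ^+ n <= nhalf n.
Proof.
move=> x0 xmu.
have [m m0 hm] : exists2 m, (0 < m)%N & x ^+ m <= (cnt (@bridge d) m)%:R.
  apply: contrapT => h0.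
  have h m : (0 < m)%N -> (cnt (@bridge d) m)%:R <= x ^+ m.
    by move=> m0; rewrite leNgt; apply/negP => /ltW hm; apply: h0; exists m.
  have r1 : x / mu < 1 by rewrite ltr_pdivrMr // mul1r.
  have [n] := gf_bridge_unbounded (1 - x / mu)^-1; apply/negP; rewrite -leNgt.
  rewrite gfE; apply: (@le_trans _ _ (\sum_(l < n.+1) (x / mu) ^+ l)).
    apply: ler_sum => l _; rewrite exprMn ler_pM2r ?exprn_gt0 ?invr_gt0 //.
    case: (nat_of_ord l) => [|k]; last exact: h.
    by rewrite expr0 -[1]/(1%:R) ler_nat (leq_trans (count_size _ _)).
  by rewrite geometric_sum_le // divr_ge0 // ltW.
pose X := Num.max 1 x; have X1 : 1 <= X by rewrite le_max lexx.
have X0 : 0 < X := lt_le_trans ltr01 X1.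
exists (X ^- m); first by rewrite invr_gt0 exprn_gt0.
move=> n.
have hq q r : (x ^+ m) ^+ q <= nhalf (q * m + r).
  elim: q => [|q IH]; first by rewrite expr0 nhalf_ge1.
  rewrite exprS mulSn -addnA.
  apply: (@le_trans _ _ ((cnt (@bridge d) m)%:R * nhalf (q * m + r))).
    by apply: ler_pM; rewrite ?exprn_ge0 // ltW.
  by rewrite -natrM ler_nat cnt_bridge_half.
rewrite {2}(divn_eq n m); apply: le_trans (hq _ _).
rewrite [in leLHS](divn_eq n m) exprD -exprM (mulnC m) mulrCA ger_pMr ?exprn_gt0 //.
rewrite mulrC ler_pdivrMr ?exprn_gt0 // mul1r.
apply: (@le_trans _ _ (X ^+ (n %% m))).
  by apply: lerXn2r; rewrite ?nnegrE ?(ltW x0) ?(ltW X0) // le_max lexx orbT.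
by apply: ler_weXn2l => //; rewrite ltnW // ltn_mod.
Qed.

End Kesten.

(** * The second-order inequality between the counts of half-space walks *)

Section RatioStep.
Context (R : realType) (d : nat) (d0 : (0 < d)%N).
Implicit Types (w : word d).
Local Notation mu := (mu R d).
Local Notation nhalf := (nhalf R d).
Local Notation H n := (wf (@half d) n).

Lemma nhalf_add_le m n : nhalf (m + n) <= nhalf m * ((2 * d.+1) ^ n)%:R.
Proof.
rewrite -natrM ler_nat; apply: leq_trans (cnt_cat (Q := @half d) (S := predT) _) _.
  by move=> u v _ _ /half_catl->.
by rewrite leq_mul // cnt_le_words.
Qed.

(** The exponential bound is weakened to order 1 / n, the size of the other error terms of
    [ratio_step]. *)
Lemma few_bumps_half : exists2 M, (0 < M)%N & exists2 K : R, 0 < K &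
  forall n, (0 < n)%N ->
    (cnt (fun w => half w && (M * nbump w <= n)%N) n)%:R <= K / n%:R * nhalf n.
Proof.
have [y /andP[y0 ymu] [M M0 [C C0 hC]]] := few_bumps R d0.
pose x := (y + mu) / 2.
have x0 : 0 < x by rewrite divr_gt0 // addr_gt0 // mu_gt0.
have yx : y < x by rewrite ltr_pdivlMr // mulr_natr mulr2n ltrD2l.
have xmu : x < mu by rewrite ltr_pdivrMr // mulr_natr mulr2n ltrD2r.
have [c c0 hc] := nhalf_lower x0 xmu.
have r0 : 0 < x / y - 1 by rewrite subr_gt0 ltr_pdivlMr // mul1r.
exists M => //; exists (C / c / (x / y - 1)); first by rewrite !divr_gt0.
move=> n n0; have nR : 0 < n%:R :> R by rewrite ltr0n.
apply: (@le_trans _ _ (C * y ^+ n)).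
  apply: le_trans (hC n); rewrite ler_nat; apply: cnt_sub => w _ /andP[/half_saw_word -> ->] //.
apply: (@le_trans _ _ (C / c / (x / y - 1) / n%:R * (c * x ^+ n))); last first.
  by rewrite ler_pM2l // !divr_gt0.
have b : n%:R * (x / y - 1) <= x ^+ n / y ^+ n.
  rewrite -expr_div_n; have -> : x / y = 1 + (x / y - 1) by rewrite addrC subrK.
  apply: le_trans (bernoulli n _); last by rewrite (le_trans _ (ltW r0)) // oppr_le0.
  by rewrite [1 + _]addrC addrK mulr_natl lerDr.
move: r0 b; set r := x / y - 1 => r0 b.
have -> : C / c / r / n%:R * (c * x ^+ n) = C * (x ^+ n / (n%:R * r)).
  by field; rewrite !gt_eqF.
by rewrite ler_pM2l // ler_pdivlMr ?mulr_gt0 // mulrC -ler_pdivlMr ?exprn_gt0.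
Qed.

Lemma sumr_const_seq (T : Type) (s : seq T) (x : R) : \sum_(i <- s) x = x *+ size s.
Proof. by rewrite big_const_seq count_predT iter_addr_0. Qed.

(** Sum (l - X)^2 >= 0 with l = S1 / h; h only has to bound the number of terms. *)
Lemma Cauchy_Schwarz_count (T : Type) (s : seq T) (P : pred T) (X : T -> R) (h : R) :
  0 < h -> (count P s)%:R <= h ->
  (\sum_(w <- s | P w) X w) ^+ 2 <= h * \sum_(w <- s | P w) X w ^+ 2.
Proof.
move=> h0 hs; set S1 := \sum_(_ <- _ | _) X _; set S2 := \sum_(_ <- _ | _) _ ^+ 2.
pose l := S1 / h.
have key : 2 * l * S1 <= l ^+ 2 * h + S2.
  apply: (@le_trans _ _ (l ^+ 2 * (count P s)%:R + S2)); last first.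
    by rewrite lerD2r ler_wpM2l // sqr_ge0.
  rewrite count_sumr !mulr_sumr -big_split /=; apply: ler_sum => w _.
  by have := sqr_ge0 (l - X w); rewrite sqrrB mulr1; lra.
have lh : l * h = S1 by rewrite divfK // gt_eqF.
by rewrite -lh in key *; have := ler_wpM2l (ltW h0) key; nra.
Qed.

Lemma mem_placesP n w p : w \in H n -> p \in places w ->
  [/\ half w, size w = n, (p.1 < size w)%N & half (ins w p.1 p.2)].
Proof.
by case: p => j s; rewrite mem_wf mem_places => /andP[-> /eqP ->] /andP[-> ->].
Qed.

(** In a walk of n + 2 steps with many bumps, each bump receives weight 1 / nbump. Deleting the
    bumps moves the sum to walks of n steps, where nbump differs by at most 7; the bound on n makes
    the denominators positive. *)
Lemma nhalf_bumps_le M n : (14 * M <= n)%N -> nhalf n.+2 <=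
  (cnt (fun w : word d => half w && (M * nbump w <= n.+2)%N) n.+2)%:R +
  \sum_(w <- H n | (n.+2 < M * (nbump w + 7))%N) (nplace w)%:R / ((nbump w)%:R - 7).
Proof.
move=> Mn; pose F w : R := if (n.+2 < M * nbump w)%N then (nbump w)%:R^-1 else 0.
have F0 w : 0 <= F w by rewrite /F; case: ifP.
apply: (@le_trans _ _ ((cnt (fun w : word d => half w && (M * nbump w <= n.+2)%N) n.+2)%:R +
  \sum_(w <- H n.+2) (nbump w)%:R * F w)).
  rewrite /nhalf /cnt !count_sumr /wf big_filter.
  rewrite (bigID (fun w => (M * nbump w <= n.+2)%N)) /= lerD2l.
  rewrite [leRHS](bigID (fun w => (M * nbump w <= n.+2)%N)) /= ler_wpDl //.
    by apply: sumr_ge0 => w _; rewrite mulr_ge0.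
  apply: ler_sum => w /andP[_]; rewrite -ltnNge => h; rewrite /F h mulfV //.
  by rewrite pnatr_eq0 -lt0n; case: (nbump w) h => //; rewrite muln0.
rewrite lerD2l; apply: le_trans (insertion_ge n F0) _.
rewrite [leRHS]big_mkcond /= big_seq [leRHS]big_seq; apply: ler_sum => w wH.
apply: (@le_trans _ _ (\sum_(p <- places w)
    (if (n.+2 < M * (nbump w + 7))%N then ((nbump w)%:R - 7)^-1 else 0))); last first.
  case: ifP => _; last by rewrite big1.
  by rewrite sumr_const_seq [leRHS]mulr_natl.
rewrite big_seq [leRHS]big_seq; apply: ler_sum => p pw.
have [hw sw pl hp] := mem_placesP wH pw.
have [b1 b2] := nbump_ins p.2 pl.
rewrite /F; case: ifP => [h|_]; last first.
  case: ifP => // h; rewrite invr_ge0 subr_ge0 ler_nat.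
  have : (14 * M < M * (nbump w + 7))%N by apply: leq_trans h; rewrite ltnS leqW // leqW.
  by rewrite mulnC ltn_mul2l => /andP[_]; lia.
have h' : (n.+2 < M * (nbump w + 7))%N by apply: leq_trans h _; rewrite leq_mul2l b2 orbT.
rewrite h'.
have N7 : (7 < nbump w)%N.
  have : (14 * M < M * (nbump w + 7))%N by apply: leq_trans h'; rewrite ltnS leqW // leqW.
  by rewrite mulnC ltn_mul2l => /andP[_]; lia.
have N7' : 0 < (nbump w)%:R - 7 :> R by rewrite subr_gt0 ltr_nat.
rewrite lef_pV2 ?posrE //; first by rewrite lerBlDr -natrD ler_nat.
by rewrite ltr0n; lia.
Qed.

(** Insert two bumps in succession: there are at least nplace * (nplace - 10 (d + 1)) choices, and a
    resulting walk arises at most (nbump + 14) (nbump + 7) times. F2 and F3 distribute this division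
    over the two insertions. *)
Lemma nhalf_places_ge (P : pred (word d)) n :
  \sum_(w <- H n | P w) (nplace w)%:R * ((nplace w)%:R - (10 * d.+1)%:R)
     / (((nbump w)%:R + 14) * ((nbump w)%:R + 7)) <= nhalf n.+4.
Proof.
pose F2 w : R := (nplace w)%:R / ((nbump w)%:R + 7) / (nbump w)%:R.
pose F3 w : R := (nbump w)%:R^-1.
have F20 w : 0 <= F2 w by rewrite /F2 !divr_ge0 // addr_ge0.
have F30 w : 0 <= F3 w by rewrite /F3 invr_ge0.
have bump_pos w p n' : w \in H n' -> p \in places w -> (0 < nbump (ins w p.1 p.2))%N.
  move=> wH pw; have [_ _ pl _] := mem_placesP wH pw.
  rewrite lt0n nbump_eq0; apply/negP => /bumpfreeP/(_ p.1).
  by rewrite bumpat_ins.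
apply: (@le_trans _ _ (\sum_(w <- H n) \sum_(p <- places w) F2 (ins w p.1 p.2))).
  rewrite big_mkcond big_seq [leRHS]big_seq; apply: ler_sum => w wH /=.
  case: ifP => _; last by apply: sumr_ge0 => p _; apply: F20.
  rewrite -mulrA mulr_natl -sumr_const_seq.
  rewrite big_seq [leRHS]big_seq; apply: ler_sum => p pw.
  have [hw sw pl hp] := mem_placesP wH pw.
  have [b1 b2] := nbump_ins p.2 pl.
  have c := nplace_ins hw pl hp.
  have [neg|pos] := lerP ((nplace w)%:R - (10 * d.+1)%:R : R) 0.
    have Dp : 0 < (((nbump w)%:R + 14) * ((nbump w)%:R + 7))^-1 :> R.
      by rewrite invr_gt0 mulr_gt0 // ltr_wpDl.
    by apply: le_trans (F20 _); rewrite pmulr_lle0.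
  have bp := bump_pos _ _ _ wH pw.
  have bp' : 0 < (nbump (ins w p.1 p.2))%:R :> R by rewrite ltr0n.
  have b2' : (nbump (ins w p.1 p.2))%:R <= (nbump w)%:R + 7 :> R by rewrite -natrD ler_nat.
  have W0 : 0 <= (nbump w)%:R :> R by [].
  rewrite /F2 -[leRHS]mulrA -invfM; apply: ler_pM.
  - exact: ltW.
  - by rewrite invr_ge0 mulr_ge0 // addr_ge0.
  - by rewrite lerBlDr -natrD ler_nat.
  rewrite lef_pV2 ?posrE ?mulr_gt0 ?ltr_wpDl //.
  apply: ler_pM; rewrite ?addr_ge0 //.
  by apply: le_trans (lerD b2' (lexx 7)) _; rewrite -addrA lerD2l -natrD.
apply: le_trans (insertion_le n F20) _.
apply: (@le_trans _ _ (\sum_(w <- H n.+2) \sum_(p <- places w) F3 (ins w p.1 p.2))).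
  rewrite big_seq [leRHS]big_seq; apply: ler_sum => w wH.
  apply: (@le_trans _ _ ((nplace w)%:R / ((nbump w)%:R + 7))).
    rewrite /F2 mulrC; have [->|nz] := eqVneq ((nbump w)%:R : R) 0.
      by rewrite mulr0 divr_ge0 // addr_ge0.
    by rewrite divfK.
  rewrite mulr_natl -sumr_const_seq.
  rewrite big_seq [leRHS]big_seq; apply: ler_sum => p pw.
  have [hw sw pl hp] := mem_placesP wH pw.
  have [b1 b2] := nbump_ins p.2 pl.
  have bp' : 0 < (nbump (ins w p.1 p.2))%:R :> R by rewrite ltr0n (bump_pos _ _ _ wH pw).
  by rewrite /F3 lef_pV2 ?posrE ?ltr_wpDl // -natrD ler_nat.
apply: le_trans (insertion_le n.+2 F30) _.
rewrite /nhalf -size_wf -sum1_size natr_sum; apply: ler_sum => w _.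
have [->|nz] := eqVneq ((nbump w)%:R : R) 0; first by rewrite mul0r.
by rewrite /F3 mulfV.
Qed.

(** N and u stand for the numbers of bumps and places. N is at least of order n and u at most D n,
    so u / N is bounded and the shifts by 7, 14 and c cost O(1 / n). *)
Lemma bump_ratio_bounds (n N u m D c : R) : 0 < n -> 0 <= u -> 0 < m -> 0 < D -> 0 <= c ->
  25 < N -> n <= 2 * m * N -> u <= D * n ->
  u / (N - 7) <= u / N + 28 * (2 * m * D) * m / n /\
  (u / N) ^+ 2 - (28 * (2 * m * D) ^+ 2 + 2 * m * D * c) * (2 * m) / n
    <= u * (u - c) / ((N + 14) * (N + 7)).
Proof.
move=> n0 u0 m0 D0 c0 N25 nN un.
have N0 : 0 < N by lra.
have Nn : N != 0 by rewrite gt_eqF.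
have uX : u = u / N * N by rewrite divfK.
have X0 : 0 <= u / N by rewrite divr_ge0 // ltW.
move: (u / N) X0 uX => X X0 uX; rewrite {u}uX in u0 un *.
pose K3 := 2 * m * D.
have K30 : 0 < K3 by rewrite !mulr_gt0.
have XK : X <= K3.
  rewrite -(ler_pM2r N0) (le_trans un) // /K3 mulrC -[2 * m * D * N]mulrA (mulrC D) mulrA.
  by rewrite ler_pM2r.
have iN : N^-1 <= 2 * m / n by rewrite ler_pdivlMr // ler_pdivrMl // mulrC.
split.
  have -> : X * N / (N - 7) = X + X * (7 / (N - 7)).
    by field; apply/eqP; lra.
  rewrite lerD2l.
  have h : 7 / (N - 7) <= 14 * N^-1.
    by rewrite ler_pdivrMr ?subr_gt0 ?(lt_trans _ N25) ?ltr_nat // mulrAC ler_pdivlMr //; lra.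
  apply: (@le_trans _ _ (K3 * (14 * (2 * m / n)))); last first.
    by rewrite le_eqVlt; apply/orP; left; apply/eqP; rewrite /K3; field; rewrite gt_eqF.
  apply: ler_pM => //; first by rewrite divr_ge0 //; lra.
  by apply: le_trans h _; rewrite ler_pM2l.
have D1 : 0 < (N + 14) * (N + 7) by rewrite mulr_gt0 // addr_gt0.
have t1 : X ^+ 2 * (1 - 28 / N) <= (X * N) ^+ 2 / ((N + 14) * (N + 7)).
  rewrite exprMn -[leRHS]mulrA; apply: ler_wpM2l; first exact: sqr_ge0.
  rewrite ler_pdivlMr //.
  have -> : (1 - 28 / N) * ((N + 14) * (N + 7)) = N ^+ 2 - 7 * N - 490 - 28 * 98 / N.
    by field; rewrite gt_eqF.
  have : 0 <= 28 * 98 / N by rewrite divr_ge0 // ltW.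
  lra.
have t2 : X * N * c / ((N + 14) * (N + 7)) <= X * c / N.
  rewrite -!mulrA ler_wpM2l // mulrCA [leRHS]mulrC [leRHS]mulrC ler_wpM2l //.
  rewrite ler_pdivrMr // mulrC -ler_pdivrMr ?invr_gt0 // invrK.
  have := sqr_ge0 N; nra.
have -> : X * N * (X * N - c) / ((N + 14) * (N + 7)) =
    (X * N) ^+ 2 / ((N + 14) * (N + 7)) - X * N * c / ((N + 14) * (N + 7)).
  by rewrite mulrBr mulrBl expr2.
apply: le_trans (lerB t1 t2); rewrite mulrBr mulr1 -addrA lerD2l -opprD lerN2.
have -> : X ^+ 2 * (28 / N) + X * c / N = (28 * X ^+ 2 + X * c) * N^-1.
  by field.
rewrite -[leRHS]mulrA; apply: ler_pM => //.
- by rewrite addr_ge0 // mulr_ge0 // sqr_ge0.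
- by rewrite invr_ge0 ltW.
rewrite lerD ?ler_wpM2r // ler_pM2l //.
by apply: lerXn2r; rewrite ?nnegrE // ltW.
Qed.

Lemma ratio_arith (h h4 A B S1 S2 K b e n : R) : 0 < h -> 0 <= A -> 0 < n -> 0 <= K -> 0 <= b ->
  A <= K * h -> A <= b / n * h + S1 -> 0 <= S1 -> S1 ^+ 2 <= h * S2 -> S2 <= h4 + e / n * h ->
  A ^+ 2 <= h * h4 + (e + 2 * K * b) / n * h ^+ 2.
Proof.
move=> h0 A0 n0 K0 b0 AK AB S10 S12 S24; set B' := b / n * h in AB.
have B0 : 0 <= B' by rewrite mulr_ge0 ?divr_ge0 // ltW.
have h1 : A ^+ 2 <= S1 ^+ 2 + 2 * (A * B').
  have [le|lt] := lerP A B'.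
    have : A * A <= A * B' by rewrite ler_wpM2l.
    by have := sqr_ge0 S1; have := mulr_ge0 A0 B0; rewrite expr2 [A ^+ 2]expr2; lra.
  have : (A - B') ^+ 2 <= S1 ^+ 2 by apply: lerXn2r; rewrite ?nnegrE ?subr_ge0 ?(ltW lt) // lerBlDl.
  by rewrite sqrrB mulr2n; have := sqr_ge0 B'; lra.
have h2 : A * B' <= K * h * B' by rewrite ler_wpM2r.
have h3 : h * S2 <= h * (h4 + e / n * h) by rewrite ler_pM2l.
apply: (le_trans h1); apply: le_trans (lerD (le_trans S12 h3) (_ : _ <= 2 * (K * h * B'))) _.
  by rewrite ler_pM2l.
by rewrite le_eqVlt; apply/orP; left; apply/eqP; rewrite /B'; field; rewrite gt_eqF.
Qed.

Lemma ltn_mul_add7 M N : (32 * M < M * (N + 7))%N -> (25 < N)%N.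
Proof. by rewrite mulnC ltn_mul2l => /andP[_]; clear; lia. Qed.

(** With X = nplace / nbump, $h_{n+2}$ is at most the sum of X and $h_{n+4}$ at least the sum of X^2
    over the good walks of n steps, up to O(1 / n) $h_n$. Cauchy-Schwarz links the two sums. *)
Lemma ratio_step : exists2 D : R, 0 < D & exists n0, forall n, (n0 <= n)%N ->
  nhalf n.+2 ^+ 2 <= nhalf n * nhalf n.+4 + D / n%:R * nhalf n ^+ 2.
Proof.
have [M M0 [K K0 hK]] := few_bumps_half.
pose m : R := M%:R; pose D : R := (2 * d.+1)%:R; pose c : R := (10 * d.+1)%:R.
pose K2 : R := ((2 * d.+1) ^ 2)%:R.
have m0 : 0 < m by rewrite ltr0n.
have D0 : 0 < D by rewrite ltr0n.
have c0 : 0 <= c by [].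
have K20 : 0 < K2 by rewrite ltr0n expn_gt0.
pose E1 := 28 * (2 * m * D) * m.
pose E2 := (28 * (2 * m * D) ^+ 2 + 2 * m * D * c) * (2 * m).
have E10 : 0 < E1 by rewrite !mulr_gt0.
have E20 : 0 < E2.
  by rewrite mulr_gt0 ?mulr_gt0 // ltr_pwDl ?mulr_ge0 ?(ltW m0) ?(ltW D0) // mulr_gt0 // exprn_gt0 // !mulr_gt0.
exists (E2 + 2 * K2 * (K * K2 + E1)).
  by rewrite addr_gt0 // !mulr_gt0 // addr_gt0 // mulr_gt0.
(* From 32 M on, a good walk has more than 25 bumps, as [bump_ratio_bounds] asks. *)
exists (32 * M)%N => n nM.
have n0 : (0 < n)%N by apply: leq_trans nM; rewrite muln_gt0.
have nR : 0 < n%:R :> R by rewrite ltr0n.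
have h0 := nhalf_gt0 R d n.
pose good (w : word d) := (n.+2 < M * (nbump w + 7))%N.
have goodP w : w \in H n -> good w ->
    (nplace w)%:R / ((nbump w)%:R - 7) <= (nplace w)%:R / (nbump w)%:R + E1 / n%:R /\
    ((nplace w)%:R / (nbump w)%:R) ^+ 2 - E2 / n%:R <=
     (nplace w)%:R * ((nplace w)%:R - c) / (((nbump w)%:R + 14) * ((nbump w)%:R + 7)).
  rewrite mem_wf => /andP[_ /eqP sw] gw; apply: bump_ratio_bounds => //.
  - have : (32 * M < M * (nbump w + 7))%N.
      by apply: leq_ltn_trans nM _; apply: leq_trans gw; rewrite ltnS leqW.
    by move/ltn_mul_add7; rewrite ltr_nat.
  - have h : (32 * M < M * (nbump w + 7))%N.
      by apply: leq_ltn_trans nM _; apply: leq_trans gw; rewrite ltnS leqW.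
    rewrite /m -!natrM ler_nat; apply: (@leq_trans (M * (nbump w + 7))).
      by apply: leq_trans (ltnW gw); rewrite leqW.
    rewrite mulnAC mulnC leq_mul2r; apply/orP; right.
    have {}h := ltn_mul_add7 h.
    by rewrite mul2n -addnn leq_add2l (leq_trans _ h).
  - by rewrite -natrM ler_nat -sw nplace_le.
pose X w : R := (nplace w)%:R / (nbump w)%:R.
have cg : (count good (H n))%:R <= nhalf n by rewrite /nhalf -size_wf ler_nat count_size.
have sum_const (x : R) : 0 <= x -> \sum_(w <- H n | good w) x <= x * nhalf n.
  move=> x0; rewrite -[X in X <= _]mulr1 -[x in \sum_(_ <- _ | _) x]mulr1.
  by rewrite mulr1 -mulr_sumr -count_sumr ler_wpM2l.
apply: (@ratio_arith _ _ _ 0 (\sum_(w <- H n | good w) X w) (\sum_(w <- H n | good w) X w ^+ 2)) => //.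
- by rewrite addr_ge0 ?mulr_ge0 // ltW.
- by rewrite mulrC -addn2; apply: nhalf_add_le.
- apply: le_trans (nhalf_bumps_le (M := M) _) _.
    by apply: leq_trans nM; rewrite leq_mul2r orbT.
  rewrite (mulrDl (K * K2)) mulrDl -addrA; apply: lerD.
    apply: le_trans (hK n.+2 isT) _.
    apply: (@le_trans _ _ (K / n%:R * (K2 * nhalf n))); last by rewrite mulrA (mulrAC K).
    apply: ler_pM; rewrite ?divr_ge0 ?(ltW K0) ?(ltW (nhalf_gt0 _ _ _)) //.
      by rewrite ler_pM2l // lef_pV2 ?posrE ?ltr0n // ler_nat leqW.
    by rewrite mulrC -addn2; apply: nhalf_add_le.
  apply: (@le_trans _ _ (\sum_(w <- H n | good w) (X w + E1 / n%:R))).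
    rewrite big_seq_cond [leRHS]big_seq_cond; apply: ler_sum => w /andP[wH gw].
    by have [] := goodP w wH gw.
  rewrite big_split /= addrC lerD2r; apply: sum_const.
  by rewrite divr_ge0 // ltW.
- by apply: sumr_ge0 => w _; rewrite divr_ge0.
- exact: Cauchy_Schwarz_count.
rewrite -lerBlDr; apply: le_trans (nhalf_places_ge good n).
apply: (@le_trans _ _ (\sum_(w <- H n | good w) (X w ^+ 2 - E2 / n%:R))).
  rewrite sumrB lerD2l lerN2; apply: sum_const.
  by rewrite divr_ge0 // ltW.
rewrite big_seq_cond [leRHS]big_seq_cond; apply: ler_sum => w /andP[wH gw].
by have [] := goodP w wH gw.
Qed.

End RatioStep.

(** * Limits of ratios and of prefix probabilities *)

Section RatioLimit.
Context (R : realType) (d : nat).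
Implicit Types (w : word d).
Local Notation mu := (mu R d).
Local Notation nhalf := (nhalf R d).

Lemma nhalf_le_succ n : nhalf n <= nhalf n.+1.
Proof.
rewrite ler_nat -!size_wf; apply: (leq_size_inj (f := cons (e1 d))); first exact: uniq_wf.
  by move=> w w' _ _ [].
by move=> w; rewrite !mem_wf /= eqSS => /andP[/half_e1-> ->].
Qed.

Lemma ratio_iterate (r : nat -> R) (D : R) n0 n i : 0 <= D -> (0 < n)%N -> (n0 <= n)%N ->
  (forall m, (n0 <= m)%N -> r m <= r m.+2 + D / m%:R) -> r n - D / n%:R *+ i <= r (n + i.*2)%N.
Proof.
move=> D0 n1 nn h; elim: i => [|i IH]; first by rewrite mulr0n subr0 addn0.
rewrite doubleS !addnS mulrS opprD addrCA -lerBrDl opprK.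
apply: (le_trans IH); apply: le_trans (h _ _) _; first by rewrite (leq_trans nn) // leq_addr.
rewrite lerD2l ler_wpM2l // lef_pV2 ?posrE ?ltr0n ?addn_gt0 ?n1 //.
by rewrite ler_nat leq_addr.
Qed.

(** If the ratio exceeded (1 + e) mu^2 at a large n, it would stay above (1 + e / 2) mu^2 for n / M
    further double steps, and h would grow faster than mu allows. *)
Lemma nhalf_add2_le_pos : (0 < d)%N -> forall e : R, 0 < e ->
  exists n0, forall n, (n0 <= n)%N -> nhalf n.+2 <= (1 + e) * mu ^+ 2 * nhalf n.
Proof.
move=> d0 e e0; have mu0 := mu_gt0 R d.
have mu20 : 0 < mu ^+ 2 by rewrite exprn_gt0.
have [D D0 [n1 hD]] := ratio_step R d0.
pose r n := nhalf n.+2 / nhalf n.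
have rP n : (n1 <= n)%N -> r n <= r n.+2 + D / n%:R.
  move=> /hD h; have h0 := nhalf_gt0 R d n; have h2 := nhalf_gt0 R d n.+2.
  rewrite /r ler_pdivrMr // mulrDl.
  have := ler_wpM2r (_ : 0 <= (nhalf n.+2)^-1) h; rewrite invr_ge0 => /(_ (ltW h2)).
  rewrite expr2 mulfK ?gt_eqF // => {}h; apply: (le_trans h).
  rewrite mulrDl [nhalf n.+4 / _ * _]mulrAC (mulrC (nhalf n.+4)) lerD2l.
  rewrite expr2 mulrA -(mulrA (D / n%:R * nhalf n)) ler_piMr //.
    by rewrite mulr_ge0 ?divr_ge0 // ltW.
  rewrite ler_pdivrMr // mul1r.
  exact: le_trans (nhalf_le_succ _) (nhalf_le_succ _).
(* Over I = n / M double steps the ratio loses at most D / M < mu^2 e / 2. *)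
have [M hM] : exists M, D / (mu ^+ 2 * (e / 2)) < M%:R.
  exists (Num.bound (D / (mu ^+ 2 * (e / 2)))); apply: archi_boundP.
  by rewrite divr_ge0 ?ltW // mulr_gt0 // divr_gt0.
have M0 : (0 < M)%N.
  rewrite lt0n; apply/negP => /eqP M0; move: hM; rewrite M0 ltNge divr_ge0 // ltW //.
  by rewrite mulr_gt0 // divr_gt0.
have e40 : 0 < e / 4 by rewrite divr_gt0.
(* The bounds on h have bases off from mu by a factor 1 + t; over the window this costs at most (1 +
   e / 4)^I up to a constant, less than the gain (1 + e / 2)^I. *)
have [t t0 ht] := root_ge1_exists (2 * M + 2) e40.
have t1 : 0 < 1 + t by rewrite addr_gt0.
pose x := mu * (1 + t); pose y := mu / (1 + t).
have mx : mu < x by rewrite ltr_pMr // ltrDl.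
have ym : y < mu by rewrite ltr_pdivrMr // ltr_pMr // ltrDl.
have y0 : 0 < y by rewrite divr_gt0.
have [C C0 hC] := growth_le_mu mx.
have [c c0 hc] := nhalf_lower y0 ym.
pose b := (1 + e / 2) / (1 + e / 4).
have b1 : 1 < b by rewrite ltr_pdivlMr ?addr_gt0 // mul1r ltrD2l ltr_pM2l // ltf_pV2 ?posrE // ltr_nat.
have [I0 hI0] := expr_unbounded (C / c * (1 + t) ^+ (2 * M)) b1.
exists (maxn (maxn n1 1) (M * I0)) => n; rewrite !geq_max => /andP[/andP[n1n n0] nI].
rewrite leNgt; apply/negP => big.
pose I := (n %/ M)%N.
have I0I : (I0 <= I)%N by rewrite leq_divRL // mulnC.
have nR : 0 < n%:R :> R by rewrite ltr0n.
have step i : (i <= I)%N -> mu ^+ 2 * (1 + e / 2) <= r (n + i.*2)%N.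
  move=> iI; apply: le_trans (ratio_iterate i (ltW D0) n0 n1n rP).
  rewrite lerBrDr; apply: (@le_trans _ _ ((1 + e) * mu ^+ 2)); last first.
    by rewrite /r ler_pdivlMr ?nhalf_gt0 // ltW.
  have -> : (1 + e) * mu ^+ 2 = mu ^+ 2 * (1 + e / 2) + mu ^+ 2 * (e / 2) by field.
  rewrite lerD2l -mulr_natr.
  apply: (@le_trans _ _ (D / n%:R * (n%:R / M%:R))).
    rewrite ler_pM2l ?divr_gt0 // ler_pdivlMr ?ltr0n // -natrM ler_nat.
    by rewrite -leq_divRL.
  rewrite [leLHS]mulrA divfK ?gt_eqF // ler_pdivrMr ?ltr0n // [leRHS]mulrC -ler_pdivrMr.
    exact: ltW.
  by rewrite mulr_gt0 // divr_gt0.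
have grow i : (i <= I)%N -> nhalf n * (mu ^+ 2 * (1 + e / 2)) ^+ i <= nhalf (n + i.*2).
  elim: i => [|i IH] iI; first by rewrite expr0 mulr1 addn0.
  rewrite doubleS !addnS exprSr mulrA.
  have := step i (ltnW iI); rewrite /r ler_pdivlMr ?nhalf_gt0 // mulrC; apply: le_trans.
  rewrite ler_wpM2r ?IH ?(ltnW iI) // mulr_ge0 ?(ltW mu20) // addr_ge0 //.
  by rewrite divr_ge0 // ltW.
have e20 : 0 < 1 + e / 2 by rewrite addr_gt0 // divr_gt0.
have key : c * (1 + e / 2) ^+ I <= C * (1 + t) ^+ (n + (n + I.*2)).
  have g := grow I (leqnn _).
  have u : nhalf (n + I.*2) <= C * x ^+ (n + I.*2) := le_trans (nhalf_le R d _) (hC _).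
  have l := hc n.
  have mm : 0 < mu ^+ (n + I.*2) by rewrite exprn_gt0.
  rewrite -(ler_pM2l mm).
  have -> : mu ^+ (n + I.*2) * (C * (1 + t) ^+ (n + (n + I.*2))) =
     (1 + t) ^+ n * (C * x ^+ (n + I.*2)).
    by rewrite /x exprMn (exprD (1 + t) n); move: (mu ^+ _) ((1 + t) ^+ n) ((1 + t) ^+ _) => A B E; ring.
  apply: (@le_trans _ _ ((1 + t) ^+ n * (nhalf n * (mu ^+ 2 * (1 + e / 2)) ^+ I))); last first.
    by rewrite ler_pM2l ?exprn_gt0 //; apply: le_trans u.
  have -> : mu ^+ (n + I.*2) * (c * (1 + e / 2) ^+ I) =
     (1 + t) ^+ n * ((c * y ^+ n) * (mu ^+ 2 * (1 + e / 2)) ^+ I).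
    rewrite /y expr_div_n exprMn -exprM -mul2n exprD; field.
    by rewrite gt_eqF // exprn_gt0.
  rewrite ler_pM2l ?exprn_gt0 // ler_wpM2r // exprn_ge0 // mulr_ge0 // ltW //.
have up : (1 + t) ^+ (n + (n + I.*2)) <= (1 + t) ^+ (2 * M) * (1 + e / 4) ^+ I.
  apply: (@le_trans _ _ ((1 + t) ^+ (2 * M + (2 * M + 2) * I))).
    apply: ler_weXn2l; first by rewrite lerDl ltW.
    have := divn_eq n M; have := ltn_pmod n M0; rewrite -/I -!mul2n; clear; nia.
  rewrite exprD ler_pM2l ?exprn_gt0 // exprM.
  by apply: lerXn2r; rewrite ?nnegrE ?exprn_ge0 ?addr_ge0 ?(ltW t0) ?(ltW e40).
have : b ^+ I <= C / c * (1 + t) ^+ (2 * M).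
  rewrite expr_div_n ler_pdivrMr ?exprn_gt0 ?addr_gt0 // mulrAC -mulrA mulrAC ler_pdivlMr //.
  rewrite mulrC; apply: (le_trans key); rewrite ler_pM2l //.
  by rewrite mulrC.
apply/negP; rewrite -ltNge; apply: (lt_le_trans hI0); apply: ler_weXn2l => //.
exact: ltW.
Qed.

(** On a line, self-avoidance forbids turning back and the half-space fixes the direction. *)
Lemma nhalf_le1 n : d = 0%N -> (cnt (@half d) n <= 1)%N.
Proof.
move=> dz.
have stepP (s t : step d) : s != ops t -> s = t.
  case: s t => [i b] [j c]; rewrite /ops /= => h.
  have ij : i = j by apply: val_inj; case: i j {h} => [i hi] [j hj] /=; lia.
  by move: h; rewrite ij xpair_eqE eqxx /=; case: b c => [] [].
have cst (s t : step d) (w : word d) : saw (s :: t :: w) -> t = s.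
  move=> h; apply: stepP; apply/eqP => e; move: h; rewrite e /saw !traj_cons /= sv_ops.
  by rewrite add0r subrr inE mem_traj_head orbT.
have nseqE w : half w -> w = nseq (size w) (e1 d).
  case: w => // s w /andP[sw nw].
  have sE : s = e1 d.
    apply: stepP; apply/eqP => e; move/allP: nw => /(_ (0 + sv s)).
    rewrite traj_cons inE mem_traj_head orbT => /(_ isT).
    by rewrite e sv_ops add0r mxE sv_e1.
  have wE : w = nseq (size w) s; last by rewrite /= -sE; congr (_ :: _).
  elim: w s sw {nw sE} => // t w IH s sw.
  have ts := cst _ _ _ sw; rewrite {1}ts /=; congr (_ :: _).
  by rewrite -ts; apply: IH; case/(@saw_cat _ [:: s]): sw.
rewrite -size_wf -[1%N]/(size [:: tt]); apply: (leq_size_inj (f := fun=> tt)).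
- exact: uniq_wf.
- move=> w w'; rewrite !mem_wf => /andP[/nseqE wE /eqP sw] /andP[/nseqE wE' /eqP sw'] _.
  by rewrite wE wE' sw sw'.
- by move=> w _; rewrite mem_head.
Qed.

Lemma nhalf_add2_le (e : R) : 0 < e ->
  exists n0, forall n, (n0 <= n)%N -> nhalf n.+2 <= (1 + e) * mu ^+ 2 * nhalf n.
Proof.
move=> e0; have [dz|d0] := posnP d; last exact: nhalf_add2_le_pos.
exists 0%N => n _; apply: (@le_trans _ _ (1 * nhalf n)).
  rewrite mul1r; apply: le_trans (nhalf_ge1 R d n).
  by rewrite -[1]/(1%:R) ler_nat nhalf_le1.
by rewrite ler_wpM2r // mulr_ege1 ?exprn_ege1 ?mu_ge1 // lerDl ltW.
Qed.

(** Removing a bridge of odd length k from n + 1 steps leaves the parity of n, so n is reached again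
    by double steps. *)
Lemma odd_shift n n1 J k : (n1 + J + 1 <= n)%N -> (k <= J)%N -> odd k ->
  [/\ n = (n.+1 - k + k./2.*2)%N, (n1 <= n.+1 - k)%N & (k./2 <= J)%N].
Proof.
move=> nn kJ ok; have := odd_double_half k; rewrite ok add1n -mul2n.
by move: (k./2) => h hk; split; lia.
Qed.

Lemma even_shift n n1 J k : (n1 + J + 1 <= n)%N -> (k <= J)%N -> ~~ odd k ->
  [/\ n.+1 = (n.+1 - k + k./2.*2)%N, (n1 <= n.+1 - k)%N & (k./2 <= J)%N].
Proof.
move=> nn kJ /negbTE ok; have := odd_double_half k; rewrite ok add0n -mul2n.
by move: (k./2) => h hk; split; lia.
Qed.

Lemma inv1D_ge (t : R) : 0 < t -> 1 - t <= (1 + t)^-1.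
Proof.
move=> t0; rewrite -[leRHS]mul1r ler_pdivlMr ?addr_gt0 //.
by have := sqr_ge0 t; rewrite expr2; lra.
Qed.

(* In the renewal inequality, Po and Pe are the masses at mu^-1 of the irreducible
   bridges of odd and even length, up to length J. *)
Lemma renewal_arith (e i Po Pe th : R) : 0 < e -> 0 < i -> i <= 1 -> 0 < th ->
  1 - e * i / 8 <= th -> i <= Po -> 0 <= Pe -> 1 - e * i / 8 < Po + Pe ->
  1 - th * Pe <= Po + 2 * (e * i / 8) /\ (1 - e) * (Po + 2 * (e * i / 8)) <= th * Po.
Proof.
move=> e0 i0 i1 th0; set t := e * i / 8 => th1 Po1 Pe0 PP.
have t0 : 0 < t by rewrite divr_gt0 // mulr_gt0.
have te : t <= e / 8 by rewrite ler_pM2r // ler_piMr // ltW.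
have Po0 : 0 < Po := lt_le_trans i0 Po1.
have h4 : 2 * t <= Po * (e / 4).
  by rewrite /t; have := ler_wpM2r (ltW e0) Po1; lra.
have h5 : (1 - t) * Po <= th * Po by rewrite ler_pM2r.
have h6 : t * Po <= e / 8 * Po by rewrite ler_pM2r.
have h7 := mulr_ge0 (ltW e0) (ltW t0).
have h8 := mulr_gt0 e0 Po0.
split; last by clear -h4 h5 h6 h7 h8; lra.
have [neg|pos] := lerP (1 - t - Po) 0.
  have := mulr_ge0 (ltW th0) Pe0; clear -neg t0; lra.
have h1 : (1 - t) * (1 - t - Po) <= th * Pe.
  apply: (@le_trans _ _ (th * (1 - t - Po))); first by rewrite ler_pM2r.
  by rewrite ler_pM2l // lerBlDl ltW.
have := mulr_ge0 (ltW t0) (ltW Po0); have := sqr_ge0 t; rewrite expr2.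
by clear -h1 t0; lra.
Qed.

(* Splitting off the first irreducible bridge. *)
Lemma sum_irred_le (Q : pred (word d)) n J : (J <= n)%N ->
  (\sum_(b <- words_le (@irred d) J) cnt (fun v => half v && Q (b ++ v)) (n - size b)
   <= cnt (fun w => half w && Q w) n)%N.
Proof.
move=> Jn.
pose s := [seq (b, v) | b <- words_le (@irred d) J,
                        v <- wf (fun v => half v && Q (b ++ v)) (n - size b)].
have -> : (\sum_(b <- words_le (@irred d) J)
    cnt (fun v => half v && Q (b ++ v)) (n - size b) = size s)%N.
  by rewrite size_allpairs_dep sumnE big_map; apply: eq_bigr => b _; rewrite size_wf.
rewrite -size_wf; apply: (leq_size_inj (f := fun p => p.1 ++ p.2)).
- apply: allpairs_uniq_dep; [exact: uniq_words_le|by move=> b _; apply: uniq_wf|].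
  by move=> [? ?] [? ?] _ _ [-> ->].
- move=> [u v] [u' v'] /allpairsPdep[a [b [am bm [-> ->]]]].
  move=> /allpairsPdep[a' [b' [am' bm' [-> ->]]]] /= e.
  move: am am' bm bm' e; rewrite !mem_words_le !mem_wf.
  move=> /andP[ia _] /andP[ia' _] /andP[/andP[hb _] _] /andP[/andP[hb' _] _] e.
  have ea := irred_prefix_inj ia ia' hb hb' e.
  by move: e; rewrite ea => /eqP; rewrite eqseq_cat // eqxx => /eqP->.
- move=> [u v] /allpairsPdep[a [b [am bm [-> ->]]]].
  move: am bm; rewrite mem_words_le !mem_wf => /andP[ia sa] /andP[/andP[hb qb] /eqP sb].
  rewrite /= (bridge_cat_half (irred_bridge ia) hb) qb size_cat sb subnKC ?eqxx //.
  exact: leq_trans Jn.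
Qed.

Definition ahalf n : R := nhalf n / mu ^+ n.

Lemma ahalf_gt0 n : 0 < ahalf n.
Proof. by rewrite divr_gt0 ?nhalf_gt0 // exprn_gt0 // mu_gt0. Qed.

Lemma sum_ahalf_le n J : (J <= n)%N ->
  \sum_(b <- words_le (@irred d) J) mu^-1 ^+ size b * ahalf (n - size b) <= ahalf n.
Proof.
move=> Jn; have mu0 := mu_gt0 R d.
rewrite /ahalf ler_pdivlMr ?exprn_gt0 // mulr_suml.
apply: (@le_trans _ _ (\sum_(b <- words_le (@irred d) J) nhalf (n - size b))).
  rewrite big_seq [leRHS]big_seq; apply: ler_sum => b.
  rewrite mem_words_le => /andP[_ /leq_trans/(_ Jn) bn].
  rewrite -{3}(subnK bn) exprD exprVn le_eqVlt; apply/orP; left; apply/eqP.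
  by field; rewrite !expf_neq0 // gt_eqF.
have := sum_irred_le predT Jn; rewrite -(ler_nat R) natr_sum.
set X := (cnt _ n)%:R; have -> : X = nhalf n.
  by congr (_%:R); apply: eq_count => w /=; rewrite andbT.
apply: le_trans; apply: ler_sum => b _; rewrite ler_nat; apply: eq_leq.
by apply: eq_count => w /=; rewrite andbT.
Qed.

Lemma ahalf_add2_le (e : R) : 0 < e ->
  exists n0, forall n, (n0 <= n)%N -> ahalf n.+2 <= (1 + e) * ahalf n.
Proof.
move=> /nhalf_add2_le[n0 h]; exists n0 => n /h {}h; have mu0 := mu_gt0 R d.
rewrite /ahalf ler_pdivrMr ?exprn_gt0 //; apply: (le_trans h).
rewrite -(addn2 n) (exprD _ n) le_eqVlt; apply/orP; left; apply/eqP.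
by field; rewrite expf_neq0 // gt_eqF.
Qed.

Lemma ahalf_add_even_le (e : R) n0 n i : 0 < e ->
  (forall n, (n0 <= n)%N -> ahalf n.+2 <= (1 + e) * ahalf n) -> (n0 <= n)%N ->
  ahalf (n + i.*2) <= (1 + e) ^+ i * ahalf n.
Proof.
move=> e0 h nn; elim: i => [|i IH]; first by rewrite addn0 expr0 mul1r.
rewrite doubleS !addnS exprS -mulrA; apply: le_trans (h _ _) _.
  by rewrite (leq_trans nn) // leq_addr.
by rewrite ler_pM2l // addr_gt0.
Qed.

(** By the two-step bound, [ahalf] at n + 1 - |b| is at least th times its value at n or n + 1,
    according to the parity of |b|. The renewal inequality becomes a_(n+1) >= th (Po a_n + Pe
    a_(n+1)), where Po + Pe is close to 1 and Po is bounded away from 0. *)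
Lemma ahalf_ratio_lower (e : R) : 0 < e ->
  exists n0, forall n, (n0 <= n)%N -> (1 - e) * ahalf n <= ahalf n.+1.
Proof.
move=> e0; have mu0 := mu_gt0 R d; have imu0 : 0 < mu^-1 by rewrite invr_gt0.
have [ge1|lt1] := lerP 1 e.
  exists 0%N => n _; apply: le_trans (ltW (ahalf_gt0 _)).
  by rewrite pmulr_lle0 ?ahalf_gt0 // subr_le0.
(* Scaled by 1 / mu, the lower bound for Po, because the final step divides by a quantity close to
   Po. *)
pose t := e * mu^-1 / 8.
have t0 : 0 < t by rewrite !divr_gt0 // mulr_gt0.
have im1 : mu^-1 <= 1 by rewrite invf_le1 // mu_ge1.
have te : t <= e / 8 by rewrite ler_pM2r // ler_piMr // ltW.
have [J hJ] : exists n, 1 - t < gf (@irred d) n mu^-1 by apply: gf_irred_near1; rewrite gtrBl.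
have [s s0 hs] := root_ge1_exists J t0.
have [n1 h1] := ahalf_add2_le s0.
exists (n1 + J + 1)%N => n nn.
have Jn : (J <= n.+1)%N by rewrite leqW // (leq_trans _ nn) // addnAC leq_addl.
have a0 := ahalf_gt0 n; have a1 := ahalf_gt0 n.+1.
pose th := (1 + t)^-1.
have th0 : 0 < th by rewrite invr_gt0 addr_gt0.
have th1 : 1 - t <= th.
  exact: inv1D_ge.
have thle1 : th <= 1 by rewrite invf_le1 ?addr_gt0 // lerDl ltW.
have low m i : (n1 <= m)%N -> (i <= J)%N -> th * ahalf (m + i.*2) <= ahalf m.
  move=> mm iJ; rewrite /th mulrC ler_pdivrMr ?addr_gt0 // mulrC.
  apply: le_trans (ahalf_add_even_le i s0 h1 mm) _; rewrite ler_pM2r ?ahalf_gt0 //.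
  by apply: le_trans hs; apply: ler_weXn2l => //; rewrite lerDl ltW.
pose Pe := \sum_(b <- words_le (@irred d) J | ~~ odd (size b)) mu^-1 ^+ size b.
pose Po := \sum_(b <- words_le (@irred d) J | odd (size b)) mu^-1 ^+ size b.
have PP : gf (@irred d) J mu^-1 = Po + Pe by rewrite /gf (bigID (fun b : word d => odd (size b))).
have Pe0 : 0 <= Pe by apply: sumr_ge0 => b _; rewrite exprn_ge0 // ltW.
have J1 : (0 < J)%N.
  rewrite lt0n; apply/negP => /eqP J0; move: hJ; rewrite J0 /gf.
  rewrite big_seq big1 ?ltr_geF //; last first.
    move=> b; rewrite mem_words_le leqn0 size_eq0 => /andP[ib /eqP b0].
    by move: ib; rewrite b0 /irred /= andbF.
  by apply/negP; rewrite -leNgt subr_ge0 (le_trans te) // ler_pdivrMr // mul1r (le_trans (ltW lt1)) // ler1n.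
have Po1 : mu^-1 <= Po.
  rewrite /Po -big_filter.
  have := @ler_sum_sub_seq _ _ [:: [:: e1 d]] [seq b <- words_le (@irred d) J | odd (size b)]
     (fun b => mu^-1 ^+ size b); rewrite big_seq1 /= expr1; apply => //.
    by move=> b; rewrite inE => /eqP->; rewrite mem_filter mem_words_le irred_e1.
  by move=> b _; rewrite exprn_ge0 // ltW.
have P1 := gf_irred_le1 R d J; rewrite PP in P1 hJ.
have main : th * (Po * ahalf n + Pe * ahalf n.+1) <= ahalf n.+1.
  apply: le_trans (sum_ahalf_le Jn); rewrite [leRHS](bigID (fun b : word d => odd (size b))) /=.
  rewrite mulrDr; apply: lerD.
    rewrite /Po mulr_suml mulr_sumr big_seq_cond [leRHS]big_seq_cond; apply: ler_sum => b.
    rewrite mem_words_le => /andP[/andP[_ bJ] ob]; rewrite mulrCA ler_wpM2l ?exprn_ge0 ?(ltW imu0) //.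
    by have [E g1 g2] := odd_shift nn bJ ob; have := low _ _ g1 g2; rewrite -E.
  rewrite /Pe mulr_suml mulr_sumr big_seq_cond [leRHS]big_seq_cond; apply: ler_sum => b.
  rewrite mem_words_le => /andP[/andP[_ bJ] ob]; rewrite mulrCA ler_wpM2l ?exprn_ge0 ?(ltW imu0) //.
  by have [E g1 g2] := even_shift nn bJ ob; have := low _ _ g1 g2; rewrite -E.
have Po0 : 0 < Po := lt_le_trans imu0 Po1.
have [c1 c3] := renewal_arith e0 imu0 im1 th0 th1 Po1 Pe0 hJ.
have c2 : th * Po * ahalf n <= (Po + 2 * t) * ahalf n.+1.
  apply: (@le_trans _ _ ((1 - th * Pe) * ahalf n.+1)); last by rewrite ler_wpM2r // ltW.
  by move: main; rewrite mulrDr mulrBl mul1r lerBrDr !mulrA.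
have q0 : 0 < Po + 2 * t by rewrite addr_gt0 // mulr_gt0.
rewrite -(ler_pM2l q0); apply: le_trans c2; rewrite mulrA [_ * (1 - e)]mulrC.
by rewrite ler_pM2r.
Qed.

Lemma dist_ratio_le (e x y : R) : 0 < e -> e <= 1 / 2 -> 0 < x -> 0 < y ->
  (1 - e) * x <= y -> (1 - e) * y <= (1 + e) * x -> `|1 - x / y| <= 4 * e.
Proof.
move=> e0 eh x0 y0 l1 l4.
have q0 : 0 < 1 - e by rewrite subr_gt0; lra.
have ex := mulr_gt0 e0 x0; have ey := mulr_gt0 e0 y0.
have eex := mulr_gt0 e0 ex.
rewrite ler_norml lerBrDr lerBlDl -lerBlDr; apply/andP; split.
  have : x / y <= 1 + 4 * e; last by move=> ?; lra.
  rewrite ler_pdivrMr // -(ler_pM2l q0); apply: (le_trans l1).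
  have e2 : e * e * y <= 1 / 2 * (e * y) by rewrite -mulrA ler_pM2r.
  nra.
rewrite ler_pdivlMr // -(ler_pM2l q0).
have [neg|pos] := lerP (1 - 4 * e) 0.
  apply: (@le_trans _ _ 0); last by rewrite mulr_ge0 // ltW.
  by rewrite mulr_ge0_le0 ?(ltW q0) // mulr_le0_ge0 // ltW.
rewrite mulrCA; apply: (@le_trans _ _ ((1 - 4 * e) * ((1 + e) * x))).
  by rewrite ler_pM2l.
nra.
Qed.

(** The missing upper bound on a_(n+1) / a_n follows from a_(n+1) <= (1 + e) a_(n-1) and (1 - e)
    a_(n-1) <= a_n. *)
Lemma cvg_nhalf_ratio : nhalf n / nhalf n.+1 @[n --> \oo] --> mu^-1.
Proof.
have mu0 := mu_gt0 R d; have imu0 : 0 < mu^-1 by rewrite invr_gt0.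
apply/cvgrPdist_le => e e0.
have [e1 e10 he1] : exists2 e1 : R, 0 < e1 <= 1 / 2 & 4 * e1 * mu^-1 <= e.
  exists (Num.min (1 / 2) (e * mu / 4)).
    by rewrite lt_min ge_min lexx !divr_gt0 //= mulr_gt0.
  apply: (@le_trans _ _ (4 * (e * mu / 4) * mu^-1)).
    by rewrite ler_pM2r // ler_pM2l // ge_min lexx orbT.
  by rewrite le_eqVlt; apply/orP; left; apply/eqP; field; rewrite gt_eqF.
case/andP: e10 => e10 e1h.
have [n1 h1] := ahalf_ratio_lower e10.
have [n2 h2] := ahalf_add2_le e10.
exists (maxn n1 n2).+1 => // n; rewrite /= gtn_max => /andP[nn1 nn2].
have [a0 a1 a2] : [/\ 0 < ahalf n.-1, 0 < ahalf n & 0 < ahalf n.+1] by split; apply: ahalf_gt0.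
have nE : n.-1.+1 = n by rewrite prednK // (leq_ltn_trans _ nn1).
have l1 : (1 - e1) * ahalf n <= ahalf n.+1 by apply: h1; apply: ltnW.
have l2 : (1 - e1) * ahalf n.-1 <= ahalf n by rewrite -{2}nE; apply: h1; rewrite -ltnS nE.
have l3 : ahalf n.+1 <= (1 + e1) * ahalf n.-1 by rewrite -{1}nE; apply: h2; rewrite -ltnS nE.
have -> : nhalf n / nhalf n.+1 = mu^-1 * (ahalf n / ahalf n.+1).
  rewrite /ahalf exprS; field; rewrite !gt_eqF ?nhalf_gt0 ?exprn_gt0 //.
rewrite -{1}[mu^-1]mulr1 -mulrBr normrM gtr0_norm // mulrC -ler_pdivlMr //.
apply: (@le_trans _ _ (4 * e1)); last by rewrite ler_pdivlMr.
have l4 : (1 - e1) * ahalf n.+1 <= (1 + e1) * ahalf n.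
  apply: (@le_trans _ _ ((1 - e1) * ((1 + e1) * ahalf n.-1))).
    by rewrite ler_wpM2l // subr_ge0; lra.
  by rewrite mulrCA ler_pM2l // addr_gt0.
exact: dist_ratio_le.
Qed.

End RatioLimit.

(** * Limits of real sequences *)

Section Limits.
Context (R : realType).

Lemma cvg_sum_seq (T : eqType) (s : seq T) (f : T -> nat -> R) (l : T -> R) :
  (forall x, x \in s -> f x n @[n --> \oo] --> l x) ->
  \sum_(x <- s) f x n @[n --> \oo] --> \sum_(x <- s) l x.
Proof.
elim: s => [|x s IH] h.
  rewrite big_nil; rewrite [X in X @ _ --> _](_ : _ = fun=> 0); first exact: cvg_cst.
  by apply/funext => n; rewrite big_nil.
rewrite big_cons [X in X @ _ --> _](_ : _ = fun n => f x n + \sum_(y <- s) f y n); last first.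
  by apply/funext => n; rewrite big_cons.
apply: cvgD; first by apply: h; rewrite mem_head.
by apply: IH => y ys; apply: h; rewrite inE ys orbT.
Qed.

Lemma cvg_subn (f : nat -> R) (l : R) j :
  f n @[n --> \oo] --> l -> f (n - j)%N @[n --> \oo] --> l.
Proof. by move=> h; apply: (cvg_comp _ f (@cvg_subnr j)). Qed.

Lemma cvg_eventually_eq (f g : nat -> R) (l : R) N :
  (forall n, (N <= n)%N -> f n = g n) -> f n @[n --> \oo] --> l -> g n @[n --> \oo] --> l.
Proof. by move=> fg; apply: cvg_trans; apply: near_eq_cvg; exists N. Qed.

Lemma cvg_approx (f : nat -> R) :
  (forall e : R, 0 < e -> exists (g : nat -> R) (l : R), g n @[n --> \oo] --> l /\
    \forall n \near \oo, `|f n - g n| <= e) -> exists l : R, f n @[n --> \oo] --> l.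
Proof.
move=> h; suff c : cvg (f n @[n --> \oo]) by exists (lim (f n @[n --> \oo])).
apply: cauchy_cvg; apply: cauchy_exP => e e0.
have e20 : 0 < e / 2 by rewrite divr_gt0.
have [g [l [gl fg]]] := h _ e20; exists l.
have {}gl : \forall n \near \oo, `|l - g n| < e / 2 by move/cvgrPdist_lt: gl; apply.
change (\forall n \near \oo, ball l e (f n)); near=> n; rewrite -ball_normE /=.
have -> : l - f n = (l - g n) - (f n - g n) by rewrite opprB addrA subrK.
rewrite (le_lt_trans (ler_normB _ _)) // [e]splitr ltr_leD //.
  by near: n.
by near: n.
Unshelve. all: end_near. Qed.

End Limits.

(** * Convergence of prefix frequencies *)

Section PrefixLimit.
Context (R : realType) (d : nat).
Implicit Types (u v w b : word d).
Local Notation mu := (mu R d).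
Local Notation nhalf := (nhalf R d).

Lemma cvg_nhalf_shift j : nhalf (n - j)%N / nhalf n @[n --> \oo] --> mu^-1 ^+ j.
Proof.
elim: j => [|j IH].
  rewrite expr0 [X in X @ _ --> _](_ : _ = fun=> 1); first exact: cvg_cst.
  by apply/funext => n; rewrite subn0 divff // gt_eqF // nhalf_gt0.
rewrite exprS; apply: (cvg_eventually_eq (N := j.+1)) (cvgM (cvg_subn j.+1 (@cvg_nhalf_ratio R d)) IH) => n jn /=.
rewrite -subSn // subSS mulrA divfK // gt_eqF // nhalf_gt0 //.
Qed.

Definition prefix_count u n := cnt (fun w => half w && prefix u w) n.
Definition prefix_freq u n : R := (prefix_count u n)%:R / nhalf n.

Lemma prefix_cat_long u b v : (size u <= size b)%N -> prefix u (b ++ v) = prefix u b.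
Proof. by move=> ub; rewrite !prefixE takel_cat. Qed.

Lemma prefix_cat_short u b v : (size b <= size u)%N ->
  prefix u (b ++ v) = prefix b u && prefix (drop (size b) u) v.
Proof.
move=> bu; rewrite -{1}(cat_take_drop (size b) u) prefix_catr ?size_takel //.
by rewrite (prefixE b).
Qed.

Lemma cnt_predC (P Q : pred (word d)) n :
  (cnt (fun w => P w && Q w) n + cnt (fun w => P w && ~~ Q w) n = cnt P n)%N.
Proof.
have E S : cnt (fun w => P w && S w) n = count S (wf P n).
  by rewrite /wf count_filter; apply: eq_count => w /=; rewrite andbC.
by rewrite !E -size_wf -(count_predC Q).
Qed.

(** The approximants keep the walks that start with an irreducible bridge b of length at most J.
    Either b is at least as long as u and decides the prefix, or it has to be a prefix of u and
    leaves a shorter word. *)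
Lemma prefix_freq_cvg u : exists l : R, prefix_freq u n @[n --> \oo] --> l.
Proof.
have [k] := ubnP (size u); elim: k u => // k IH u; rewrite ltnS => uk.
have mu0 := mu_gt0 R d.
apply: cvg_approx => e e0.
have [J hJ] : exists n, 1 - e < gf (@irred d) n mu^-1 by apply: gf_irred_near1; rewrite gtrBl.
pose c (b : word d) n : R := (cnt (fun v => half v && prefix u (b ++ v)) (n - size b))%:R / nhalf n.
have cC b : exists l : R, b \in words_le (@irred d) J -> c b n @[n --> \oo] --> l.
  have [|] := boolP (b \in _); last by exists 0.
  rewrite mem_words_le => /andP[/and3P[_ b0 _] _].
  have zero : (forall v, prefix u (b ++ v) = false) -> exists l : R, true -> c b n @[n --> \oo] --> l.
    move=> pf; exists 0 => _; apply: (cvg_eventually_eq (N := 0)) (cvg_cst (0 : R)) => n _.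
    rewrite /c /cnt (eq_count (a2 := pred0)) ?count_pred0 ?mul0r // => v /=.
    by rewrite pf andbF.
  have [ub|bu] := leqP (size u) (size b).
    have [pb|/negbTE pb] := boolP (prefix u b); last by apply: zero => v; rewrite prefix_cat_long.
    exists (mu^-1 ^+ size b) => _.
    apply: (cvg_eventually_eq (N := 0) _ (@cvg_nhalf_shift (size b))) => n _.
    by congr (_%:R / _); apply: eq_count => v; rewrite /= prefix_cat_long // pb andbT.
  have [pb|/negbTE pb] := boolP (prefix b u); last first.
    by apply: zero => v; rewrite (prefix_cat_short _ (ltnW bu)) pb.
  have [l hl] : exists l : R, prefix_freq (drop (size b) u) n @[n --> \oo] --> l.
    apply: IH; rewrite size_drop (leq_trans _ uk) // ltn_subrL lt0n size_eq0 b0.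
    exact: leq_ltn_trans bu.
  exists (l * mu^-1 ^+ size b) => _.
  apply: (cvg_eventually_eq (N := 0) _ (cvgM (cvg_subn (size b) hl) (@cvg_nhalf_shift (size b)))).
  move=> n _ /=; rewrite /prefix_freq mulrA divfK ?gt_eqF ?nhalf_gt0 //.
  congr (_%:R / _); apply: eq_count => v.
  by rewrite /= (prefix_cat_short _ (ltnW bu)) pb.
have [L hL] := choice cC.
exists (fun n => \sum_(b <- words_le (@irred d) J) c b n), (\sum_(b <- words_le (@irred d) J) L b).
split; first exact: cvg_sum_seq.
have S : \sum_(b <- words_le (@irred d) J) (nhalf (n - size b)%N / nhalf n) @[n --> \oo]
    --> gf (@irred d) J mu^-1.
  by apply: cvg_sum_seq => b _; apply: cvg_nhalf_shift.
have {}S : \forall n \near \oo,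
    1 - e < \sum_(b <- words_le (@irred d) J) (nhalf (n - size b)%N / nhalf n).
  exact: cvgr_gt S _ hJ.
near=> n.
have Jn : (J <= n)%N by near: n; exists J.
have Sn : 1 - e < \sum_(b <- words_le (@irred d) J) (nhalf (n - size b)%N / nhalf n) by near: n.
have n0 := nhalf_gt0 R d n.
(* A and B bound from below the walks with and without prefix u. Since A + B exceeds (1 - e) $h_n$,
   A misses at most e $h_n$ of the former. *)
pose A := (\sum_(b <- words_le (@irred d) J)
  cnt (fun v => half v && prefix u (b ++ v)) (n - size b))%N.
pose B := (\sum_(b <- words_le (@irred d) J)
  cnt (fun v => half v && ~~ prefix u (b ++ v)) (n - size b))%N.
have le_A : (A <= prefix_count u n)%N := sum_irred_le (prefix u) Jn.
have le_B : (B <= cnt (fun w => half w && ~~ prefix u w) n)%N := sum_irred_le (predC (prefix u)) Jn.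
have := cnt_predC (@half d) (prefix u) n; rewrite -/(prefix_count u n).
rewrite -mulr_suml in Sn; rewrite /c -mulr_suml /prefix_freq -mulrBl.
rewrite normrM [ `|_^-1| ]gtr0_norm ?invr_gt0 // ler_pdivrMr //.
rewrite -natr_sum -/A -natrB // normr_nat => T.
have : nhalf n - e * nhalf n < (A + B)%:R.
  have -> : (A + B = \sum_(b <- words_le (@irred d) J) cnt (@half d) (n - size b))%N.
    by rewrite /A /B -big_split; apply: eq_bigr => b _; apply: cnt_predC.
  by rewrite natr_sum; move: Sn; rewrite ltr_pdivlMr // mulrBl mul1r.
have : (prefix_count u n - A <= cnt (@half d) n - (A + B))%N by lia.
have ABn : (A + B <= cnt (@half d) n)%N by rewrite -T leq_add.
by rewrite -(ler_nat R) (natrB _ ABn); lra.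
Unshelve. all: end_near. Qed.

Definition prefix_lim u : R := lim (prefix_freq u n @[n --> \oo]).

Lemma cvg_prefix_freq u : prefix_freq u n @[n --> \oo] --> prefix_lim u.
Proof. by have [l /cvgP] := prefix_freq_cvg u. Qed.

Lemma prefix_limE u (f : nat -> R) (l : R) N :
  (forall n, (N <= n)%N -> f n = prefix_freq u n) -> f n @[n --> \oo] --> l -> prefix_lim u = l.
Proof.
move=> fu fl; apply/(@cvg_lim R); first exact: Rhausdorff.
exact: (cvg_eventually_eq fu fl).
Qed.

Lemma prefix_lim_ge0 u : 0 <= prefix_lim u.
Proof.
apply: limr_ge; first exact: cvg_prefix_freq.
by near=> n; rewrite /prefix_freq divr_ge0.
Unshelve. all: end_near. Qed.

Lemma prefix_lim_nil : prefix_lim [::] = 1.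
Proof.
apply: (@prefix_limE _ (fun=> 1) _ 0 _ (cvg_cst _)) => n _.
rewrite /prefix_freq (_ : (prefix_count _ _)%:R = nhalf n) ?divff ?gt_eqF ?nhalf_gt0 //.
by congr (_%:R); apply: eq_count => w; rewrite /= prefix0s andbT.
Qed.

(** This confines the limit law to self-avoiding paths. *)
Lemma prefix_lim_eq0 u : ~~ half u -> prefix_lim u = 0.
Proof.
move=> hu; apply: (@prefix_limE _ (fun=> 0) _ 0 _ (cvg_cst _)) => n _.
rewrite /prefix_freq (_ : prefix_count u n = 0%N) ?mul0r //.
apply/eqP; rewrite -leqn0 leqNgt -has_count; apply/hasPn => w _.
apply/negP => /andP[hw /prefixP[v wE]]; move: hw; rewrite wE => /half_catl.
by rewrite (negbTE hu).
Qed.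

Lemma prefix_rconsE u w : (size u < size w)%N ->
  nat_of_bool (prefix u w) = (\sum_(s : step d) prefix (rcons u s) w)%N.
Proof.
move=> uw; have [pu|npu] := boolP (prefix u w); last first.
  rewrite big1 // => s _; apply/eqP; rewrite eqb0; apply: contra npu.
  exact/prefix_trans/prefix_rcons.
have [[|t v] wE] := prefixP pu; first by rewrite wE cats0 ltnn in uw.
rewrite (bigD1 t) //= big1 => [|s /negbTE st].
  by rewrite wE -cat_rcons prefix_prefix addn0.
by rewrite wE -cats1 prefix_catr // eqxx prefix_cons st.
Qed.

Lemma prefix_lim_split u : prefix_lim u = \sum_(s : step d) prefix_lim (rcons u s).
Proof.
have h : \sum_(s <- index_enum (step d)) prefix_freq (rcons u s) n @[n --> \oo]
    --> \sum_(s : step d) prefix_lim (rcons u s).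
  by apply: cvg_sum_seq => s _; apply: cvg_prefix_freq.
apply: (prefix_limE (N := (size u).+1) _ h) => n un.
rewrite /prefix_freq -mulr_suml -natr_sum; congr (_%:R / _).
transitivity (\sum_(s : step d) \sum_(w <- words d n) (half w && prefix (rcons u s) w))%N.
  by apply: eq_bigr => s _; rewrite /prefix_count /cnt -sum1_count big_mkcond.
rewrite exchange_big /prefix_count /cnt -sum1_count [RHS]big_mkcond /=.
apply: eq_big_seq => w; rewrite mem_words => /eqP sw.
have [hw|] := boolP (half w); last by rewrite /= big1.
by rewrite /= -prefix_rconsE ?sw //; case: ifP.
Qed.

End PrefixLimit.

(** * The limit measure *)

Section NestedIntervals.
Context (R : realType) (T : finType) (p : seq T -> R).
Context (p_ge0 : forall u, 0 <= p u).
Context (p_split : forall u, p u = \sum_t p (rcons u t)).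
Implicit Types (u v w : seq T) (s t : T) (x : R).

Definition psum u k : R := \sum_(t | (enum_rank t < k)%N) p (rcons u t).

Lemma psum_rankS u s : psum u (enum_rank s).+1 = psum u (enum_rank s) + p (rcons u s).
Proof.
rewrite /psum (bigD1 s) //= addrC; congr (_ + _); apply: eq_bigl => t.
rewrite ltnS [RHS]ltn_neqAle andbC; congr (~~ _ && _).
by rewrite -(inj_eq enum_rank_inj).
Qed.

Lemma psum_le u j k : (j <= k)%N -> psum u j <= psum u k.
Proof.
move=> jk; rewrite /psum [leLHS]big_mkcond [leRHS]big_mkcond.
apply: ler_sum => t _; case: ifP => [tj|_]; last by case: ifP.
by rewrite (leq_trans tj).
Qed.

Lemma psum0 u : psum u 0 = 0. Proof. exact: big_pred0. Qed.

Lemma psum_all u : psum u #|T| = p u.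
Proof. by rewrite p_split; apply: eq_bigl => t; rewrite ltn_ord. Qed.

Fixpoint left_end_from v w : R :=
  if w is s :: w' then psum v (enum_rank s) + left_end_from (rcons v s) w' else 0.
Definition left_end w := left_end_from [::] w.

Lemma left_end_rcons w s : left_end (rcons w s) = left_end w + psum w (enum_rank s).
Proof.
rewrite /left_end -[X in psum X]/([::] ++ w).
elim: w [::] => [|t w IH] v /=; first by rewrite cats0 addr0 add0r.
by rewrite IH cat_rcons addrA.
Qed.

(* The blocks of the words rcons u s partition the block of u. *)
Definition inblock u x := left_end u <= x < left_end u + p u.

Lemma inblock_rcons u s x : inblock (rcons u s) x =
  (psum u (enum_rank s) <= x - left_end u < psum u (enum_rank s).+1).
Proof. by rewrite /inblock left_end_rcons psum_rankS lerBrDl ltrBlDl addrA. Qed.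

Lemma inblock_sub u s x : inblock (rcons u s) x -> inblock u x.
Proof.
rewrite inblock_rcons => /andP[l r]; apply/andP; split.
  by rewrite -subr_ge0; apply: le_trans l; rewrite -(psum0 u) psum_le.
by rewrite -ltrBlDl; apply: lt_le_trans r _; rewrite -(psum_all u) psum_le.
Qed.

Lemma inblock_inj u s t x : inblock (rcons u s) x -> inblock (rcons u t) x -> s = t.
Proof.
rewrite !inblock_rcons => /andP[ls rs] /andP[lt rt]; apply: enum_rank_inj; apply: val_inj.
have [st|st|//] := ltngtP (enum_rank s) (enum_rank t).
  by have := lt_le_trans rs (psum_le u st); rewrite ltNge lt.
by have := lt_le_trans rt (psum_le u st); rewrite ltNge ls.
Qed.

Lemma inblock_child u x : inblock u x -> exists s, inblock (rcons u s) x.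
Proof.
move=> /andP[]; rewrite -subr_ge0 -ltrBlDl -psum_all => l r.
have ex : exists k, x - left_end u < psum u k by exists #|T|.
case: (ex_minnP ex) => -[|k] hk min; first by move: hk; rewrite psum0 ltNge l.
have kT : (k < #|T|)%N by apply: min.
exists (enum_val (Ordinal kT)); rewrite inblock_rcons enum_valK hk andbT /=.
by rewrite leNgt; apply/negP => /min; rewrite ltnn.
Qed.

(** For x in the block of the empty word some child block always contains x, by [inblock_child]; the
    other branch is a default. *)
Fixpoint code x n : seq T :=
  if n is n'.+1 then
    let u := code x n' in
    if [pick s | inblock (rcons u s) x] is Some s then rcons u s else u
  else [::].

Lemma code_inblock x n : inblock [::] x -> inblock (code x n) x.
Proof. by move=> h; elim: n => //= n IH; case: pickP. Qed.

Lemma codeS x n : inblock [::] x -> exists s, code x n.+1 = rcons (code x n) s.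
Proof.
move=> h /=; case: pickP => [s _|none]; first by exists s.
by have [s] := inblock_child (code_inblock n h); rewrite none.
Qed.

Lemma size_code x n : inblock [::] x -> size (code x n) = n.
Proof.
move=> h; elim: n => // n IH; have [s ->] := codeS n h.
by rewrite size_rcons IH.
Qed.

Lemma take_code x m n : inblock [::] x -> (m <= n)%N -> take m (code x n) = code x m.
Proof.
move=> h; elim: n => [|n IH]; first by rewrite leqn0 => /eqP->.
rewrite leq_eqVlt => /orP[/eqP->|mn].
  by rewrite -{1}(size_code n.+1 h) take_size.
have [s ->] := codeS n h; rewrite -cats1 takel_cat ?size_code //.
exact: IH.
Qed.

Lemma code_eq x u : inblock [::] x -> (code x (size u) == u) = inblock u x.
Proof.
move=> h; apply/eqP/idP => [<-|]; first exact: code_inblock.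
elim/last_ind: u => // u s IH us; rewrite size_rcons.
have uE := IH (inblock_sub us).
have [t tE] := codeS (size u) h; rewrite tE uE; congr rcons.
have := code_inblock (size u).+1 h; rewrite tE uE => /inblock_inj; exact.
Qed.

Lemma block_itv u : [set x | inblock u x] = [set` `[left_end u, left_end u + p u[].
Proof. by apply/seteqP; split => x; rewrite /= in_itv. Qed.

Lemma measurable_block u : measurable ([set x | inblock u x] : set R).
Proof. by rewrite block_itv; apply: measurable_itv. Qed.

Lemma lebesgue_measure_block u : lebesgue_measure ([set x | inblock u x] : set R) = (p u)%:E.
Proof.
rewrite block_itv lebesgue_measure_itv /= lte_fin ltrDl.
have := p_ge0 u; rewrite le_eqVlt => /orP[/eqP<-|->]; first by rewrite ltxx.
by rewrite -EFinB addrAC subrr add0r.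
Qed.

End NestedIntervals.

(** * Words versus sequences of lattice points *)

Section Paths.
Context (R : realType) (d : nat).
Implicit Types (u v w : word d) (s : step d).

Lemma sum_sqr_sv s : \sum_i sv s 0 i ^+ 2 = 1.
Proof.
rewrite (bigD1 s.1) //= big1 ?addr0 => [|i /negbTE is1]; last by rewrite svE is1 expr0n.
by rewrite svE eqxx; case: s.2.
Qed.

Lemma sum_sqr_eq1 (x : lattice d) : \sum_i x 0 i ^+ 2 = 1 -> exists s, x = sv s.
Proof.
move=> x1; have [i xi] : exists i, x 0 i != 0.
  apply/not_existsP => h; move: x1; rewrite big1 // => i _.
  by have /negP/negPn/eqP-> := h i; rewrite expr0n.
have xi1 : 1 <= x 0 i ^+ 2 by rewrite -gtz0_ge1 exprn_even_gt0.
have rest0 : \sum_(j | j != i) x 0 j ^+ 2 = 0.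
  apply/eqP; rewrite eq_le sumr_ge0 ?andbT => [|j _]; last exact: sqr_ge0.
  by move: x1; rewrite (bigD1 i) //= => x1; rewrite -(lerD2l (x 0 i ^+ 2)) x1 addr0.
have x0 j : j != i -> x 0 j = 0.
  move=> ji; apply/eqP; rewrite -sqrf_eq0; move/eqP: rest0.
  by rewrite psumr_eq0 => [|k _]; [move/allP => /(_ j (mem_index_enum j)); rewrite ji|exact: sqr_ge0].
have : x 0 i ^+ 2 == 1 by move: x1; rewrite (bigD1 i) //= rest0 addr0 => ->.
rewrite sqrf_eq1 => xb; exists (i, x 0 i == 1); apply/rowP => j; rewrite svE /=.
have [->|/x0 //] := eqVneq j i.
by case/orP: xb => /eqP->.
Qed.

Lemma disp_rcons w s : disp (rcons w s) = disp w + sv s.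
Proof. by rewrite -cats1 disp_cat /= addr0. Qed.

Lemma disp_takeS w j s : (j < size w)%N ->
  disp (take j.+1 w) = disp (take j w) + sv (nth s w j).
Proof. by move=> jw; rewrite (take_nth s jw) disp_rcons. Qed.

Lemma traj_takeE x w : traj x w = [seq x + disp (take j w) | j <- iota 0 (size w).+1].
Proof.
elim: w x => [|s w IH] x; first by rewrite traj_nil /= addr0.
rewrite traj_cons IH -[iota 0 (size (s :: w)).+1]/(0%N :: iota (1 + 0) (size w).+1) iotaDl map_cons addr0 -map_comp.
by congr (_ :: _); apply: eq_map => j /=; rewrite addrA.
Qed.

Lemma traj0_takeE w : traj 0 w = [seq disp (take j w) | j <- iota 0 (size w).+1].
Proof. by rewrite traj_takeE; apply: eq_map => j; rewrite add0r. Qed.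

Lemma eq_from_disp_take u v n : size u = n -> size v = n ->
  (forall j, (j <= n)%N -> disp (take j u) = disp (take j v)) -> u = v.
Proof.
move=> su sv' h; apply: (@eq_from_nth _ (e1 d)); first by rewrite su sv'.
move=> j; rewrite su => jn; apply: sv_inj; have := h _ jn.
rewrite (disp_takeS (e1 d)) ?su // (disp_takeS (e1 d)) ?sv' // h ?(ltnW jn) //.
exact: addrI.
Qed.

Definition path_of n w : fseq d n := [ffun j : 'I_n.+1 => disp (take j w)].

Lemma path_of_inj n u v : size u = n -> size v = n -> path_of n u = path_of n v -> u = v.
Proof.
move=> su sv' /ffunP h; apply: (eq_from_disp_take su sv') => j jn.
by have := h (Ordinal (jn : (j < n.+1)%N)); rewrite !ffunE.
Qed.

Lemma enorm_sv s : enorm R (sv s) = 1.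
Proof. by apply/enorm1P/sum_sqr_sv. Qed.

Lemma nearest_neighbour_path n (w : fseq d n) : w ord0 = 0 ->
  (forall i j : 'I_n.+1, j = i.+1 :> nat -> enorm R (w j - w i) = 1) ->
  exists2 u, size u = n & w = path_of n u.
Proof.
move=> w0 w1.
suff [u su hu] : exists2 u, size u = n & forall j : 'I_n.+1, (j <= n)%N -> w j = disp (take j u).
  by exists u => //; apply/ffunP => j; rewrite ffunE hu // -ltnS.
suff H m : (m <= n)%N ->
    exists2 u, size u = m & forall j : 'I_n.+1, (j <= m)%N -> w j = disp (take j u) by exact: H.
elim: m => [|m IH] mn.
  exists [::] => // j; rewrite leqn0 => /eqP j0; have -> : j = ord0 by apply: val_inj.
  exact: w0.
have [u su hu] := IH (ltnW mn).
have jm : (m < n.+1)%N by apply: ltnW.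
have /enorm1P/sum_sqr_eq1[s sE] := w1 (Ordinal jm) (Ordinal (mn : (m.+1 < n.+1)%N)) erefl.
exists (rcons u s); first by rewrite size_rcons su.
move=> j; rewrite leq_eqVlt ltnS => /orP[/eqP jE|jm']; last by rewrite -cats1 takel_cat ?su // hu.
rewrite jE take_oversize ?size_rcons ?su // disp_rcons -sE.
have -> : j = Ordinal (mn : (m.+1 < n.+1)%N) by apply: val_inj.
by rewrite (hu (Ordinal jm)) //= take_oversize ?su // addrC subrK.
Qed.

Lemma half_sawE n (w : fseq d n) :
  half_saw R d n w <-> exists u, [/\ size u = n, half u & w = path_of n u].
Proof.
split=> [[[w1 w2] w0 wH]|[u [su /andP[saw_u /allP]]]].
  have [u su wE] := nearest_neighbour_path w0 w1; exists u; split => //.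
  rewrite /half /saw /nonneg traj0_takeE su; apply/andP; split.
    rewrite map_inj_in_uniq ?iota_uniq // => i j; rewrite !mem_iota add0n /= => ni nj.
    have [ij|ji|//] := ltngtP i j => e.
      by case: (w2 (Ordinal ni) (Ordinal nj) ij); rewrite wE !ffunE.
    by case: (w2 (Ordinal nj) (Ordinal ni) ji); rewrite wE !ffunE.
  apply/allP => x /mapP[j]; rewrite mem_iota add0n /= => jn ->.
  by have := wH (Ordinal jn); rewrite wE /half_space /= ffunE.
rewrite traj0_takeE su => nw wE; split; first split.
- move=> i j ij; rewrite wE !ffunE ij (disp_takeS (e1 d)) ?su.
    by rewrite addrC addKr enorm_sv.
  by rewrite -ltnS -ij.
- move=> i j ij; rewrite wE !ffunE => e.
  have := disp_take_inj saw_u _ _ e; rewrite !inE su -ltnS ltn_ord -ltnS ltn_ord.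
  by move=> /(_ isT isT) ije; rewrite ije ltnn in ij.
- by rewrite wE ffunE take0.
- move=> j; rewrite /half_space /= wE ffunE; apply: nw; apply/mapP; exists (j : nat) => //.
  by rewrite mem_iota add0n ltn_ord.
Qed.

End Paths.

(** * The uniform measure in terms of words *)

Section UniformHalfSaw.
Context (R : realType) (d : nat).
Implicit Types (u v w : word d).

Lemma card_fset_set_seq (T : choiceType) (S : set T) (s : seq T) :
  uniq s -> (forall x, S x <-> x \in s) -> #|` fset_set S| = size s.
Proof.
move=> us hS; have -> : S = [set` [fset x in s]%fset].
  by apply/seteqP; split => x /=; rewrite in_fset_ /=; apply hS.
by rewrite set_fsetK card_fseq undup_id.
Qed.

Lemma starts_with_path_of k n (eta : fseq d k) w : (k <= n)%N -> size w = n ->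
  starts_with eta n (path_of n w) <-> eta = path_of k (take k w).
Proof.
move=> kn sw; split=> [h|-> i j ij]; last by rewrite !ffunE ij take_takel // -ltnS.
apply/ffunP => j; rewrite ffunE take_takel ?leq_ord //.
by rewrite -(h (widen_ord (kn : (k < n.+1)%N) j) j erefl) ffunE.
Qed.

Lemma unif_half_sawP n (A : set (fseq d n)) (Q : pred (word d)) :
  (forall w, size w = n -> A (path_of n w) <-> Q w) ->
  unif_half_saw R A = ((cnt (fun w => half w && Q w) n)%:R / nhalf R d n)%:E.
Proof.
have card (B : set (fseq d n)) (P : pred (word d)) :
    (forall w : fseq d n, B w <-> exists u, [/\ size u = n, P u & w = path_of n u]) ->
    #|` fset_set B| = cnt P n.
  move=> h; rewrite -size_wf -(size_map (@path_of d n)); apply: card_fset_set_seq.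
    rewrite map_inj_in_uniq ?uniq_wf // => u v; rewrite !mem_wf.
    by move=> /andP[_ /eqP su] /andP[_ /eqP sv'] /path_of_inj; apply.
  move=> w; rewrite h; split=> [[u [su Pu ->]]|/mapP[u]].
    by apply: map_f; rewrite mem_wf Pu su /=.
  by rewrite mem_wf => /andP[Pu /eqP su] ->; exists u.
move=> hA; rewrite /unif_half_saw (card (half_saw R d n) (@half d)); last by move=> w; apply: half_sawE.
rewrite (card _ (fun w => half w && Q w)) // => w; split.
  by move=> [/half_sawE[u [su hu ->]] /hA Qu]; exists u; rewrite hu Qu.
by move=> [u [su /andP[hu Qu] ->]]; split; [apply/half_sawE; exists u|apply/hA].
Qed.

Lemma unif_half_saw_starts_with k n u : size u = k -> (k <= n)%N ->
  unif_half_saw R (starts_with (path_of k u) n) = (prefix_freq R u n)%:E.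
Proof.
move=> su kn; apply: unif_half_sawP => w sw; rewrite starts_with_path_of // prefixE su.
split=> [|/eqP-> //] /path_of_inj <-; rewrite ?eqxx //.
by rewrite size_takel ?sw.
Qed.

Lemma unif_half_saw_not_path k n (eta : fseq d k) : (k <= n)%N ->
  (forall u, size u = k -> eta <> path_of k u) -> unif_half_saw R (starts_with eta n) = 0%E.
Proof.
move=> kn h; rewrite (@unif_half_sawP _ _ xpred0) => [|w sw].
  by rewrite /cnt (eq_count (a2 := xpred0)) ?count_pred0 ?mul0r // => w; rewrite andbF.
by rewrite starts_with_path_of //; split=> // e; case: (h (take k w)); rewrite ?size_takel ?sw.
Qed.

End UniformHalfSaw.

(** * The random infinite path *)

Section LimitMeasure.
Context (R : realType) (d : nat).
Implicit Types (u v w : word d) (x : R).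
Local Notation inblock := (inblock (@prefix_lim R d)).
Local Notation code := (code (@prefix_lim R d)).

(** A block that contains a point has positive length. Hence the path coded by any point of the
    block of the empty word is self-avoiding, not just almost surely. *)
Lemma inblock_half u x : inblock u x -> half u.
Proof.
move=> /andP[l r]; apply/negPn/negP => /(prefix_lim_eq0 R) p0.
by move: (le_lt_trans l r); rewrite p0 addr0 ltxx.
Qed.

Definition coded_path x : nat -> lattice d := fun n => disp (code x n).

Lemma coded_path_inf_saw x : inblock [::] x -> inf_saw R d (coded_path x).
Proof.
move=> h; have sp := @prefix_lim_split R d; split; last by [].
split=> [j|i j ij]; rewrite /coded_path.
  by have [s ->] := codeS sp j h; rewrite disp_rcons addrC addKr enorm_sv.
have /inblock_half/andP[sw _] := code_inblock j h.
rewrite -(take_code sp h (ltnW ij)) -[code x j in RHS]take_size => e.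
have := disp_take_inj sw _ _ e; rewrite !inE (size_code sp) // ltnW // leqnn.
by move=> /(_ isT isT) ije; rewrite ije ltnn in ij.
Qed.

(* The law of the infinite path is the image of Lebesgue measure on [0, 1[. *)
Definition decode_path (x : measurableTypeR R) : g_sigma_algebraType (cylinders R d) :=
  let x0 : inf_saw R d := point in if inblock [::] x then insubd x0 (coded_path x) else x0.

Lemma val_decode_path x : inblock [::] x ->
  val (decode_path x : inf_saw R d) = coded_path x.
Proof. by move=> h; rewrite /decode_path h val_insubd mem_set //; apply: coded_path_inf_saw. Qed.

Lemma decode_path_starts_with x k u : inblock [::] x -> size u = k ->
  inf_starts_with R (path_of k u) (decode_path x) <-> inblock u x.
Proof.
move=> h su; have sp := @prefix_lim_split R d; rewrite -(code_eq (@prefix_lim_ge0 R d) sp) // su.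
rewrite /inf_starts_with /= val_decode_path // /coded_path.
split=> [e|/eqP e j]; last first.
  by rewrite ffunE -e (take_code sp) // leq_ord.
apply/eqP; apply: (eq_from_disp_take (size_code sp k h) su) => j jk.
by rewrite (take_code sp) // (e (Ordinal (jk : (j < k.+1)%N))) ffunE.
Qed.

Let unit_itv : set R := [set x | inblock [::] x].

Lemma preimage_path k u : size u = k ->
  unit_itv `&` decode_path @^-1` inf_starts_with R (path_of k u) = [set x | inblock u x].
Proof.
move=> su; apply/seteqP; split => x /=; first by move=> [x01 /decode_path_starts_with]; apply.
move=> xu; have x01 : inblock [::] x.
  elim/last_ind: u xu {su} => // u s IH.
  by move=> /(inblock_sub (@prefix_lim_ge0 R d) (@prefix_lim_split R d)).
by split => //; apply/decode_path_starts_with.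
Qed.

Lemma preimage_not_path k (eta : fseq d k) : (forall u, size u = k -> eta <> path_of k u) ->
  unit_itv `&` decode_path @^-1` inf_starts_with R eta = set0.
Proof.
move=> np; have sp := @prefix_lim_split R d.
apply/seteqP; split => // x [x01]; rewrite /inf_starts_with /= val_decode_path // => e.
apply: (np (code x k)); first exact: size_code.
by apply/ffunP => j; rewrite -e ffunE (take_code sp) // leq_ord.
Qed.

Let measurable_unit_itv : measurable unit_itv.
Proof. exact: measurable_block. Qed.

(** Cylinders generate the sigma-algebra; their preimages within the unit interval are blocks or
    empty, and outside it [decode_path] is constant. *)
Lemma measurable_decode_path : measurable_fun setT decode_path.
Proof.
apply: (@measurability _ _ (measurableTypeR R) _ setT decode_path (cylinders R d)) => //.
move=> _ [_ [k [eta ->]] <-]; rewrite setTI.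
have mI := measurable_unit_itv.
rewrite -[X in measurable X]setTI -(setUv unit_itv) setIUl; apply: measurableU.
  have [[u [su ->]]|np] := pselect (exists u, size u = k /\ eta = path_of k u).
    by rewrite preimage_path //; apply: measurable_block.
  rewrite preimage_not_path; first exact: measurable0.
  by move=> u su eE; apply: np; exists u.
have [pe|npe] := pselect (inf_starts_with R eta point).
  rewrite (_ : _ `&` _ = ~` unit_itv); first exact: measurableC.
  apply/seteqP; split => [x []//|x xn]; split => //; rewrite /preimage /mkset /decode_path.
  by case: ifP => // /xn.
rewrite (_ : _ `&` _ = set0); first exact: measurable0.
apply/seteqP; split => // x [xn]; rewrite /preimage /mkset /decode_path.
by case: ifP => [/xn//|_ /npe].
Qed.

HB.instance Definition _ := isMeasurableFun.Build _ _ _ _ decode_path measurable_decode_path.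

Definition unit_lebesgue := mrestr (@lebesgue_measure R) measurable_unit_itv.
HB.instance Definition _ := Measure.on unit_lebesgue.

Let unit_lebesgue_setT : unit_lebesgue setT = 1%E.
Proof.
rewrite /unit_lebesgue /mrestr setTI (lebesgue_measure_block (@prefix_lim_ge0 R d)).
by rewrite prefix_lim_nil.
Qed.
HB.instance Definition _ := Measure_isProbability.Build _ _ _ unit_lebesgue unit_lebesgue_setT.

Definition half_saw_limit : probability (g_sigma_algebraType (cylinders R d)) R :=
  distribution unit_lebesgue decode_path.

Lemma half_saw_limitE A :
  half_saw_limit A = lebesgue_measure (unit_itv `&` decode_path @^-1` A).
Proof. by rewrite setIC. Qed.

Lemma half_saw_limit_path k u : size u = k ->
  half_saw_limit (inf_starts_with R (path_of k u)) = (prefix_lim R u)%:E.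
Proof.
move=> su; rewrite half_saw_limitE preimage_path //.
exact: lebesgue_measure_block (@prefix_lim_ge0 R d) u.
Qed.

Lemma half_saw_limit_not_path k (eta : fseq d k) :
  (forall u, size u = k -> eta <> path_of k u) -> half_saw_limit (inf_starts_with R eta) = 0%E.
Proof. by move=> np; rewrite half_saw_limitE preimage_not_path // measure0. Qed.

End LimitMeasure.

Theorem mainTheorem1 (R : realType) (d : nat) :
  exists mu : probability (g_sigma_algebraType (cylinders R d)) R,
    forall (k : nat) (eta : fseq d k), (1 <= k)%N -> eta ord0 = 0 ->
      (fun n => unif_half_saw R (starts_with eta n)) @ \oo
        --> mu (inf_starts_with R eta).
Proof.
exists (half_saw_limit R d) => k eta _ _.
(* A sequence that is not a nearest-neighbour path from 0 has limit 0 on the left and probability 0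
   on the right. *)
have [[u [su ->]]|np] := pselect (exists u, size u = k /\ eta = path_of k u).
  rewrite half_saw_limit_path //; apply: cvg_EFin; first exact: nearW.
  apply: (cvg_eventually_eq (N := k) _ (@cvg_prefix_freq R d u)) => n kn; rewrite /comp.
  by rewrite unif_half_saw_starts_with.
have {}np u : size u = k -> eta <> path_of k u by move=> su e; apply: np; exists u.
rewrite half_saw_limit_not_path //; apply: cvg_EFin; first exact: nearW.
apply: (cvg_eventually_eq (N := k) _ (cvg_cst (0 : R))) => n kn; rewrite /comp.
by rewrite unif_half_saw_not_path.
Qed.
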